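(* Let $\Gamma$ be a discrete group and let $\varepsilon\in(0,1)$. Then the group von Neumann algebra $\mathrm{vN}(\Gamma)$ has the $\varepsilon$-separation property if and only if $\mathrm{vN}(\Gamma)$ is non-injective.
   Context: A von Neumann algebra $\mathrm{M}$ has the $\varepsilon$-separation property ($\varepsilon\in(0,1)$) if for every net $(\Phi_\lambda)_{\lambda\in\Lambda}$ of normal, finite rank, unital completely positive maps on $\mathrm{M}$ there are $x\in \mathrm{M}$ and $\omega\in \mathrm{M}_*$ with $\|x\|=\|\omega\|=1$ such that $\limsup_{\lambda\in\Lambda}|\langle x-\Phi_\lambda(x),\omega\rangle|>\varepsilon$. Injectivity of $\mathrm{M}$ is equivalent to the $w^*$-CPAP: existence of a net of normal, finite rank, unital completely positive maps on $\mathrm{M}$ converging to the identity in the point-ultraweak topology. *)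

(* Defs.v *)
From HB Require Import structures.
From mathcomp Require Import all_boot all_order all_algebra.
From mathcomp Require Import all_classical all_reals all_analysis.
From mathcomp Require Import complex ring.

Set Implicit Arguments.
Unset Strict Implicit.
Unset Printing Implicit Defensive.

Import Order.TTheory GRing.Theory Num.Theory.
Import numFieldNormedType.Exports.

Local Open Scope classical_set_scope.
Local Open Scope ring_scope.

(* The real-valued modulus of a complex number ([`|z|] lives in [R[i]]). *)
Notation cabs := Normc.normc.

Section Sums.
Context {R : realType} {I : choiceType}.

(* Unordered sums; only meant for absolutely summable families. *)
Definition rsum (f : I -> R) : R :=
  fine (\esum_(i in [set: I]) (EFin \o f)^\+%E i) -
  fine (\esum_(i in [set: I]) (EFin \o f)^\-%E i).

Definition csum (f : I -> R[i]) : R[i] :=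
  Complex (rsum (fun i => complex.Re (f i))) (rsum (fun i => complex.Im (f i))).

Definition sqsum (f : I -> R[i]) : \bar R :=
  \esum_(i in [set: I]) (cabs (f i) ^+ 2)%:E.

Lemma sqsum_ge0 (f : I -> R[i]) : (0 <= sqsum f)%E.
Proof. by apply: esum_ge0 => i _; rewrite lee_fin sqr_ge0. Qed.

Lemma cabs_sqD (a x y : R[i]) :
  cabs (a * x + y) ^+ 2 <= 2 * cabs a ^+ 2 * cabs x ^+ 2 + 2 * cabs y ^+ 2.
Proof.
have n0 (z : R[i]) : 0 <= cabs z by case: z => u v /=; exact: sqrtr_ge0.
have h : cabs (a * x + y) <= cabs a * cabs x + cabs y.
  by rewrite -Normc.normcM; exact: le_normcD.
apply: (@le_trans _ _ ((cabs a * cabs x + cabs y) ^+ 2)).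
  by rewrite ler_pXn2r ?nnegrE ?addr_ge0 ?mulr_ge0.
rewrite -mulrA -exprMn -subr_ge0.
have -> : forall s t : R, 2 * s ^+ 2 + 2 * t ^+ 2 - (s + t) ^+ 2 = (s - t) ^+ 2.
  by move=> s t; ring.
exact: sqr_ge0.
Qed.

Lemma sqsum_comb (a : R[i]) (f g : I -> R[i]) :
  (sqsum (a *: f + g)%R <=
   (2 * cabs a ^+ 2)%:E * sqsum f + 2%:E * sqsum g)%E.
Proof.
rewrite /sqsum.
have E (c : R) (h : I -> R[i]) : 0 <= c ->
    (\esum_(i in [set: I]) (c * cabs (h i) ^+ 2)%:E <=
     c%:E * \esum_(i in [set: I]) (cabs (h i) ^+ 2)%:E)%E.
  move=> c0; apply: ge_ereal_sup => _ [F [Ffin _] <-].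
  under eq_fsbigr do rewrite EFinM.
  rewrite -ge0_mule_fsumr//; last by move=> i; rewrite lee_fin sqr_ge0.
  apply: lee_pmul => //.
    by rewrite fsume_ge0// => i _; rewrite lee_fin sqr_ge0.
  by apply: ereal_sup_ubound; exists F.
have P (c : R) (h : I -> R[i]) i : 0 <= c -> (0 <= (c * cabs (h i) ^+ 2)%:E)%E.
  by move=> c0; rewrite lee_fin mulr_ge0 ?sqr_ge0.
have a0 : 0 <= 2 * cabs a ^+ 2 :> R by rewrite mulr_ge0 ?sqr_ge0.
apply: (le_trans _ (leeD (E _ f a0) (E 2 g (ler0n _ _)))).
rewrite -esumD; [|by move=> i _; exact: P..].
by apply: le_esum => i _; rewrite lee_fin; exact: cabs_sqD.
Qed.

End Sums.

Section Ell2.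
Variables (R : realType) (I : choiceType).

Definition square_summable : {pred (I -> R[i])} :=
  fun f => (sqsum f < +oo)%E.

Lemma square_summable_submod : submod_closed square_summable.
Proof.
split=> [|a f g].
  by rewrite unfold_in /sqsum esum1// => i _; rewrite Normc.normc0 expr0n.
rewrite !unfold_in => fo go; apply: (le_lt_trans (sqsum_comb _ _ _)).
apply: lte_add_pinfty; apply: lte_mul_pinfty; rewrite ?lee_fin//.
by rewrite mulr_ge0 ?sqr_ge0.
Qed.

HB.instance Definition _ :=
  GRing.isSubmodClosed.Build R[i] (I -> R[i]) square_summable
    square_summable_submod.

(* The Hilbert space of square-summable families; every Hilbert space is
   isometric to one of this form. *)
Record ell2 := Ell2 {
  ell2_fun :> I -> R[i];
  ell2_funP : ell2_fun \in square_summable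
}.

HB.instance Definition _ := [isSub of ell2 for ell2_fun].
HB.instance Definition _ := [Choice of ell2 by <:].
HB.instance Definition _ := [SubChoice_isSubLmodule of ell2 by <:].

(* Linear in the first variable. *)
Definition dot (xi eta : ell2) : R[i] := csum (fun i => xi i * conjc (eta i)).

Definition ell2_norm (xi : ell2) : R := Num.sqrt (fine (sqsum xi)).

Definition bounded_operator : {pred (ell2 -> ell2)} :=
  fun T => `[< linear T /\
    exists k : R, forall xi, ell2_norm (T xi) <= k * ell2_norm xi >].

Lemma ell2_norm_comb (a : R[i]) (xi eta : ell2) :
  ell2_norm (a *: xi + eta) ^+ 2 <=
  2 * cabs a ^+ 2 * ell2_norm xi ^+ 2 + 2 * ell2_norm eta ^+ 2.
Proof.
have fnum (z : ell2) : sqsum z \is a fin_num.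
  by rewrite ge0_fin_numE ?sqsum_ge0//; exact: (ell2_funP z).
have h (z : ell2) : ell2_norm z ^+ 2 = fine (sqsum z).
  by rewrite sqr_sqrtr// fine_ge0// sqsum_ge0.
rewrite !h -lee_fin EFinD !EFinM !fineK// -!EFinM.
exact: sqsum_comb.
Qed.

Lemma bounded_operator_submod : submod_closed bounded_operator.
Proof.
have norm0 : ell2_norm 0 = 0.
  rewrite /ell2_norm /sqsum esum1 ?sqrtr0// => i _.
  by rewrite Normc.normc0 expr0n.
split=> [|a S T].
  apply/asboolP; split=> [b x y|]; first by rewrite /= scaler0 addr0.
  by exists 0 => xi; rewrite /= norm0 mul0r.
move=> /asboolP[Sl [k Sk]] /asboolP[Tl [l Tl']]; apply/asboolP; split.
  move=> b x y.
  rewrite -[LHS]/(a *: S (b *: x + y) + T (b *: x + y)).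
  rewrite -[RHS]/(b *: (a *: S x + T x) + (a *: S y + T y)) Sl Tl.
  by rewrite !scalerDr !scalerA (mulrC a b) addrACA.
exists (Num.sqrt (2 * cabs a ^+ 2 * k ^+ 2 + 2 * l ^+ 2)) => xi.
have n0 z : 0 <= ell2_norm z by exact: sqrtr_ge0.
have c0 : 0 <= 2 * cabs a ^+ 2 * k ^+ 2 + 2 * l ^+ 2 :> R.
  by apply: addr_ge0; apply: mulr_ge0; rewrite ?sqr_ge0// mulr_ge0 ?sqr_ge0.
have sq (u v : R) : 0 <= u -> u <= v -> u ^+ 2 <= v ^+ 2.
  by move=> u0 uv; rewrite ler_pXn2r ?nnegrE// (le_trans u0).
rewrite -(@ler_pXn2r _ 2)// ?nnegrE ?mulr_ge0 ?sqrtr_ge0//.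
apply: (le_trans (ell2_norm_comb _ _ _)).
rewrite exprMn (sqr_sqrtr c0) [leRHS]mulrDl.
rewrite -[X in _ <= X + _]mulrA -[X in _ <= _ + X]mulrA.
rewrite -!exprMn; apply: lerD; last by rewrite ler_wpM2l ?sq.
by rewrite ler_wpM2l ?sq// mulr_ge0 ?sqr_ge0.
Qed.

HB.instance Definition _ :=
  GRing.isSubmodClosed.Build R[i] (ell2 -> ell2) bounded_operator
    bounded_operator_submod.

Record bop := Bop {
  bop_fun :> ell2 -> ell2;
  bop_funP : bop_fun \in bounded_operator
}.

HB.instance Definition _ := [isSub of bop for bop_fun].
HB.instance Definition _ := [Choice of bop by <:].
HB.instance Definition _ := [SubChoice_isSubLmodule of bop by <:].

Lemma bop1_subproof : (id : ell2 -> ell2) \in bounded_operator.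
Proof. by apply/asboolP; split=> //; exists 1 => xi; rewrite mul1r. Qed.

Definition bop1 : bop := Bop bop1_subproof.

Definition opnorm (T : bop) : R :=
  sup [set ell2_norm (T xi) | xi in [set xi | ell2_norm xi <= 1]].

Definition commutant (S : set bop) : set bop :=
  [set T : bop | forall s, S s -> T \o s =1 s \o T].

(* A pair of sequences of vectors with square-summable norms, indexing the
   functional x |-> \sum_n <x xi_n, eta_n>. *)
Record uw_index := UwIndex {
  uw_left : nat -> ell2;
  uw_right : nat -> ell2;
  uw_leftP : (\sum_(n <oo) (ell2_norm (uw_left n) ^+ 2)%:E < +oo)%E;
  uw_rightP : (\sum_(n <oo) (ell2_norm (uw_right n) ^+ 2)%:E < +oo)%E
}.

Definition uw_functional (p : uw_index) (x : bop) : R[i]^o :=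
  csum (fun n : nat => dot (x (uw_left p n)) (uw_right p n)).

(* The only topology put on bounded operators is the ultraweak one: the
   coarsest for which all the functionals above are continuous. *)
Definition ultraweak :=
  sup_topology (fun p : uw_index =>
    Topological.class (initial_topology (uw_functional p))).

HB.instance Definition _ := Topological.copy bop ultraweak.

End Ell2.

Arguments bop1 {R I}.

(* In this section M stands for a von Neumann algebra of operators on l^2(I). A
   map on M is given by a function on all bounded operators, of which only the
   values on M are relevant. *)
Section VonNeumann.
Variables (R : realType) (I : choiceType).
Local Notation B := (bop R I).
Implicit Types (M : set B) (Phi : B -> B) (omega : B -> R[i]).

Definition linear_on (V : lmodType R[i]) M (f : B -> V) : Prop :=
  forall (a : R[i]) (x y : B), M x -> M y -> f (a *: x + y) = a *: f x + f y.

(* The normal linear functionals on M. *)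
Definition predual M (omega : B -> R[i]^o) : Prop :=
  linear_on M omega /\ {within M, continuous omega}.

Definition predual_norm M omega : R :=
  sup [set cabs (omega x) | x in M `&` [set x | opnorm x <= 1]].

Definition normal_map M Phi : Prop := {within M, continuous Phi}.

Definition finite_rank M Phi : Prop :=
  exists (n : nat) (e : 'I_n -> B), forall x, M x ->
    exists c : 'I_n -> R[i], Phi x = \sum_(i < n) c i *: e i.

(* Positivity of the operator (X_ij) on the n-fold direct sum of l^2(I). *)
Definition mx_positive (n : nat) (X : 'M[B]_n) : Prop :=
  forall xi : 'I_n -> ell2 R I,
    0 <= \sum_(i < n) \sum_(j < n) dot (X i j (xi j)) (xi i).

Definition completely_positive M Phi : Prop :=
  forall (n : nat) (X : 'M[B]_n), (forall i j, M (X i j)) ->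
    mx_positive X -> mx_positive (map_mx Phi X).

Definition normal_finite_rank_ucp M Phi : Prop :=
  [/\ (forall x, M x -> M (Phi x)), linear_on M Phi, completely_positive M Phi,
      Phi bop1 = bop1 & normal_map M Phi /\ finite_rank M Phi].

Definition directed (L : Type) (le : L -> L -> Prop) : Prop :=
  [/\ inhabited L, (forall a, le a a),
      (forall a b c, le a b -> le b c -> le a c) &
      forall a b, exists c, le a c /\ le b c].

Definition net_limsup (L : Type) (le : L -> L -> Prop) (f : L -> R) : \bar R :=
  ereal_inf [set ereal_sup [set (f m)%:E | m in [set m | le l m]] | l in setT].

Definition separation_property M (eps : R) : Prop :=
  forall (L : Type) (le : L -> L -> Prop) (Phi : L -> B -> B),
    directed le -> (forall l, normal_finite_rank_ucp M (Phi l)) ->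
    exists x omega, [/\ M x, predual M omega, opnorm x = 1,
      predual_norm M omega = 1 &
      (eps%:E < net_limsup le (fun l => cabs (omega (x - Phi l x)%R)))%E].

(* Existence of a projection of norm one from all bounded operators onto M; the
   norm is one and not less because M contains bop1. *)
Definition injective_vN M : Prop :=
  exists E : B -> B, [/\ linear E, (forall T, M (E T)),
    (forall x, M x -> E x = x) & forall T, opnorm (E T) <= opnorm T].

End VonNeumann.

Section GroupVonNeumann.
Variables (R : realType) (Gamma : groupType).

Lemma sqsum_lshift (g : Gamma) (f : Gamma -> R[i]) :
  sqsum (fun h => f (g^-1 * h)%g) = sqsum f.
Proof.
rewrite /sqsum [RHS](reindex_esum setT setT (fun h => (g^-1 * h)%g))//.
split=> [//|x y _ _ /mulgI//|y _]; exists (g * y)%g => //.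
by rewrite mulKg.
Qed.

Lemma lregular_ell2_subproof (g : Gamma) (xi : ell2 R Gamma) :
  (fun h => xi (g^-1 * h)%g) \in @square_summable R Gamma.
Proof. by rewrite unfold_in sqsum_lshift; exact: (ell2_funP xi). Qed.

Definition lregular_fun (g : Gamma) (xi : ell2 R Gamma) : ell2 R Gamma :=
  Ell2 (lregular_ell2_subproof g xi).

Lemma lregular_subproof (g : Gamma) :
  lregular_fun g \in @bounded_operator R Gamma.
Proof.
apply/asboolP; split=> [a x y|]; first exact/val_inj.
by exists 1 => xi; rewrite mul1r /ell2_norm sqsum_lshift.
Qed.

Definition lregular (g : Gamma) : bop R Gamma := Bop (lregular_subproof g).

(* The von Neumann algebra generated by the left regular representation. *)
Definition group_vN : set (bop R Gamma) := commutant (commutant (range lregular)).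

End GroupVonNeumann.

Arguments group_vN R Gamma : clear implicits.

(* Main.v *)
Require Import Defs.
From HB Require Import structures.
From mathcomp Require Import all_boot all_order all_algebra.
From mathcomp Require Import all_classical all_reals all_analysis.
From mathcomp Require Import complex ring lra cyclic separable cyclotomic.

Set Implicit Arguments.
Unset Strict Implicit.
Unset Printing Implicit Defensive.

Import Order.TTheory GRing.Theory Num.Theory.
Import numFieldNormedType.Exports.

Local Open Scope classical_set_scope.
Local Open Scope ring_scope.

(** Both properties are tied to amenability of the group, which appears here as
    [almost_invariant_vectors] and as the existence of an [invariant_mean].

    Injectivity gives a mean.  Let E be a projection of norm one onto the algebra
    and tau the trace.  The functional f |-> tau (E f), for f acting by
    multiplication, is an invariant mean once tau o E is known to commute with the
    unitaries lam g.  Since only contractivity of E is given, this is proved directly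
    ([hypertrace]): contractivity at 1 - a^* a / 4 + s x a bounds E (x a) at vectors
    that a = lam g - c almost annihilates ([projection_small]), and the trace is an
    average over approximate eigenvectors of lam g whose eigenvalues c run through
    the n-th roots of unity ([eigvec_average]).

    A mean gives almost invariant vectors ([mean_almost_invariant]).  Without them,
    some symmetric finite sum of translations has norm below the number of its terms
    ([spectral_gap]).  Its Green function is then finite, positive and strictly
    superharmonic ([green_superharmonic]), so the logarithmic increments of the
    latter along the finite set have negative sum; but invariance of the mean makes
    their means cancel in inverse pairs ([gap_no_mean]).

    Almost invariant vectors xi defeat separation: the multipliers by the positive
    definite functions g |-> <lam g xi, xi>, with xi finitely supported, form a net
    of normal finite-rank unital completely positive maps that converges to the
    identity ([almost_invariant_not_separated]).

    Conversely, if separation fails for some net Phi, then Haagerup's functions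
    [coef] g = <Phi (lam g) delta_1, delta_g> are positive definite,
    square-summable because Phi has finite rank, and eventually at distance at most
    some e < 1 from 1 at each point.  By iterated squaring, positive definiteness and
    square-summability bound the sum of [coef] over a finite list by the norm of the
    corresponding sum of translations ([coef_sum_le]).  These sums have real part at
    least 1 - e times the length of the list, so that powers of it contradict a
    spectral gap ([coefs_almost_invariant]).  An ultrafilter limit of vector states
    is an invariant mean ([almost_invariant_mean]), and averaging the conjugates of
    an operator by right translations projects onto the algebra ([mean_injective]),
    because the latter is the whole commutant of the right translations
    ([vN_of_rtrans]). *)

(** * Complex moduli *)

Section Modulus.
Variable R : realType.
Implicit Types z w : R[i].

Lemma cabs_ge0 z : 0 <= cabs z.
Proof. by case: z => a b /=; exact: sqrtr_ge0. Qed.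

Lemma cabsE z : cabs z ^+ 2 = complex.Re z ^+ 2 + complex.Im z ^+ 2.
Proof. by case: z => a b /=; rewrite sqr_sqrtr// addr_ge0 ?sqr_ge0. Qed.

Lemma normr_cabs z : `|z| = (cabs z)%:C%C.
Proof. by case: z. Qed.

Lemma cabs_conj z : cabs (conjc z) = cabs z.
Proof. by case: z => a b /=; rewrite sqrrN. Qed.

Lemma cabs_real (a : R) : cabs (a%:C)%C = `|a|.
Proof. by rewrite /= expr0n addr0 sqrtr_sqr. Qed.

Lemma Re_le_cabs z : `|complex.Re z| <= cabs z.
Proof.
by rewrite -(@ler_pXn2r _ 2)// ?nnegrE ?cabs_ge0// cabsE real_normK ?num_real//
  lerDl sqr_ge0.
Qed.

Lemma Im_le_cabs z : `|complex.Im z| <= cabs z.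
Proof.
by rewrite -(@ler_pXn2r _ 2)// ?nnegrE ?cabs_ge0// cabsE real_normK ?num_real//
  lerDr sqr_ge0.
Qed.

Lemma cabs_le_ReIm z : cabs z <= `|complex.Re z| + `|complex.Im z|.
Proof.
rewrite -(@ler_pXn2r _ 2)// ?nnegrE ?cabs_ge0 ?addr_ge0// cabsE.
rewrite -(real_normK (num_real (complex.Re z))).
rewrite -(real_normK (num_real (complex.Im z))).
have := mulr_ge0 (normr_ge0 (complex.Re z)) (normr_ge0 (complex.Im z)).
nra.
Qed.

Lemma mulc_conj z : z * conjc z = (cabs z ^+ 2)%:C%C.
Proof.
rewrite cabsE; case: z => a b; apply/eqP; rewrite eq_complex /=.
by apply/andP; split; apply/eqP; ring.
Qed.

Lemma conjcX z n : conjc (z ^+ n) = conjc z ^+ n.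
Proof. exact: (rmorphXn (@conjc R)). Qed.

Lemma cabsX z n : cabs (z ^+ n) = cabs z ^+ n.
Proof.
by elim: n => [|n IH]; rewrite ?expr0 ?Normc.normc1// !exprS Normc.normcM IH.
Qed.

Lemma ReD z w : complex.Re (z + w) = complex.Re z + complex.Re w.
Proof. by case: z => a b; case: w. Qed.

Lemma ReB z w : complex.Re (z - w) = complex.Re z - complex.Re w.
Proof. by case: z => a b; case: w. Qed.

Lemma conjcD z w : conjc (z + w) = conjc z + conjc w.
Proof. by case: z => a b; case: w => c d; rewrite /conjc /= opprD. Qed.

Lemma conjcM z w : conjc (z * w) = conjc z * conjc w.
Proof. exact: (rmorphM (@conjc R)). Qed.

Lemma conjcN z : conjc (- z) = - conjc z.
Proof. by case: z. Qed.

Lemma realcM (s t : R) : (s * t)%:C%C = s%:C%C * t%:C%C :> R[i].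
Proof. exact: (rmorphM (real_complex R)). Qed.

Lemma realcD (s t : R) : (s + t)%:C%C = s%:C%C + t%:C%C :> R[i].
Proof. exact: (rmorphD (real_complex R)). Qed.

Lemma realcN (s : R) : (- s)%:C%C = - s%:C%C :> R[i].
Proof. exact: (rmorphN (real_complex R)). Qed.

Lemma conjc_sum (J : Type) (r : seq J) (P : pred J) (F : J -> R[i]) :
  conjc (\sum_(i <- r | P i) F i) = \sum_(i <- r | P i) conjc (F i).
Proof. exact: (raddf_sum (@conjc R)). Qed.

Lemma cabs_phase z : exists2 a : R[i], cabs a = 1 & a * z = (cabs z)%:C%C.
Proof.
have [->|z0] := eqVneq z 0; first by exists 1; rewrite ?Normc.normc1 ?Normc.normc0 ?mulr0.
have c0 : cabs z != 0 by apply: contra_neq z0; exact: Normc.eq0_normc.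
exists (conjc z * (cabs z)^-1%:C%C).
  by rewrite Normc.normcM cabs_conj cabs_real ger0_norm ?invr_ge0 ?cabs_ge0// divff.
rewrite mulrAC [conjc z * z]mulrC mulc_conj -rmorphM /= expr2 -mulrA divff// mulr1.
by [].
Qed.

Lemma cabs_sum (J : Type) (r : seq J) (P : pred J) (F : J -> R[i]) :
  cabs (\sum_(i <- r | P i) F i) <= \sum_(i <- r | P i) cabs (F i).
Proof.
elim/big_ind2: _ => //; first by rewrite Normc.normc0.
by move=> z x w y zx wy; apply: le_trans (le_normcD _ _) _; exact: lerD.
Qed.

End Modulus.

Lemma sub_le_sum (R : realDomainType) (J : eqType) (r s : seq J) (F : J -> R) :
  uniq r -> uniq s -> {subset r <= s} -> (forall i, 0 <= F i) ->
  \sum_(i <- r) F i <= \sum_(i <- s) F i.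
Proof.
move=> ur us rs F0; rewrite [leRHS](bigID (mem r))/= -[X in _ <= X + _]big_filter.
rewrite (perm_big [seq i <- s | i \in r]) ?lerDl ?sumr_ge0//=.
apply: uniq_perm => //; first exact: filter_uniq.
by move=> i; rewrite mem_filter; case: (boolP (i \in r)) => // /rs ->.
Qed.

(** * Unordered sums of absolutely summable families *)

Section UnorderedSums.
Context {R : realType} {I : choiceType}.
Implicit Types (f g : I -> R) (u v : I -> R[i]).

Definition rsummable f := summable [set: I] (EFin \o f).
Definition csummable u :=
  rsummable (fun i => complex.Re (u i)) /\ rsummable (fun i => complex.Im (u i)).

Lemma rsummable_le f g : (forall i, `|f i| <= `|g i|) -> rsummable g -> rsummable f.
Proof.
move=> fg; apply: le_lt_trans; apply: le_esum => i _.
by rewrite /= lee_fin.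
Qed.

Lemma rsummableD f g : rsummable f -> rsummable g -> rsummable (fun i => f i + g i).
Proof. by move=> sf sg; exact: (summableD sf sg). Qed.

Lemma ge0_esum_fin f : (forall i, 0 <= f i) -> rsummable f ->
  \esum_(i in [set: I]) (f i)%:E \is a fin_num.
Proof.
move=> f0; rewrite /rsummable summableE; congr (_ \is a fin_num).
by apply: eq_esum => i _; rewrite /= ger0_norm.
Qed.

Lemma rsumB (p q : I -> R) : (forall i, 0 <= p i) -> (forall i, 0 <= q i) ->
  rsummable p -> rsummable q ->
  rsum (fun i => p i - q i) =
  fine (\esum_(i in [set: I]) (p i)%:E) - fine (\esum_(i in [set: I]) (q i)%:E).
Proof.
move=> p0 q0 sp sq.
have sd := summableB sp sq.
rewrite -fineB ?ge0_esum_fin// -esumB//; last 2 first.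
- by move=> i _; rewrite lee_fin.
- by move=> i _; rewrite lee_fin.
have h (h : I -> \bar R) : (forall i, 0 <= h i)%E -> summable setT h ->
    \esum_(i in [set: I]) h i \is a fin_num.
  move=> h0; rewrite summableE; congr (_ \is a fin_num).
  by apply: eq_esum => i _; rewrite gee0_abs.
rewrite /rsum fineB//.
  by apply: h; [move=> i; exact: funepos_ge0|exact: summable_funepos].
by apply: h; [move=> i; exact: funeneg_ge0|exact: summable_funeneg].
Qed.

Lemma ge0_rsum f : (forall i, 0 <= f i) -> rsummable f ->
  rsum f = fine (\esum_(i in [set: I]) (f i)%:E).
Proof.
move=> f0 sf.
have z : rsummable (fun=> 0) by apply: rsummable_le sf => i; rewrite normr0.
rewrite (_ : f = (fun i => f i - 0)); last by apply/funext => i; rewrite subr0.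
rewrite rsumB// [X in _ - fine X]esum1// subr0.
by congr fine; apply: eq_esum => i _; rewrite subr0.
Qed.

Let pos f i := Num.max (f i) 0.
Let neg f i := Num.max (- f i) 0.

Lemma rsum_posneg f : f = (fun i => pos f i - neg f i).
Proof.
apply/funext => i; rewrite /pos /neg; case: (lerP (f i) 0) => h.
  by rewrite max_l ?oppr_ge0// opprK add0r.
by rewrite max_r ?subr0// oppr_le0 ltW.
Qed.

Lemma rsummable_pos f : rsummable f -> rsummable (pos f).
Proof.
apply: rsummable_le => i; rewrite /pos; case: (leP (f i) 0) => // _.
by rewrite normr0.
Qed.

Lemma rsummable_neg f : rsummable f -> rsummable (neg f).
Proof.
apply: rsummable_le => i; rewrite /neg; case: (leP (- f i) 0) => // _.
  by rewrite normr0.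
by rewrite normrN.
Qed.

Let pos_ge0 f i : 0 <= pos f i. Proof. by rewrite le_max lexx orbT. Qed.
Let neg_ge0 f i : 0 <= neg f i. Proof. by rewrite le_max lexx orbT. Qed.

Let rsum_split f : rsummable f -> rsum f =
  fine (\esum_(i in [set: I]) (pos f i)%:E) - fine (\esum_(i in [set: I]) (neg f i)%:E).
Proof.
move=> sf; rewrite -rsumB//; first by congr rsum; exact: rsum_posneg.
- exact: rsummable_pos.
- exact: rsummable_neg.
Qed.

Lemma rsumD f g : rsummable f -> rsummable g ->
  rsum (fun i => f i + g i) = rsum f + rsum g.
Proof.
move=> sf sg.
have -> : (fun i => f i + g i) = (fun i => (pos f i + pos g i) - (neg f i + neg g i)).
  apply/funext => i; have := congr1 (@^~ i) (rsum_posneg f).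
  by have /= -> := congr1 (@^~ i) (rsum_posneg g) => /= ->; ring.
have [sf1 sf2 sg1 sg2] : [/\ rsummable (pos f), rsummable (neg f),
    rsummable (pos g) & rsummable (neg g)].
  by split; do ?[exact: rsummable_pos|exact: rsummable_neg].
rewrite rsumB; do ?[by move=> i; exact: addr_ge0|exact: rsummableD].
rewrite !rsum_split//.
under eq_esum do rewrite EFinD.
rewrite esumD; [|by move=> i _; rewrite lee_fin..].
under [X in _ - fine X]eq_esum do rewrite EFinD.
rewrite esumD; [|by move=> i _; rewrite lee_fin..].
rewrite !fineD ?ge0_esum_fin//; ring.
Qed.

Lemma rsummableN f : rsummable f -> rsummable (fun i => - f i).
Proof. by apply: rsummable_le => i; rewrite normrN. Qed.

Lemma rsumN f : rsummable f -> rsum (fun i => - f i) = - rsum f.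
Proof.
move=> sf; rewrite (rsum_split sf) opprB.
rewrite (_ : (fun i => - _) = (fun i => neg f i - pos f i)); last first.
  by apply/funext => i; have /= {1}-> := congr1 (@^~ i) (rsum_posneg f); rewrite opprB.
by rewrite rsumB//; [exact: rsummable_neg|exact: rsummable_pos].
Qed.

Lemma rsum_ge0 f : (forall i, 0 <= f i) -> rsummable f -> 0 <= rsum f.
Proof.
by move=> f0 sf; rewrite ge0_rsum// fine_ge0// esum_ge0// => i _; rewrite lee_fin.
Qed.

Lemma le_rsum f g : rsummable f -> rsummable g -> (forall i, f i <= g i) ->
  rsum f <= rsum g.
Proof.
move=> sf sg fg; rewrite -subr_ge0 -rsumN// -rsumD//; last exact: rsummableN.
by apply: rsum_ge0 => [i|]; [rewrite subr_ge0|apply: rsummableD => //; exact: rsummableN].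
Qed.

Lemma le_esumZ (c : R) f : 0 <= c -> (forall i, 0 <= f i) ->
  (\esum_(i in [set: I]) (c * f i)%:E <= c%:E * \esum_(i in [set: I]) (f i)%:E)%E.
Proof.
move=> c0 f0; apply: ge_ereal_sup => _ [F [Ffin _] <-].
under eq_fsbigr do rewrite EFinM.
rewrite -ge0_mule_fsumr//.
rewrite lee_wpmul2l ?lee_fin//.
by apply: ereal_sup_ubound; exists F.
Qed.

Lemma ge0_esumZ (c : R) f : 0 <= c -> (forall i, 0 <= f i) ->
  (\esum_(i in [set: I]) (c * f i)%:E = c%:E * \esum_(i in [set: I]) (f i)%:E)%E.
Proof.
move=> c0 f0; apply/eqP; rewrite eq_le le_esumZ//=.
have [->|cn0] := eqVneq c 0; first by rewrite mul0e esum_ge0// => i _; rewrite mul0r.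
have cp : 0 < c by rewrite lt_neqAle eq_sym cn0.
have := @le_esumZ c^-1 (fun i => c * f i); rewrite invr_ge0 => /(_ c0).
move=> /(_ (fun i => mulr_ge0 c0 (f0 i))) h.
rewrite -lee_pdivlMl// (le_trans _ h)//; apply: le_esum => i _.
by rewrite mulKf.
Qed.

Lemma rsummableZ (c : R) f : rsummable f -> rsummable (fun i => c * f i).
Proof.
rewrite /rsummable /summable => sf.
rewrite (eq_esum (b := fun i => (`|c| * `|f i|)%:E)); last first.
  by move=> i _; rewrite /= normrM.
by rewrite ge0_esumZ//; apply: lte_mul_pinfty.
Qed.

Lemma rsumZ (c : R) f : rsummable f -> rsum (fun i => c * f i) = c * rsum f.
Proof.
wlog c0 : c / 0 <= c.
  move=> h sf; have [/h->//|/ltW c0] := leP 0 c.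
  rewrite (_ : (fun i => c * f i) = (fun i => - (- c * f i))); last first.
    by apply/funext => i; rewrite mulNr opprK.
  by rewrite rsumN ?h ?oppr_ge0// ?mulNr ?opprK//; exact: rsummableZ.
move=> sf; rewrite (rsum_split sf).
have [s1 s2] := (rsummable_pos sf, rsummable_neg sf).
rewrite (_ : (fun i => c * f i) = (fun i => c * pos f i - c * neg f i)); last first.
  by apply/funext => i; have /= {1}-> := congr1 (@^~ i) (rsum_posneg f); rewrite mulrBr.
rewrite !rsumB//; do ?[by move=> i; exact: mulr_ge0|exact: rsummableZ].
by rewrite !ge0_esumZ// !fineM ?ge0_esum_fin// mulrBr.
Qed.

Lemma rsum_reindex (J : choiceType) (e : J -> I) f : bijective e ->
  rsum (fun j => f (e j)) = rsum f.
Proof.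
move=> be; have eb : set_bij [set: J] [set: I] e.
  case: be => e' eK e'K; split=> [//|x y _ _ /(can_inj eK)//|y _].
  by exists (e' y).
rewrite /rsum !(reindex_esum _ _ _ _ eb).
by congr (fine _ - fine _); apply: eq_esum => i _; rewrite ?funeposE ?funenegE.
Qed.

End UnorderedSums.

Section ComplexSums.
Context {R : realType} {I : choiceType}.
Implicit Types (u v : I -> R[i]).

Lemma csummableP u : csummable u <-> rsummable (fun i => cabs (u i)).
Proof.
split=> [[sr si]|s].
  have s : rsummable (fun i => `|complex.Re (u i)| + `|complex.Im (u i)|).
    by apply: rsummableD; [apply: rsummable_le sr|apply: rsummable_le si] => i;
      rewrite normr_id.
  apply: rsummable_le s => i; rewrite (ger0_norm (cabs_ge0 _)) ger0_norm ?addr_ge0//.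
  exact: cabs_le_ReIm.
by split; apply: rsummable_le s => i; rewrite (ger0_norm (cabs_ge0 _));
  [exact: Re_le_cabs|exact: Im_le_cabs].
Qed.

Lemma csummableZ (a : R[i]) u : csummable u -> csummable (fun i => a * u i).
Proof.
move=> /csummableP s; apply/csummableP.
rewrite (_ : (fun i => _) = (fun i => cabs a * cabs (u i))).
  exact: rsummableZ.
by apply/funext => i; rewrite Normc.normcM.
Qed.

Lemma csumD u v : csummable u -> csummable v ->
  csum (fun i => u i + v i) = csum u + csum v.
Proof.
move=> [ur ui] [vr vi]; rewrite /csum.
apply/eqP; rewrite eq_complex /= -!rsumD//.
by apply/andP; split; apply/eqP; congr rsum; apply/funext => i; case: (u i); case: (v i).
Qed.

Lemma csumZ (a : R[i]) u : csummable u -> csum (fun i => a * u i) = a * csum u.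
Proof.
move=> [ur ui]; rewrite /csum; case: a => a b.
apply/eqP; rewrite eq_complex /= -!rsumZ// -[X in _ == _ - X]/(rsum _).
rewrite -rsumN ?rsummableZ// -!rsumD ?rsummableN ?rsummableZ//.
by apply/andP; split; apply/eqP; congr rsum; apply/funext => i; case: (u i).
Qed.

Lemma csum_conj u : csummable u -> csum (fun i => conjc (u i)) = conjc (csum u).
Proof.
move=> [ur ui]; rewrite /csum /= -rsumN//.
by congr Complex; congr rsum; apply/funext => i; case: (u i).
Qed.

Lemma csum_reindex (J : choiceType) (e : J -> I) u : bijective e ->
  csum (fun j => u (e j)) = csum u.
Proof.
move=> be; rewrite /csum (rsum_reindex (fun i => complex.Re (u i)) be).
by rewrite (rsum_reindex (fun i => complex.Im (u i)) be).
Qed.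

Lemma csumE_single u i0 : (forall i, i != i0 -> u i = 0) ->
  csummable u /\ csum u = u i0.
Proof.
move=> u0.
have h (f : I -> R) : (forall i, i != i0 -> f i = 0) ->
    rsummable f /\ (0 <= f i0 -> rsum f = f i0).
  move=> f0.
  have e (g : I -> R) : (forall i, i != i0 -> g i = 0) -> 0 <= g i0 ->
      \esum_(i in [set: I]) (g i)%:E = (g i0)%:E.
    move=> g0 gi0; rewrite (esumID [set i0])//; last first.
      by move=> i _; have [->//|/g0->] := eqVneq i i0.
    rewrite setTI esum_set1// [X in (_ + X)%E]esum1 ?adde0// => i [_ /= /eqP ii0].
    by rewrite g0.
  have sf : rsummable f.
    rewrite /rsummable /summable /= (e (fun i => `|f i|)) ?ltry// => i /f0 ->.
    by rewrite normr0.
  split=> // fi0; rewrite ge0_rsum//; first by rewrite e.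
  by move=> i; have [->//|/f0->] := eqVneq i i0.
have [sr rE] := h (fun i => complex.Re (u i)) (fun i ii0 => congr1 (@complex.Re R) (u0 i ii0)).
have [si iE] := h (fun i => complex.Im (u i)) (fun i ii0 => congr1 (@complex.Im R) (u0 i ii0)).
split=> //.
have k (f : I -> R) : (forall i, i != i0 -> f i = 0) -> rsummable f -> rsum f = f i0.
  move=> f0 sf; have [/(h f f0).2//|/ltW fn] := leP 0 (f i0).
  have := (h (fun i => - f i) _).2; rewrite rsumN// => /(_ _ _)/oppr_inj -> //.
    by move=> i /f0 ->; rewrite oppr0.
  by rewrite oppr_ge0.
rewrite /csum !k//; first by case: (u i0).
- by move=> i /u0 ->.
- by move=> i /u0 ->.
Qed.

Lemma cabs_csum u : csummable u -> cabs (csum u) <= rsum (fun i => cabs (u i)).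
Proof.
move=> su; have [a a1 az] := cabs_phase (csum u).
have sau := csummableZ a su.
have -> : cabs (csum u) = rsum (fun i => complex.Re (a * u i)).
  by rewrite -[LHS]/(complex.Re (cabs (csum u))%:C%C) -az -csumZ.
apply: le_rsum; [by case: sau|exact/csummableP|move=> i].
apply: le_trans (ler_norm _) _; apply: le_trans (Re_le_cabs _) _.
by rewrite Normc.normcM a1 mul1r.
Qed.

End ComplexSums.

Arguments conjc : simpl never.
Arguments Normc.normc : simpl never.
Arguments dot : simpl never.
Arguments csum : simpl never.
Arguments rsum : simpl never.
Arguments ell2_norm : simpl never.
Arguments opnorm : simpl never.

(** * The Hilbert space of square-summable families *)

Section Hilbert.
Context {R : realType} {I : choiceType}.
Local Notation H := (ell2 R I).
Local Notation nrm := (@ell2_norm R I).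
Implicit Types (x y z : H) (a : R[i]).

Lemma ell2P x y : (forall i, x i = y i) -> x = y.
Proof. by move=> xy; apply/val_inj/funext. Qed.

Lemma ell2D x y i : (x + y) i = x i + y i. Proof. by []. Qed.
Lemma ell2Z a x i : (a *: x) i = a * x i. Proof. by []. Qed.
Lemma ell20 i : (0 : H) i = 0. Proof. by []. Qed.
Lemma ell2N x i : (- x) i = - x i. Proof. by []. Qed.

Lemma ell2_sum (J : Type) (r : seq J) (P : pred J) (F : J -> H) i :
  (\sum_(j <- r | P j) F j) i = \sum_(j <- r | P j) F j i.
Proof. by elim/big_ind2: _ => // u v w t; rewrite ell2D => -> ->. Qed.

Lemma sq_rsummable x : rsummable (fun i => cabs (x i) ^+ 2).
Proof.
rewrite /rsummable /summable; have := ell2_funP x; rewrite unfold_in /sqsum.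
by under [X in _ -> (X < _)%E]eq_esum do rewrite /= ger0_norm ?sqr_ge0//.
Qed.

Lemma normE x : nrm x ^+ 2 = rsum (fun i => cabs (x i) ^+ 2).
Proof.
rewrite sqr_sqrtr ?fine_ge0 ?sqsum_ge0// ge0_rsum//.
  by move=> i; exact: sqr_ge0.
exact: sq_rsummable.
Qed.

Lemma nrm_ge0 x : 0 <= nrm x. Proof. exact: sqrtr_ge0. Qed.

Lemma dot_csummable x y : csummable (fun i => x i * conjc (y i)).
Proof.
apply/csummableP; apply: rsummable_le (rsummableD (sq_rsummable x) (sq_rsummable y)) => i.
rewrite !ger0_norm ?cabs_ge0 ?addr_ge0 ?sqr_ge0// Normc.normcM cabs_conj.
have := sqr_ge0 (cabs (x i) - cabs (y i)).
have := mulr_ge0 (cabs_ge0 (x i)) (cabs_ge0 (y i)).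
nra.
Qed.

Lemma dotDl x y z : dot (x + y) z = dot x z + dot y z.
Proof.
rewrite /dot -csumD; try exact: dot_csummable.
by congr csum; apply/funext => i; rewrite ell2D mulrDl.
Qed.

Lemma dotZl a x y : dot (a *: x) y = a * dot x y.
Proof.
rewrite /dot -csumZ; last exact: dot_csummable.
by congr csum; apply/funext => i; rewrite ell2Z mulrA.
Qed.

Lemma dotC x y : dot y x = conjc (dot x y).
Proof.
rewrite /dot -csum_conj; last exact: dot_csummable.
by congr csum; apply/funext => i; rewrite conjcM conjcK mulrC.
Qed.

Lemma dotDr x y z : dot x (y + z) = dot x y + dot x z.
Proof. by rewrite dotC dotDl conjcD -!dotC. Qed.

Lemma dotZr a x y : dot x (a *: y) = conjc a * dot x y.
Proof. by rewrite dotC dotZl conjcM -!dotC. Qed.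

Lemma dot0l x : dot 0 x = 0.
Proof. by rewrite -[0 : H](scale0r (0 : H)) dotZl mul0r. Qed.

Lemma dot0r x : dot x 0 = 0.
Proof. by rewrite dotC dot0l conjc0. Qed.

Lemma dotNl x y : dot (- x) y = - dot x y.
Proof. by rewrite -scaleN1r dotZl mulN1r. Qed.

Lemma dotNr x y : dot x (- y) = - dot x y.
Proof. by rewrite dotC dotNl conjcN -dotC. Qed.

Lemma dotBl x y z : dot (x - y) z = dot x z - dot y z.
Proof. by rewrite dotDl dotNl. Qed.

Lemma dotBr x y z : dot x (y - z) = dot x y - dot x z.
Proof. by rewrite dotDr dotNr. Qed.

Lemma dot_suml (J : Type) (r : seq J) (P : pred J) (F : J -> H) y :
  dot (\sum_(j <- r | P j) F j) y = \sum_(j <- r | P j) dot (F j) y.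
Proof.
by elim/big_rec2: _ => [|j u v _ <-]; rewrite ?dot0l ?dotDl.
Qed.

Lemma dot_sumr (J : Type) (r : seq J) (P : pred J) (F : J -> H) y :
  dot y (\sum_(j <- r | P j) F j) = \sum_(j <- r | P j) dot y (F j).
Proof. by elim/big_rec2: _ => [|j u v _ <-]; rewrite ?dot0r ?dotDr. Qed.

Lemma dotxx x : dot x x = (nrm x ^+ 2)%:C%C.
Proof.
rewrite normE /dot /csum; congr Complex.
  by congr rsum; apply/funext => i; rewrite mulc_conj.
rewrite (_ : (fun i => _) = (fun=> 0)); last first.
  by apply/funext => i; rewrite mulc_conj.
have z : rsummable (fun _ : I => 0 : R).
  by rewrite /rsummable /summable esum1// => i _; rewrite /= normr0.
by rewrite ge0_rsum// esum1.
Qed.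

Lemma nrmD_sq x y : nrm (x + y) ^+ 2 = nrm x ^+ 2 + nrm y ^+ 2 + 2 * complex.Re (dot x y).
Proof.
apply: (@complexI R); rewrite -dotxx dotDl !dotDr !dotxx (dotC x y).
case: (dot x y) => u v; apply/eqP; rewrite eq_complex /=; apply/andP; split; apply/eqP; ring.
Qed.

Lemma nrmZ a x : nrm (a *: x) = cabs a * nrm x.
Proof.
apply/eqP; rewrite -(@eqrXn2 _ 2)// ?mulr_ge0 ?nrm_ge0 ?cabs_ge0//.
by apply/eqP/(@complexI R); rewrite -dotxx dotZl dotZr dotxx mulrA mulc_conj -realcM -exprMn.
Qed.

Lemma nrmN x : nrm (- x) = nrm x.
Proof. by rewrite -scaleN1r nrmZ normcN Normc.normc1 mul1r. Qed.

Lemma nrm0 : nrm 0 = 0.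
Proof. by rewrite -[0 : H](scale0r (0 : H)) nrmZ Normc.normc0 mul0r. Qed.

Lemma coord_le_nrm x i : cabs (x i) <= nrm x.
Proof.
rewrite -(@ler_pXn2r _ 2)// ?nnegrE ?cabs_ge0 ?nrm_ge0// normE ge0_rsum.
- rewrite -lee_fin fineK; last by apply: ge0_esum_fin (sq_rsummable x) => j; exact: sqr_ge0.
  apply: esum_ge; exists [set i]; first by split.
  by rewrite fsbig_set1.
- by move=> j; exact: sqr_ge0.
- exact: sq_rsummable.
Qed.

Lemma nrm_eq0 x : nrm x = 0 -> x = 0.
Proof.
move=> x0; apply: ell2P => i; apply: Normc.eq0_normc; apply/eqP.
by rewrite eq_le cabs_ge0 andbT -x0 coord_le_nrm.
Qed.

Lemma cauchy_schwarz x y : cabs (dot x y) <= nrm x * nrm y.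
Proof.
have [x0|x0] := eqVneq (nrm x) 0; first by rewrite (nrm_eq0 x0) dot0l nrm0 mul0r Normc.normc0.
have [y0|y0] := eqVneq (nrm y) 0; first by rewrite (nrm_eq0 y0) dot0r nrm0 mulr0 Normc.normc0.
have xp : 0 < nrm x by rewrite lt_neqAle eq_sym x0 nrm_ge0.
have yp : 0 < nrm y by rewrite lt_neqAle eq_sym y0 nrm_ge0.
have [a a1 ad] := cabs_phase (dot x y).
have := sqr_ge0 (nrm (((nrm y)%:C%C * a) *: x + (- (nrm x)%:C%C) *: y)).
rewrite nrmD_sq !nrmZ Normc.normcM a1 normcN !cabs_real !ger0_norm ?nrm_ge0//.
have -> : dot (((nrm y)%:C%C * a) *: x) ((- (nrm x)%:C%C) *: y) =
   (- (nrm y * nrm x * cabs (dot x y)))%:C%C.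
  rewrite dotZl dotZr conjcN conjc_real realcN !realcM -ad; ring.
rewrite /= mulr1 => h.
have xy := mulr_gt0 xp yp.
rewrite -(ler_pM2l xy); nra.
Qed.

Lemma nrmD x y : nrm (x + y) <= nrm x + nrm y.
Proof.
rewrite -(@ler_pXn2r _ 2)// ?nnegrE ?addr_ge0 ?nrm_ge0// nrmD_sq.
have := le_trans (Re_le_cabs _) (cauchy_schwarz x y).
have := ler_norm (complex.Re (dot x y)).
nra.
Qed.

Lemma nrmB x y : nrm (x - y) <= nrm x + nrm y.
Proof. by rewrite -(nrmN y) nrmD. Qed.

Lemma nrmBC x y : nrm (x - y) = nrm (y - x).
Proof. by rewrite -nrmN opprB. Qed.

Lemma nrm_sum (J : Type) (r : seq J) (P : pred J) (F : J -> H) :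
  nrm (\sum_(j <- r | P j) F j) <= \sum_(j <- r | P j) nrm (F j).
Proof.
elim/big_ind2: _ => //; first by rewrite nrm0.
by move=> u v w t uv wt; apply: le_trans (nrmD _ _) _; exact: lerD.
Qed.

Definition delta_fun (i : I) : I -> R[i] := fun j => (i == j)%:R.

Lemma finite_support_ss (f : I -> R[i]) (A : set I) : finite_set A ->
  (forall i, ~ A i -> f i = 0) -> f \in @square_summable R I.
Proof.
move=> fA f0; rewrite unfold_in /sqsum (esumID A)//; last first.
  by move=> i _; rewrite lee_fin sqr_ge0.
rewrite [X in (_ + X)%E]esum1 ?adde0 => [|i [_ /= /f0 ->]]; last first.
  by rewrite Normc.normc0 expr0n.
rewrite setTI esum_fset//; last by move=> i _; rewrite lee_fin sqr_ge0.
by rewrite fsbig_finite//= sumEFin ltry.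
Qed.

Lemma delta_subproof i : delta_fun i \in @square_summable R I.
Proof.
apply: (@finite_support_ss _ [set i]) => // j /= /eqP.
by rewrite /delta_fun eq_sym => /negPf ->.
Qed.

Definition delta i : H := Ell2 (delta_subproof i).

Lemma deltaE i j : delta i j = (i == j)%:R. Proof. by []. Qed.

Lemma dot_deltar x i : dot x (delta i) = x i.
Proof.
rewrite /dot; have [j ji|_ ->] := @csumE_single R I (fun j => x j * conjc (delta i j)) i.
  by rewrite deltaE eq_sym (negPf ji) conjc0 mulr0.
by rewrite deltaE eqxx conjc1 mulr1.
Qed.

Lemma dot_deltal x i : dot (delta i) x = conjc (x i).
Proof. by rewrite dotC dot_deltar. Qed.

Lemma nrm_delta i : nrm (delta i) = 1.
Proof.
apply/eqP; rewrite -(@eqrXn2 _ 2)// ?nrm_ge0// expr1n; apply/eqP/(@complexI R).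
by rewrite -dotxx dot_deltar deltaE eqxx.
Qed.

(** The list stands for the set of its members, whence undup. *)
Definition trunc (A : seq I) x : H := \sum_(i <- undup A) x i *: delta i.

Lemma truncE A x i : trunc A x i = if i \in A then x i else 0.
Proof.
rewrite /trunc ell2_sum; case: ifPn => iA.
  rewrite (bigD1_seq i) ?mem_undup ?undup_uniq// ell2Z deltaE eqxx mulr1.
  rewrite big1 => [|j ji]; first exact: addr0.
  rewrite ell2Z deltaE.
  by rewrite (negPf ji) mulr0.
rewrite big1_seq// => j /andP[_]; rewrite mem_undup => jA; rewrite ell2Z deltaE.
by case: eqP => [ji|]; rewrite ?mulr0//; rewrite -ji jA in iA.
Qed.

Lemma nrm_trunc A x : nrm (trunc A x) ^+ 2 = \sum_(i <- undup A) cabs (x i) ^+ 2.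
Proof.
apply: (@complexI R); rewrite -dotxx {2}/trunc dot_sumr rmorph_sum /=.
rewrite [LHS]big_seq [RHS]big_seq; apply: eq_bigr => i; rewrite mem_undup => iA.
by rewrite dotZr dot_deltar truncE iA mulrC mulc_conj.
Qed.

Lemma nrm_sub_trunc A x : nrm (x - trunc A x) ^+ 2 = nrm x ^+ 2 - nrm (trunc A x) ^+ 2.
Proof.
have o : dot (trunc A x) (x - trunc A x) = 0.
  rewrite /trunc dot_suml big1_seq// => i /andP[_]; rewrite mem_undup => iA.
  by rewrite dotZl dot_deltal ell2D ell2N -/(trunc A x) truncE iA subrr conjc0 mulr0.
have := nrmD_sq (trunc A x) (x - trunc A x); rewrite o /= mulr0 addr0 addrC subrK => ->.
by rewrite addrAC subrr add0r.
Qed.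

Lemma nrm_trunc_le A x : nrm (trunc A x) <= nrm x.
Proof.
rewrite -(@ler_pXn2r _ 2)// ?nnegrE ?nrm_ge0// -subr_ge0 -nrm_sub_trunc sqr_ge0//.
Qed.

(** Finitely supported families are dense; the estimate holds for all larger lists,
    so that several vectors can be truncated at once. *)
Lemma trunc_dense x e : 0 < e ->
  exists A : seq I, forall B, {subset A <= B} -> nrm (x - trunc B x) < e.
Proof.
move=> e0.
have fin : \esum_(i in [set: I]) (cabs (x i) ^+ 2)%:E \is a fin_num.
  by apply: ge0_esum_fin (sq_rsummable x) => j; exact: sqr_ge0.
have e20 : 0 < e ^+ 2 by rewrite exprn_gt0.
have [_ [A [fA _] <-] Ae] := ub_ereal_sup_adherent e20 fin.
move: Ae; rewrite fsbig_finite//= sumEFin -/(esum _ _).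
have -> : \esum_(i in [set: I]) (cabs (x i) ^+ 2)%:E = (nrm x ^+ 2)%:E.
  rewrite normE ge0_rsum ?fineK//; last exact: sq_rsummable.
  by move=> i; exact: sqr_ge0.
rewrite -EFinB lte_fin => Ae.
exists (finmap.enum_fset (fset_set A)) => B AB.
rewrite -(@ltr_pXn2r _ 2)// ?nnegrE ?nrm_ge0 ?(ltW e0)// nrm_sub_trunc nrm_trunc.
rewrite ltrBlDr addrC -ltrBlDr; apply: lt_le_trans Ae _.
apply: sub_le_sum; rewrite ?undup_uniq ?finmap.fset_uniq//.
  by move=> i /AB; rewrite mem_undup.
by move=> i; exact: sqr_ge0.
Qed.

End Hilbert.

(** * Bounded operators *)

Section Operators.
Context {R : realType} {I : choiceType}.
Local Notation H := (ell2 R I).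
Local Notation B := (bop R I).
Local Notation nrm := (@ell2_norm R I).
Implicit Types (x y z : H) (a : R[i]) (S T : B).

(** Finitely supported families are dense. *)
Lemma functional_ext (f : H -> R[i]) k :
  (forall a x y, f (a *: x + y) = a * f x + f y) ->
  (forall x, cabs (f x) <= k * nrm x) -> (forall i, f (delta i) = 0) ->
  forall x, f x = 0.
Proof.
move=> fl fk fd x.
have f0 : f 0 = 0.
  have := fl 1 0 0; rewrite scale1r addr0 mul1r => /eqP.
  by rewrite -[X in X == _]addr0 (inj_eq (addrI _)) eq_sym => /eqP.
have ft A : f (trunc A x) = 0.
  rewrite /trunc; elim: (undup A) => [|i r IH]; first by rewrite big_nil.
  by rewrite big_cons fl fd mulr0 add0r.
apply: Normc.eq0_normc; apply/eqP; rewrite eq_le cabs_ge0 andbT.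
apply/ler_addgt0Pr => e e0; rewrite add0r.
have k1 : 0 < `|k| + 1 by rewrite ltr_wpDl.
have [A hA] := trunc_dense x (divr_gt0 e0 k1).
have {hA}/ltW h := hA A (fun _ => id).
have -> : f x = f (x - trunc A x).
  by rewrite -scaleN1r addrC fl ft mulr0 add0r.
apply: le_trans (fk _) _.
apply: (@le_trans _ _ ((`|k| + 1) * nrm (x - trunc A x))).
  by rewrite ler_wpM2r ?nrm_ge0// (le_trans (ler_norm _))// lerDl.
by rewrite mulrC -ler_pdivlMr.
Qed.

Lemma bop_linear T a x y : T (a *: x + y) = a *: T x + T y.
Proof. by have /asboolP[h _] := bop_funP T; exact: h. Qed.

Lemma bop0 T : T 0 = 0.
Proof.
have := bop_linear T 1 0 0; rewrite !scale1r addr0 => /eqP.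
by rewrite -[X in X == _]addr0 (inj_eq (addrI _)) eq_sym => /eqP.
Qed.

Lemma bopD T x y : T (x + y) = T x + T y.
Proof. by have := bop_linear T 1 x y; rewrite !scale1r. Qed.

Lemma bopZ T a x : T (a *: x) = a *: T x.
Proof. by have := bop_linear T a x 0; rewrite bop0 !addr0. Qed.

Lemma bopN T x : T (- x) = - T x.
Proof. by rewrite -scaleN1r bopZ scaleN1r. Qed.

Lemma bopB T x y : T (x - y) = T x - T y.
Proof. by rewrite bopD bopN. Qed.

Lemma bop_sum T (J : Type) (r : seq J) (P : pred J) (F : J -> H) :
  T (\sum_(j <- r | P j) F j) = \sum_(j <- r | P j) T (F j).
Proof. by elim/big_rec2: _ => [|j u v _ <-]; rewrite ?bop0 ?bopD. Qed.

Lemma bopP S T : (forall x, S x = T x) -> S = T.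
Proof. by move=> h; apply/val_inj/funext. Qed.

Lemma bop_addE S T x : (S + T) x = S x + T x. Proof. by []. Qed.
Lemma bop_scaleE a T x : (a *: T) x = a *: T x. Proof. by []. Qed.
Lemma bop_oppE T x : (- T) x = - T x. Proof. by []. Qed.
Lemma bop_sumE (J : Type) (r : seq J) (P : pred J) (F : J -> B) x :
  (\sum_(j <- r | P j) F j) x = \sum_(j <- r | P j) F j x.
Proof. by elim/big_rec2: _ => // j u v _ <-. Qed.

Lemma opnorm_set T : has_sup [set nrm (T x) | x in [set x | nrm x <= 1]].
Proof.
have /asboolP[_ [k hk]] := bop_funP T; split.
  by exists (nrm (T 0)); exists 0 => //=; rewrite nrm0 ler01.
exists `|k| => _ [x /= x1 <-]; apply: le_trans (hk _) _.
apply: (@le_trans _ _ (`|k| * nrm x)); first by rewrite ler_wpM2r ?nrm_ge0// ler_norm.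
by rewrite -[leRHS]mulr1 ler_wpM2l.
Qed.

Lemma opnorm_ge0 T : 0 <= opnorm T.
Proof.
apply: le_trans (nrm_ge0 (T 0)) _; apply: ub_le_sup; first by case: (opnorm_set T).
by exists 0 => //=; rewrite nrm0 ler01.
Qed.

Lemma bop_bound T x : nrm (T x) <= opnorm T * nrm x.
Proof.
have [x0|x0] := eqVneq (nrm x) 0; first by rewrite (nrm_eq0 x0) bop0 nrm0 mulr0.
have xp : 0 < nrm x by rewrite lt_neqAle eq_sym x0 nrm_ge0.
rewrite -ler_pdivrMr// mulrC.
have -> : (nrm x)^-1 * nrm (T x) = nrm (T ((nrm x)^-1%:C%C *: x)).
  by rewrite bopZ nrmZ cabs_real ger0_norm ?invr_ge0 ?nrm_ge0.
apply: ub_le_sup; first by case: (opnorm_set T).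
exists ((nrm x)^-1%:C%C *: x) => //=.
by rewrite nrmZ cabs_real ger0_norm ?invr_ge0 ?nrm_ge0// mulVf.
Qed.

Lemma opnorm_le T k : (forall x, nrm (T x) <= k * nrm x) -> 0 <= k -> opnorm T <= k.
Proof.
move=> h k0; apply: ge_sup; first by case: (opnorm_set T).
by move=> _ [x /= x1 <-]; apply: le_trans (h x) _; rewrite -[leRHS]mulr1 ler_wpM2l.
Qed.

Lemma dot_bop_le T x y : cabs (dot (T x) y) <= opnorm T * nrm x * nrm y.
Proof.
apply: le_trans (cauchy_schwarz _ _) _.
by rewrite ler_wpM2r ?nrm_ge0// bop_bound.
Qed.

Lemma bop_ext S T : (forall i, S (delta i) = T (delta i)) -> S = T.
Proof.
move=> h; apply: bopP => x; apply/eqP; rewrite -subr_eq0; apply/eqP/ell2P => j.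
rewrite -[_ - _]/((S - T) x) -dot_deltar ell20.
pose f x := dot ((S - T) x) (delta j).
apply: (functional_ext (f := f) (k := opnorm (S - T))) => [a y z|y|i]; rewrite /f.
- by rewrite bop_linear dotDl dotZl.
- by apply: le_trans (dot_bop_le _ _ _) _; rewrite nrm_delta mulr1.
- by rewrite bop_addE bop_oppE h subrr dot0l.
Qed.

Lemma mkbop_subproof (f : H -> H) k : linear f -> (forall x, nrm (f x) <= k * nrm x) ->
  f \in @bounded_operator R I.
Proof. by move=> fl fk; apply/asboolP; split => //; exists k. Qed.

Definition mkbop f k (fl : linear f) (fk : forall x, nrm (f x) <= k * nrm x) : B :=
  Bop (mkbop_subproof fl fk).

Lemma comp_linear S T : linear (S \o T).
Proof. by move=> a x y /=; rewrite !bop_linear. Qed.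

Lemma comp_bound S T x : nrm ((S \o T) x) <= (opnorm S * opnorm T) * nrm x.
Proof.
apply: le_trans (bop_bound _ _) _; rewrite -mulrA ler_wpM2l ?opnorm_ge0//.
exact: bop_bound.
Qed.

Definition bcomp S T : B := mkbop (@comp_linear S T) (comp_bound S T).

Lemma bcompE S T x : bcomp S T x = S (T x). Proof. by []. Qed.

Lemma bcompDl S S' T : bcomp (S + S') T = bcomp S T + bcomp S' T.
Proof. exact: bopP. Qed.
Lemma bcompZl a S T : bcomp (a *: S) T = a *: bcomp S T.
Proof. exact: bopP. Qed.
Lemma bcompNl S T : bcomp (- S) T = - bcomp S T.
Proof. exact: bopP. Qed.
Lemma bcompNr S T : bcomp S (- T) = - bcomp S T.
Proof. by apply: bopP => x; rewrite bop_oppE !bcompE bop_oppE bopN. Qed.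
Lemma bcompDr S T T' : bcomp S (T + T') = bcomp S T + bcomp S T'.
Proof. by apply: bopP => x; rewrite bop_addE !bcompE bop_addE bopD. Qed.
Lemma bcompZr a S T : bcomp S (a *: T) = a *: bcomp S T.
Proof. by apply: bopP => x; rewrite bop_scaleE !bcompE bop_scaleE bopZ. Qed.

(** Riesz representation in coordinates; multiplication operators and averages of
    operators are obtained from it. *)
Lemma bop_of_coords (F : H -> I -> R[i]) k : 0 <= k ->
  (forall a x y i, F (a *: x + y) i = a * F x i + F y i) ->
  (forall x (A : seq I), uniq A -> \sum_(i <- A) cabs (F x i) ^+ 2 <= (k * nrm x) ^+ 2) ->
  exists T : B, (forall x i, T x i = F x i) /\ opnorm T <= k.
Proof.
move=> k0 Fl Fk.
have le x : (sqsum (F x) <= ((k * nrm x) ^+ 2)%:E)%E.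
  apply: ge_ereal_sup => _ [A [fA _] <-].
  by rewrite fsbig_finite//= sumEFin lee_fin Fk// finmap.fset_uniq.
have ss x : F x \in @square_summable R I.
  by rewrite unfold_in (le_lt_trans (le x))// ltry.
pose f x : H := Ell2 (ss x).
have fl : linear f by move=> a x y; apply: ell2P => i; exact: Fl.
have fk x : nrm (f x) <= k * nrm x.
  rewrite -(@ler_pXn2r _ 2)// ?nnegrE ?mulr_ge0 ?nrm_ge0// sqr_sqrtr ?fine_ge0 ?sqsum_ge0//.
  have fin : sqsum (F x) \is a fin_num by rewrite ge0_fin_numE ?sqsum_ge0//; exact: (ss x).
  by rewrite -lee_fin fineK//; exact: le.
by exists (mkbop fl fk); split=> //; exact: opnorm_le.
Qed.

Definition adjoint_pair S T := forall x y, dot (S x) y = dot x (T y).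

Lemma adjoint_pair_opnorm S T : adjoint_pair S T -> opnorm S <= opnorm T.
Proof.
move=> st; apply: opnorm_le (opnorm_ge0 _) => x.
have [s0|s0] := eqVneq (nrm (S x)) 0; first by rewrite s0 mulr_ge0 ?nrm_ge0 ?opnorm_ge0.
have sp : 0 < nrm (S x) by rewrite lt_neqAle eq_sym s0 nrm_ge0.
rewrite -(ler_pM2r sp) -expr2.
have -> : nrm (S x) ^+ 2 = cabs (dot (S x) (S x)).
  by rewrite dotxx cabs_real ger0_norm ?sqr_ge0.
rewrite st; apply: le_trans (cauchy_schwarz _ _) _.
by rewrite mulrC mulrAC ler_wpM2r ?nrm_ge0// bop_bound.
Qed.

Definition cbounded (f : I -> R[i]) := exists C, forall i, cabs (f i) <= C.

Lemma mulop_exists f : cbounded f ->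
  exists T : B, (forall x i, T x i = f i * x i) /\
    (forall C, (forall i, cabs (f i) <= C) -> 0 <= C -> opnorm T <= C).
Proof.
move=> [C0 fC0].
have key C (x : H) (A : seq I) : (forall i, cabs (f i) <= C) -> 0 <= C ->
    uniq A -> \sum_(i <- A) cabs (f i * x i) ^+ 2 <= (C * nrm x) ^+ 2.
  move=> fC C0' uA; apply: (@le_trans _ _ (C ^+ 2 * \sum_(i <- A) cabs (x i) ^+ 2)).
    rewrite mulr_sumr; apply: ler_sum => i _; rewrite Normc.normcM exprMn.
    by rewrite ler_wpM2r ?sqr_ge0// ler_pXn2r ?nnegrE ?cabs_ge0.
  rewrite exprMn ler_wpM2l ?sqr_ge0// -[A in leLHS](undup_id uA) -nrm_trunc.
  by rewrite ler_pXn2r ?nnegrE ?nrm_ge0// nrm_trunc_le.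
have fC0' i : cabs (f i) <= `|C0| by apply: le_trans (fC0 i) (ler_norm _).
have [||T [TE _]] := @bop_of_coords (fun x i => f i * x i) `|C0| (normr_ge0 _).
- by move=> a x y i; rewrite ell2D ell2Z mulrDr mulrCA.
- by move=> x A uA; exact: key.
exists T; split=> // C fC C0p.
have [||S [SE SC]] := @bop_of_coords (fun x i => f i * x i) C C0p.
- by move=> a x y i; rewrite ell2D ell2Z mulrDr mulrCA.
- by move=> x A uA; exact: key.
by rewrite (_ : T = S)//; apply: bopP => x; apply: ell2P => i; rewrite TE SE.
Qed.

(** Total in f, with the junk value 0 for unbounded f, so that no proof of
    boundedness enters the terms. *)
Definition mulop (f : I -> R[i]) : B :=
  if pselect (cbounded f) is left h then projT1 (cid (mulop_exists h)) else 0.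

Lemma mulopE f x i : cbounded f -> mulop f x i = f i * x i.
Proof.
by rewrite /mulop; case: pselect => // h _; case: cid => T [TE _] /=; rewrite TE.
Qed.

Lemma opnorm_mulop f C : (forall i, cabs (f i) <= C) -> 0 <= C -> opnorm (mulop f) <= C.
Proof.
move=> fC C0; rewrite /mulop; case: pselect => [h|[]]; last by exists C.
by case: cid => T [_ TC] /=; exact: TC.
Qed.

Lemma mulop_adjoint f : cbounded f -> adjoint_pair (mulop f) (mulop (fun i => conjc (f i))).
Proof.
move=> fb x y; rewrite /dot; congr csum; apply/funext => i.
rewrite !mulopE//; first by rewrite conjcM conjcK mulrCA mulrA.
by case: fb => C fC; exists C => j; rewrite cabs_conj.
Qed.

End Operators.

(** * The group von Neumann algebra as the commutant of right translations *)

Section GroupAlgebra.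
Context {R : realType} {Gamma : groupType}.
Local Notation H := (ell2 R Gamma).
Local Notation B := (bop R Gamma).
Local Notation nrm := (@ell2_norm R Gamma).
Local Notation M := (group_vN R Gamma).
Local Notation lam := (@lregular R Gamma).
Local Notation delta := (@delta R Gamma).
Implicit Types (x y z : H) (a : R[i]) (S T : B) (g h k : Gamma).

Lemma lregE g x h : lam g x h = x (g^-1 * h)%g. Proof. by []. Qed.

Lemma nrm_lreg g x : nrm (lam g x) = nrm x.
Proof. by rewrite /ell2_norm sqsum_lshift. Qed.

Lemma lreg_delta g k : lam g (delta k) = delta (g * k)%g.
Proof.
apply: ell2P => h; rewrite lregE !deltaE; congr (_%:R); congr nat_of_bool.
by rewrite -(inj_eq (mulgI g)) mulVKg.
Qed.

Lemma lregM g h x : lam (g * h)%g x = lam g (lam h x).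
Proof. by apply: ell2P => k; rewrite !lregE invgM mulgA. Qed.

Lemma lreg1 : lam 1%g = bop1.
Proof. by apply: bopP => x; apply: ell2P => h; rewrite lregE invg1 mul1g. Qed.

Lemma lregVK g x : lam g^-1%g (lam g x) = x.
Proof. by rewrite -lregM mulVg lreg1. Qed.

Lemma mulg_bij g : bijective (fun h : Gamma => g * h)%g.
Proof. by exists (fun h => g^-1 * h)%g => h; rewrite ?mulKg ?mulVKg. Qed.

Lemma mulgr_bij g : bijective (fun h : Gamma => h * g)%g.
Proof. by exists (fun h => h * g^-1)%g => h; rewrite ?mulgK ?mulgVK. Qed.

Lemma dot_lreg g x y : dot (lam g x) y = dot x (lam g^-1%g y).
Proof.
rewrite /dot -(csum_reindex _ (mulg_bij g)); congr csum; apply/funext => h.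
by rewrite /= mulKg invgK.
Qed.

Lemma opnorm_lreg g : opnorm (lam g) = 1.
Proof.
apply/eqP; rewrite eq_le; apply/andP; split.
  by apply: opnorm_le => // x; rewrite nrm_lreg mul1r.
have := bop_bound (lam g) (delta 1%g).
by rewrite nrm_lreg nrm_delta mulr1.
Qed.

Lemma sqsum_bij (e : Gamma -> Gamma) (f : Gamma -> R[i]) : bijective e ->
  sqsum (fun h => f (e h)) = sqsum f.
Proof.
move=> [e' eK e'K]; rewrite /sqsum [RHS](reindex_esum setT setT e)//.
by split=> [//|u v _ _ /(can_inj eK)//|y _]; exists (e' y).
Qed.

Lemma bij_ell2 (e : Gamma -> Gamma) x : bijective e ->
  (fun h => x (e h)) \in @square_summable R Gamma.
Proof. by move=> be; rewrite unfold_in sqsum_bij//; exact: (ell2_funP x). Qed.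

Lemma conj_ell2 x : (fun h => conjc (x h)) \in @square_summable R Gamma.
Proof.
have := ell2_funP x; rewrite !unfold_in /sqsum => h.
by under eq_esum do rewrite cabs_conj.
Qed.

Definition rtrans_fun g x : H := Ell2 (bij_ell2 x (mulgr_bij g)).

Lemma rtrans_linear g : linear (rtrans_fun g).
Proof. by move=> a x y; apply: ell2P. Qed.

Lemma rtrans_bound g x : nrm (rtrans_fun g x) <= 1 * nrm x.
Proof. by rewrite mul1r /ell2_norm (sqsum_bij _ (mulgr_bij g)). Qed.

Definition rtrans g : B := mkbop (@rtrans_linear g) (@rtrans_bound g).

Lemma rtransE g x h : rtrans g x h = x (h * g)%g. Proof. by []. Qed.

Lemma nrm_rtrans g x : nrm (rtrans g x) = nrm x.
Proof. by rewrite /ell2_norm (sqsum_bij _ (mulgr_bij g)). Qed.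

Lemma rtransM g h x : rtrans (g * h)%g x = rtrans g (rtrans h x).
Proof. by apply: ell2P => k; rewrite !rtransE mulgA. Qed.

Lemma rtrans1 x : rtrans 1%g x = x.
Proof. by apply: ell2P => h; rewrite rtransE mulg1. Qed.

Lemma dot_rtrans g x y : dot (rtrans g x) y = dot x (rtrans g^-1%g y).
Proof.
rewrite /dot -(csum_reindex _ (mulgr_bij g^-1%g)); congr csum; apply/funext => h.
by rewrite /= mulgVK.
Qed.

Lemma rtrans_delta g k : rtrans g (delta k) = delta (k * g^-1)%g.
Proof.
apply: ell2P => h; rewrite rtransE !deltaE; congr (_%:R); congr nat_of_bool.
by rewrite -(inj_eq (mulIg g^-1)%g) mulgK.
Qed.

Lemma vN_lreg g : M (lam g).
Proof. by move=> S hS x /=; rewrite -[LHS]/((lam g \o S) x) -hS//; exists g. Qed.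

Lemma vN_lin a S T : M S -> M T -> M (a *: S + T).
Proof.
move=> hS hT U hU x.
rewrite -[LHS]/(a *: S (U x) + T (U x)) -[RHS]/(U (a *: S x + T x)) bop_linear.
have -> : S (U x) = U (S x) := hS U hU x.
by have -> : T (U x) = U (T x) := hT U hU x.
Qed.

Lemma vN0 : M 0.
Proof. by move=> U hU x; rewrite -[LHS]/(0 : H) -[RHS]/(U 0) bop0. Qed.

Lemma vND S T : M S -> M T -> M (S + T).
Proof. by move=> hS hT; rewrite -[S]scale1r; exact: vN_lin. Qed.

Lemma vNZ a S : M S -> M (a *: S).
Proof. by move=> hS; rewrite -[_ *: _]addr0; apply: vN_lin => //; exact: vN0. Qed.

Lemma vNN S : M S -> M (- S).
Proof. by rewrite -scaleN1r; exact: vNZ. Qed.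

Lemma vNB S T : M S -> M T -> M (S - T).
Proof. by move=> hS /vNN; exact: vND. Qed.

Lemma vN_comp S T : M S -> M T -> M (bcomp S T).
Proof.
move=> hS hT U hU x; rewrite -[LHS]/(S (T (U x))) -[RHS]/(U (S (T x))).
have -> : T (U x) = U (T x) := hT U hU x.
exact: hS U hU (T x).
Qed.

Lemma vN1 : M bop1. Proof. by rewrite -lreg1; exact: vN_lreg. Qed.

Lemma vN_sum (J : Type) (r : seq J) (P : pred J) (F : J -> B) :
  (forall j, P j -> M (F j)) -> M (\sum_(j <- r | P j) F j).
Proof. by move=> h; elim/big_ind: _ => //; [exact: vN0|exact: vND]. Qed.

Lemma vN_rtrans T g x : M T -> T (rtrans g x) = rtrans g (T x).
Proof.
move=> hT; apply: (hT (rtrans g)) => _ [h _ <-] y.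
by apply: ell2P => k; rewrite /= mulgA.
Qed.

Lemma vN_coord T k h : M T -> T (delta k) h = T (delta 1%g) (h * k^-1)%g.
Proof.
move=> hT; rewrite -rtransE -vN_rtrans// rtrans_delta; congr (T _ h).
by rewrite invgK mul1g.
Qed.

(** Operators commuting with all right translations are left convolutions, those
    commuting with all left translations are right convolutions, and the two
    kinds commute by associativity, that is, after a change of variable. *)
Lemma vN_of_rtrans T : (forall g x, T (rtrans g x) = rtrans g (T x)) -> M T.
Proof.
move=> hT S hS x; have {}hS g y : S (lam g y) = lam g (S y).
  by have := hS (lam g); apply; exists g.
suff e : bcomp T S = bcomp S T by rewrite -[LHS]/(bcomp T S x) e.
have T1 k h : T (delta k) h = T (delta 1%g) (h * k^-1)%g.
  by rewrite -rtransE -hT rtrans_delta invgK mul1g.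
have S1 k h : S (delta k) h = S (delta 1%g) (k^-1 * h)%g.
  by rewrite -lregE -hS lreg_delta mulg1.
have be h : bijective (fun k => h * k^-1)%g.
  by exists (fun k => k^-1 * h)%g => k; rewrite invgM ?invgK ?mulgVK ?mulKg ?mulVKg ?mulgK.
have be' h : bijective (fun k => k^-1 * h)%g.
  by exists (fun k => h * k^-1)%g => k; rewrite invgM ?invgK ?mulgVK ?mulKg ?mulVKg ?mulgK.
have row (U : B) (u : H) h : (forall k, U (delta k) h = conjc (u k)) ->
    forall y, U y h = dot y u.
  move=> hu y; apply/eqP; rewrite -subr_eq0; apply/eqP.
  apply: (functional_ext (f := fun y => U y h - dot y u) (k := opnorm U + nrm u)).
  - by move=> a z w; rewrite bop_linear dotDl dotZl ell2D ell2Z; ring.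
  - move=> z; apply: le_trans (le_normcD _ _) _; rewrite normcN mulrDl lerD//.
      by apply: le_trans (coord_le_nrm _ _) _; exact: bop_bound.
    by rewrite mulrC cauchy_schwarz.
  - by move=> i; rewrite hu dot_deltal subrr.
pose tk h := Ell2 (conj_ell2 (Ell2 (bij_ell2 (T (delta 1%g)) (be h)))).
pose sk h := Ell2 (conj_ell2 (Ell2 (bij_ell2 (S (delta 1%g)) (be' h)))).
have Trow h y : T y h = dot y (tk h).
  by apply: row => k; rewrite T1 /= conjcK.
have Srow h y : S y h = dot y (sk h).
  by apply: row => k; rewrite S1 /= conjcK.
apply: bop_ext => g; apply: ell2P => h.
rewrite !bcompE Trow Srow /dot.
rewrite -[RHS](csum_reindex _ (mulgr_bij g)) -[RHS](csum_reindex _ (be h)).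
congr csum; apply/funext => k; rewrite T1 S1 /= !conjcK mulrC; congr (_ * _).
  by rewrite mulgK.
by rewrite !invgM !invgK -!mulgA mulVg mulg1.
Qed.

End GroupAlgebra.

(** * Invariant means, and injectivity from an invariant mean *)

Section Means.
Context {R : realType} {Gamma : groupType}.
Local Notation H := (ell2 R Gamma).
Local Notation B := (bop R Gamma).
Local Notation nrm := (@ell2_norm R Gamma).
Local Notation M := (group_vN R Gamma).

Definition rbounded (f : Gamma -> R) := exists C, forall x, `|f x| <= C.

Record invariant_mean (m : (Gamma -> R) -> R) : Prop := InvariantMean {
  mean_lin : forall a f f', rbounded f -> rbounded f' ->
    m (fun x => a * f x + f' x) = a * m f + m f';
  mean_ge0 : forall f, rbounded f -> (forall x, 0 <= f x) -> 0 <= m f;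
  mean1 : m (fun=> 1) = 1;
  mean_inv : forall f g, rbounded f -> m (fun x => f (g * x)%g) = m f }.

Variables (m : (Gamma -> R) -> R) (hm : invariant_mean m).

Lemma rbounded_cst c : rbounded (fun=> c).
Proof. by exists `|c|. Qed.

Lemma rboundedZD a f f' : rbounded f -> rbounded f' -> rbounded (fun x => a * f x + f' x).
Proof.
move=> [C fC] [C' fC']; exists (`|a| * C + C') => x.
by apply: le_trans (ler_normD _ _) _; rewrite normrM lerD// ler_wpM2l.
Qed.

Lemma mean0 : m (fun=> 0) = 0.
Proof.
have := mean_lin hm 0 (rbounded_cst 1) (rbounded_cst 0).
rewrite (_ : (fun _ : Gamma => 0 * 1 + 0 : R) = (fun=> 0)); last first.
  by apply/funext => x; rewrite mul0r addr0.
have := mean_lin hm 1 (rbounded_cst 0) (rbounded_cst 0).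
rewrite (_ : (fun _ : Gamma => 1 * 0 + 0 : R) = (fun=> 0)); last first.
  by apply/funext => x; rewrite mulr0 addr0.
by rewrite mul1r => h _; lra.
Qed.

Lemma meanZ a f : rbounded f -> m (fun x => a * f x) = a * m f.
Proof.
move=> bf; have := mean_lin hm a bf (rbounded_cst 0); rewrite mean0 addr0 => <-.
by congr m; apply/funext => x; rewrite addr0.
Qed.

Lemma meanD f f' : rbounded f -> rbounded f' -> m (fun x => f x + f' x) = m f + m f'.
Proof.
move=> bf bf'; have := mean_lin hm 1 bf bf'; rewrite mul1r => <-.
by congr m; apply/funext => x; rewrite mul1r.
Qed.

Lemma mean_cst c : m (fun=> c) = c.
Proof.
have := meanZ c (rbounded_cst 1); rewrite (mean1 hm) mulr1 => E; rewrite -[RHS]E.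
by congr m; apply/funext => x; rewrite mulr1.
Qed.

Lemma mean_le f f' : rbounded f -> rbounded f' -> (forall x, f x <= f' x) -> m f <= m f'.
Proof.
move=> bf bf' ff'; rewrite -subr_ge0.
have -> : m f' - m f = m (fun x => -1 * f x + f' x) by rewrite (mean_lin hm)//; ring.
by apply: (mean_ge0 hm) => // [|x]; [exact: rboundedZD|rewrite mulN1r addrC subr_ge0].
Qed.

Lemma mean_sum (J : Type) (r : seq J) (F : J -> Gamma -> R) :
  (forall j, rbounded (F j)) ->
  rbounded (fun x => \sum_(j <- r) F j x) /\
  m (fun x => \sum_(j <- r) F j x) = \sum_(j <- r) m (F j).
Proof.
move=> bF; elim: r => [|j r [IHb IH]].
  rewrite (_ : (fun x => _) = (fun=> 0)); last by apply/funext => x; rewrite big_nil.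
  by split; [exact: rbounded_cst|rewrite mean0 big_nil].
rewrite (_ : (fun x => _) = (fun x => F j x + \sum_(j <- r) F j x)); last first.
  by apply/funext => x; rewrite big_cons.
split; last by rewrite meanD// IH big_cons.
have := rboundedZD 1 (bF j) IHb.
by rewrite (_ : (fun x => 1 * _ + _) = (fun x => F j x + \sum_(j <- r) F j x))//;
  apply/funext => x; rewrite mul1r.
Qed.

Definition cmean (f : Gamma -> R[i]) : R[i] :=
  Complex (m (fun x => complex.Re (f x))) (m (fun x => complex.Im (f x))).

Lemma cbounded_Re (f : Gamma -> R[i]) : cbounded f -> rbounded (fun x => complex.Re (f x)).
Proof. by move=> [C fC]; exists C => x; apply: le_trans (Re_le_cabs _) (fC x). Qed.

Lemma cbounded_Im (f : Gamma -> R[i]) : cbounded f -> rbounded (fun x => complex.Im (f x)).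
Proof. by move=> [C fC]; exists C => x; apply: le_trans (Im_le_cabs _) (fC x). Qed.

Lemma cmean_lin a (f f' : Gamma -> R[i]) : cbounded f -> cbounded f' ->
  cmean (fun x => a * f x + f' x) = a * cmean f + cmean f'.
Proof.
move=> bf bf'; case: a => u v; rewrite /cmean.
have [[[r1 i1] r2] i2] := (cbounded_Re bf, cbounded_Im bf, cbounded_Re bf', cbounded_Im bf').
apply/eqP; rewrite eq_complex /=; apply/andP; split; apply/eqP.
  have -> : (fun x => complex.Re ((u +i* v)%C * f x + f' x)) =
      (fun x => u * complex.Re (f x) + (- v * complex.Im (f x) + complex.Re (f' x))).
    by apply/funext => x; case: (f x) => p q; case: (f' x) => s t /=; ring.
  by rewrite !(mean_lin hm)//; [ring|exact: rboundedZD].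
have -> : (fun x => complex.Im ((u +i* v)%C * f x + f' x)) =
    (fun x => u * complex.Im (f x) + (v * complex.Re (f x) + complex.Im (f' x))).
  by apply/funext => x; case: (f x) => p q; case: (f' x) => s t /=; ring.
by rewrite !(mean_lin hm)//; [ring|exact: rboundedZD].
Qed.

Lemma cmean_cst c : cmean (fun=> c) = c.
Proof. by rewrite /cmean !mean_cst; case: c. Qed.

Lemma cmean_inv (f : Gamma -> R[i]) g : cbounded f ->
  cmean (fun x => f (g * x)%g) = cmean f.
Proof.
move=> bf; rewrite /cmean; congr Complex.
  exact: (mean_inv hm g (cbounded_Re bf)).
exact: (mean_inv hm g (cbounded_Im bf)).
Qed.

Lemma cmean_bound (f : Gamma -> R[i]) C : (forall x, cabs (f x) <= C) ->
  cabs (cmean f) <= C.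
Proof.
move=> fC; have bf : cbounded f by exists C.
have [a a1 az] := cabs_phase (cmean f).
have b0 : cbounded (fun _ : Gamma => 0 : R[i]) by exists 0 => x; rewrite Normc.normc0.
have E : cmean (fun x => a * f x) = (cabs (cmean f))%:C%C.
  rewrite -az; have := cmean_lin a bf b0; rewrite cmean_cst addr0 => <-.
  by congr cmean; apply/funext => x; rewrite addr0.
have baf : cbounded (fun x => a * f x).
  by exists C => x; rewrite Normc.normcM a1 mul1r.
rewrite -[leLHS]/(complex.Re (cabs (cmean f))%:C%C) -E /= -[leRHS]mean_cst.
apply: mean_le (rbounded_cst _) _ => [|x]; first exact: cbounded_Re.
apply: le_trans (ler_norm _) _; apply: le_trans (Re_le_cabs _) _.
by rewrite Normc.normcM a1 mul1r.
Qed.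

(** The matrix coefficients of the mean of the conjugates of T by right translations. *)
Definition avg_form (T : B) (x y : H) : R[i] :=
  cmean (fun g => dot (T (rtrans g^-1%g x)) (rtrans g^-1%g y)).

Lemma avg_bound (T : B) x y g :
  cabs (dot (T (rtrans g^-1%g x)) (rtrans g^-1%g y)) <= opnorm T * nrm x * nrm y.
Proof. by apply: le_trans (dot_bop_le _ _ _) _; rewrite !nrm_rtrans. Qed.

Lemma avg_cbounded (T : B) x y :
  cbounded (fun g => dot (T (rtrans g^-1%g x)) (rtrans g^-1%g y)).
Proof. by exists (opnorm T * nrm x * nrm y) => g; exact: avg_bound. Qed.

Lemma avg_formDl T a x x' y :
  avg_form T (a *: x + x') y = a * avg_form T x y + avg_form T x' y.
Proof.
rewrite -cmean_lin; try exact: avg_cbounded.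
by congr cmean; apply/funext => g; rewrite !bop_linear dotDl dotZl.
Qed.

Lemma avg_formDr T a x y y' :
  avg_form T x (a *: y + y') = conjc a * avg_form T x y + avg_form T x y'.
Proof.
rewrite -cmean_lin; try exact: avg_cbounded.
by congr cmean; apply/funext => g; rewrite !bop_linear dotDr dotZr.
Qed.

Lemma avg_form0r T x : avg_form T x 0 = 0.
Proof.
rewrite /avg_form (_ : (fun g => _) = (fun=> 0)) ?cmean_cst//.
by apply/funext => g; rewrite bop0 dot0r.
Qed.

Lemma avg_formTl T T' a x y :
  avg_form (a *: T + T') x y = a * avg_form T x y + avg_form T' x y.
Proof.
rewrite -cmean_lin; try exact: avg_cbounded.
by congr cmean; apply/funext => g; rewrite bop_addE bop_scaleE dotDl dotZl.
Qed.

Lemma avg_form_le T x y : cabs (avg_form T x y) <= opnorm T * nrm x * nrm y.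
Proof. by apply: cmean_bound => g; exact: avg_bound. Qed.

Lemma avg_exists (T : B) : exists E : B,
  (forall x h, E x h = avg_form T x (delta h)) /\ opnorm E <= opnorm T.
Proof.
apply: (@bop_of_coords _ _ (fun x h => avg_form T x (delta h))); first exact: opnorm_ge0.
  by move=> a x y h; exact: avg_formDl.
move=> x A uA; set F := fun h => avg_form T x (delta h).
pose y : H := \sum_(h <- A) F h *: delta h.
have yE h : h \in A -> y h = F h.
  move=> hA; rewrite /y ell2_sum (bigD1_seq h)// big1 => [|j jh].
    by rewrite [LHS]addr0 ell2Z deltaE eqxx mulr1.
  by rewrite ell2Z deltaE (negPf jh) mulr0.
set S := \sum_(h <- A) _.
have dyy : dot y y = S%:C%C.
  rewrite {2}/y dot_sumr /S (rmorph_sum (real_complex R)) /=.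
  rewrite [LHS]big_seq [RHS]big_seq; apply: eq_bigr => h hA.
  by rewrite dotZr dot_deltar yE// mulrC mulc_conj.
have yS : nrm y ^+ 2 = S by apply: (@complexI R); rewrite -dotxx dyy.
have fy : avg_form T x y = S%:C%C.
  rewrite /y /S (rmorph_sum (real_complex R)) /=; elim: (A) => [|h r IH].
    by rewrite !big_nil avg_form0r.
  by rewrite !big_cons avg_formDr IH mulrC mulc_conj.
have S0 : 0 <= S by rewrite -yS sqr_ge0.
have := avg_form_le T x y; rewrite fy cabs_real ger0_norm// -yS => h.
rewrite ler_pXn2r ?nnegrE ?mulr_ge0 ?opnorm_ge0 ?nrm_ge0//.
have [->|y0] := eqVneq (nrm y) 0; first by rewrite mulr_ge0 ?opnorm_ge0 ?nrm_ge0.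
have yp : 0 < nrm y by rewrite lt_neqAle eq_sym y0 nrm_ge0.
by rewrite -(ler_pM2r yp) -expr2.
Qed.

(** Invariance of the mean makes the averaged operator commute with right
    translations, so it lies in the algebra; an operator of the algebra equals all
    its conjugates, so it is its own average. *)
Theorem mean_injective : injective_vN M.
Proof.
have [E hE] := choice avg_exists.
have EE T x h : E T x h = avg_form T x (delta h) by case: (hE T).
exists E; split.
- move=> a S T; apply: bopP => x; apply: ell2P => h.
  by rewrite bop_addE bop_scaleE ell2D ell2Z !EE avg_formTl.
- move=> T; apply: vN_of_rtrans => k x; apply: ell2P => h.
  rewrite rtransE !EE /avg_form.
  rewrite -(cmean_inv k^-1%g (avg_cbounded T x (delta (h * k)%g))).
  congr cmean; apply/funext => g.
  rewrite !rtrans_delta !invgK -mulgA mulVKg invgM invgK.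
  by rewrite rtransM.
- move=> T hT; apply: bopP => x; apply: ell2P => h.
  rewrite EE /avg_form (_ : (fun g => _) = (fun=> T x h)) ?cmean_cst//.
  apply/funext => g; rewrite vN_rtrans// dot_rtrans invgK -rtransM mulgV rtrans1.
  by rewrite dot_deltar.
- by move=> T; case: (hE T).
Qed.

End Means.

(** * Invariant means from almost invariant vectors *)

Section UltraLimit.
Context {R : realType} {L : Type}.

Lemma ultralimit (G : set_system L) (a : L -> R) C : UltraFilter G ->
  (forall l, `|a l| <= C) -> cvg (a @ G).
Proof.
move=> UG aC; pose S := [set r | G [set l | r <= a l]].
have aC1 l : - C <= a l by have := aC l; rewrite ler_norml => /andP[].
have aC2 l : a l <= C by have := aC l; rewrite ler_norml => /andP[].
have hS : has_sup S.
  split; first by exists (- C); apply: filterS filterT => l _ /=.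
  by exists C => r /= /filter_ex[l /= rl]; exact: le_trans rl _.
apply/cvg_ex; exists (sup S); apply/cvgrPdist_le => e e0.
have [r Sr re] := sup_adherent e0 hS.
have : G [set l | a l < sup S + e].
  have [|] := in_ultra_setVsetC [set l | sup S + e <= a l] UG.
    move=> h; have : sup S + e <= sup S by apply: ub_le_sup => //; case: hS.
    by rewrite gerDl leNgt e0.
  by apply: filterS => l /= /negP; rewrite -ltNge.
move: Sr; rewrite /S /= => Sr h; near=> l.
have h1 : r <= a l by near: l.
have h2 : a l < sup S + e by near: l.
by rewrite ler_norml; apply/andP; split; lra.
Unshelve. all: by end_near. Qed.

End UltraLimit.

Section AlmostInvariant.
Context {R : realType} {Gamma : groupType}.
Local Notation H := (ell2 R Gamma).
Local Notation nrm := (@ell2_norm R Gamma).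
Local Notation lam := (@lregular R Gamma).

Definition supported (x : H) (A : seq Gamma) := forall h, h \notin A -> x h = 0.

(** Weak containment of the trivial representation in the regular one. *)
Definition almost_invariant_vectors := forall (W : seq Gamma) (d : R), 0 < d ->
  exists (x : H) (A : seq Gamma),
    [/\ supported x A, nrm x = 1 & forall g, g \in W -> nrm (lam g x - x) <= d].

Definition state (f : Gamma -> R) (x : H) : R :=
  complex.Re (dot (mulop (fun g => (f g)%:C%C) x) x).

Lemma realc_bounded (f : Gamma -> R) : rbounded f -> cbounded (fun g => (f g)%:C%C).
Proof. by move=> [C fC]; exists C => g; rewrite cabs_real. Qed.

Lemma state_lin a f f' x : rbounded f -> rbounded f' ->
  state (fun g => a * f g + f' g) x = a * state f x + state f' x.
Proof.
move=> bf bf'; rewrite /state.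
have -> : mulop (fun g => (a * f g + f' g)%:C%C) x =
    a%:C%C *: mulop (fun g => (f g)%:C%C) x + mulop (fun g => (f' g)%:C%C) x.
  apply: ell2P => i; rewrite ell2D ell2Z !mulopE; try exact: realc_bounded.
    by rewrite realcD realcM; ring.
  by apply: realc_bounded; exact: rboundedZD.
rewrite dotDl dotZl ReD; congr (_ + _).
by case: (dot (mulop (fun g => (f g)%:C%C) x) x) => u v /=; ring.
Qed.

Lemma state_bound f C x : 0 <= C -> (forall g, `|f g| <= C) -> `|state f x| <= C * nrm x ^+ 2.
Proof.
move=> C0 fC; apply: le_trans (Re_le_cabs _) _; apply: le_trans (dot_bop_le _ _ _) _.
rewrite -mulrA -expr2 ler_wpM2r ?sqr_ge0// opnorm_mulop// => g.
by rewrite cabs_real.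
Qed.

Lemma state_ge0 f x : rbounded f -> (forall g, 0 <= f g) -> 0 <= state f x.
Proof.
move=> bf f0; rewrite /state /dot /csum /=.
have [s _] := dot_csummable (mulop (fun g => (f g)%:C%C) x) x.
apply: rsum_ge0 => // g; rewrite mulopE; last exact: realc_bounded.
rewrite -mulrA mulc_conj -realcM /=.
by rewrite mulr_ge0 ?sqr_ge0.
Qed.

Lemma state1 x : state (fun=> 1) x = nrm x ^+ 2.
Proof.
rewrite /state (_ : mulop _ x = x) ?dotxx//; apply: ell2P => g.
rewrite mulopE ?mul1r//; exact: realc_bounded (rbounded_cst 1).
Qed.

Lemma state_shift f g x : rbounded f ->
  state (fun h => f (g * h)%g) x = state f (lam g x).
Proof.
move=> bf; rewrite /state /dot; congr complex.Re.
rewrite -[RHS](csum_reindex _ (mulg_bij g)); congr csum; apply/funext => h.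
rewrite !mulopE; try exact: realc_bounded.
  by rewrite /= mulKg.
by case: bf => C fC; apply: realc_bounded; exists C => k.
Qed.

Lemma state_diff f C x y : 0 <= C -> (forall g, `|f g| <= C) ->
  `|state f x - state f y| <= C * (nrm x + nrm y) * nrm (x - y).
Proof.
move=> C0 fC; rewrite /state; set F := mulop _.
have FC : opnorm F <= C by apply: opnorm_mulop => // g; rewrite cabs_real.
rewrite -ReB.
have -> : dot (F x) x - dot (F y) y = dot (F (x - y)) x + dot (F y) (x - y).
  by rewrite bopB dotBl dotBr; ring.
apply: le_trans (Re_le_cabs _) _; apply: le_trans (le_normcD _ _) _.
have h1 := dot_bop_le F (x - y) x; have h2 := dot_bop_le F y (x - y).
have p (s t : H) : opnorm F * nrm s * nrm t <= C * nrm s * nrm t.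
  by rewrite ler_wpM2r ?nrm_ge0// ler_wpM2r ?nrm_ge0.
have := lerD (le_trans h1 (p _ _)) (le_trans h2 (p _ _)).
by move=> h; apply: le_trans h _; rewrite le_eqVlt; apply/orP; left; apply/eqP; ring.
Qed.

Let L := (seq Gamma * nat)%type.
Let tails (l : L) : set L := [set k : L | {subset l.1 <= k.1} /\ (l.2 <= k.2)%N].

(** The mean is the limit, along an ultrafilter, of the vector states of almost
    invariant vectors: translating a function amounts to translating the vector,
    which changes the state by little. *)
Theorem almost_invariant_mean : almost_invariant_vectors ->
  exists m : (Gamma -> R) -> R, invariant_mean m.
Proof.
move=> ai.
have /choice[v hv] (l : L) : exists x : H,
    nrm x = 1 /\ forall g, g \in l.1 -> nrm (lam g x - x) <= (l.2.+1%:R)^-1.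
  have [|x [A [_ x1 xW]]] := ai l.1 (l.2.+1%:R)^-1; first by rewrite invr_gt0.
  by exists x.
have v1 l : nrm (v l) = 1 by case: (hv l).
have PF : ProperFilter (filter_from [set: L] tails).
  apply: filter_from_proper; last by move=> l _; exists l; split.
  apply: filter_from_filter; first by exists ([::], 0%N).
  move=> [W n] [W' n'] _ _; exists (W ++ W', maxn n n') => // k [/= s m]; split; split=> /=.
  - by move=> g gW; apply: s; rewrite mem_cat gW.
  - by apply: leq_trans m; exact: leq_maxl.
  - by move=> g gW; apply: s; rewrite mem_cat gW orbT.
  - by apply: leq_trans m; exact: leq_maxr.
have [G [UG FG]] := ultraFilterLemma PF.
pose m f := lim ((fun l => state f (v l)) @ G).
have cv f : rbounded f -> (fun l => state f (v l)) @ G --> m f.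
  move=> [C fC]; apply: (@ultralimit _ _ _ _ `|C|) => l.
  have := @state_bound f `|C| (v l) (normr_ge0 _).
  rewrite v1 expr1n mulr1; apply => g.
  exact: le_trans (fC g) (ler_norm _).
have mE f r : (fun l => state f (v l)) @ G --> r -> m f = r.
  by move=> h; apply: cvg_lim => //; exact: Rhausdorff.
exists m; split.
- move=> a f f' bf bf'; apply: mE.
  rewrite (_ : (fun l => _) = (fun l => a * state f (v l) + state f' (v l))); last first.
    by apply/funext => l; rewrite state_lin.
  by apply: cvgD; [apply: cvgMr; exact: cv|exact: cv].
- move=> f bf f0; apply: (cvgr_to_ge (cv f bf)).
  by apply: nearW => l; exact: state_ge0.
- apply: mE; rewrite (_ : (fun l => _) = (fun=> 1)); first exact: cvg_cst.
  by apply/funext => l; rewrite state1 v1 expr1n.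
- move=> f g bf; apply: mE; case: (bf) => C fC.
  have fC' x : `|f x| <= `|C| by apply: le_trans (fC x) (ler_norm _).
  apply/cvgrPdist_le => e e0.
  have e2 : 0 < e / 2 by rewrite divr_gt0.
  have := cv f bf => /cvgrPdist_le/(_ _ e2) h1.
  pose N := Num.trunc (2 * `|C| / (e / 2)).
  have h2 : G (tails ([:: g], N)) by apply: FG; exists ([:: g], N).
  near=> l.
  have : `|m f - state f (v l)| <= e / 2 by near: l.
  have : tails ([:: g], N) l by near: l.
  move=> [/= /(_ g (mem_head _ _)) gl Nl] h.
  rewrite state_shift//.
  have := state_diff (v l) (lam g (v l)) (normr_ge0 C) fC'.
  rewrite nrm_lreg v1 nrmBC => h3.
  have h4 : nrm (lam g (v l) - v l) <= l.2.+1%:R^-1 by have [_ ->] := hv l.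
  have h5 : `|C| * (1 + 1) * nrm (lam g (v l) - v l) <= e / 2.
    apply: le_trans (ler_wpM2l _ h4) _; first by rewrite mulr_ge0.
    rewrite ler_pdivrMr ?ltr0n// -ler_pdivrMl//.
    rewrite (_ : _ * (`|C| * _) = 2 * `|C| / (e / 2)); last first.
      by rewrite mulrC; congr (_ / _); ring.
    apply: ltW; apply: lt_le_trans (truncnS_gt _) _.
    by rewrite ler_nat ltnS.
  have := ler_normD (m f - state f (v l)) (state f (v l) - state f (lam g (v l))).
  rewrite addrA subrK => /le_trans; apply.
  rewrite [leRHS](_ : e = e / 2 + e / 2); last by field.
  by apply: lerD => //; exact: le_trans h3 h5.
Unshelve. all: by end_near. Qed.

End AlmostInvariant.

(** * Spectral gap in the absence of almost invariant vectors *)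

Section SpectralGap.
Context {R : realType} {Gamma : groupType}.
Local Notation H := (ell2 R Gamma).
Local Notation B := (bop R Gamma).
Local Notation nrm := (@ell2_norm R Gamma).
Local Notation lam := (@lregular R Gamma).
Implicit Types (W : seq Gamma) (x : H).

Definition lsum W : B := \sum_(w <- W) lam w.

Definition symmetric_seq W := perm_eq [seq (w^-1)%g | w <- W] W.

Lemma lsumE W x : lsum W x = \sum_(w <- W) lam w x.
Proof. exact: bop_sumE. Qed.

Lemma lsum_le W x : nrm (lsum W x) <= (size W)%:R * nrm x.
Proof.
rewrite lsumE; apply: le_trans (nrm_sum _ _ _) _.
under eq_bigr do rewrite nrm_lreg.
by rewrite big_const_seq count_predT iter_addr_0 mulr_natl.
Qed.

Lemma lsum_bound_dense W q : 0 <= q ->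
  (forall x A, supported x A -> nrm x = 1 -> nrm (lsum W x) <= q) ->
  forall x, nrm (lsum W x) <= q * nrm x.
Proof.
move=> q0 h.
have hA x A : supported x A -> nrm (lsum W x) <= q * nrm x.
  move=> xA; have [x0|x0] := eqVneq (nrm x) 0; first by rewrite (nrm_eq0 x0) bop0 nrm0 mulr0.
  have xp : 0 < nrm x by rewrite lt_neqAle eq_sym x0 nrm_ge0.
  have := h ((nrm x)^-1%:C%C *: x) A.
  rewrite bopZ !nrmZ !cabs_real ger0_norm ?invr_ge0 ?nrm_ge0// mulVf//.
  rewrite ler_pdivrMl// mulrC; apply => // g gA.
  by rewrite ell2Z xA// mulr0.
move=> x; apply/ler_addgt0Pr => e e0.
pose n : R := (size W)%:R + q + 1.
have n0 : 0 < n by rewrite ltr_wpDl// addr_ge0.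
have [A /(_ A (fun _ => id))/ltW hx] := trunc_dense x (divr_gt0 e0 n0).
have hT : nrm (lsum W (trunc A x)) <= q * nrm (trunc A x).
  by apply: (hA _ A) => g /negPf gA; rewrite truncE gA.
have := nrmD (lsum W (trunc A x)) (lsum W (x - trunc A x)).
rewrite -bopD addrC subrK => /le_trans; apply; apply: lerD.
  by apply: le_trans hT _; rewrite ler_wpM2l// nrm_trunc_le.
apply: le_trans (lsum_le _ _) _.
apply: (@le_trans _ _ (n * nrm (x - trunc A x))).
  by rewrite ler_wpM2r ?nrm_ge0// /n -addrA lerDl addr_ge0.
by rewrite mulrC -ler_pdivlMr.
Qed.

(** If no unit vector is moved little by all members of a finite list, the
    parallelogram identity keeps the sum of the corresponding translations
    uniformly below its trivial bound. *)
Lemma spectral_gap : ~ @almost_invariant_vectors R Gamma ->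
  exists W q, [/\ symmetric_seq W, 0 < q < (size W)%:R &
    forall x, nrm (lsum W x) <= q * nrm x].
Proof.
move=> /existsNP[F /existsNP[d /not_implyP[d0 hF]]].
have {hF} far x A : supported x A -> nrm x = 1 ->
    exists2 g, g \in F & d < nrm (lam g x - x).
  move=> xA x1; apply: contrapT => h; apply: hF; exists x, A; split => // g gF.
  by rewrite leNgt; apply/negP => dg; apply: h; exists g.
have far2 x g : nrm x = 1 -> d < nrm (lam g x - x) -> d < 2 /\
    nrm (x + lam g x) <= 2 - d ^+ 2 / 4.
  move=> x1 dx.
  have d2 : d < 2.
    apply: lt_le_trans dx _; apply: le_trans (nrmB _ _) _.
    by rewrite nrm_lreg x1.
  split=> //.
  have c0 : 0 <= 2 - d ^+ 2 / 4 by nra.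
  rewrite -(@ler_pXn2r _ 2)// ?nnegrE ?nrm_ge0//.
  have := nrmD_sq x (lam g x); rewrite nrm_lreg x1 => ->.
  have := nrmD_sq (lam g x) (- x); rewrite nrmN dotNr nrm_lreg x1 dotC.
  case: (dot x (lam g x)) => u v /= h.
  have dsq : d ^+ 2 <= nrm (lam g x - x) ^+ 2.
    by rewrite ler_pXn2r ?nnegrE ?nrm_ge0 ?(ltW d0)// ltW.
  have e4 : 0 <= d ^+ 2 by exact: sqr_ge0.
  rewrite h in dsq; nra.
pose W := 1%g :: F ++ [seq (w^-1)%g | w <- F].
have d2 : d < 2.
  have [||g _ dg] := far (delta 1%g) [:: 1%g]; rewrite ?nrm_delta//.
    by move=> h; rewrite inE eq_sym deltaE => /negPf ->.
  by have [] := far2 _ _ (nrm_delta _) dg.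
have sW : (size W)%:R = 1 + (size (F ++ [seq (w^-1)%g | w <- F]))%:R :> R.
  by rewrite /W /= -natr1 addrC.
have e4 : 0 < d ^+ 2 by rewrite exprn_gt0.
exists W, ((size W)%:R - d ^+ 2 / 4); split.
- rewrite /symmetric_seq /W /= invg1 perm_cons map_cat -map_comp.
  by rewrite (@eq_map _ _ _ id (@invgK Gamma)) map_id perm_catC.
- rewrite sW; set n := _%:R; have n0 : 0 <= n by rewrite ler0n.
  by apply/andP; split; nra.
- apply: lsum_bound_dense.
    rewrite sW; set n := _%:R; have n0 : 0 <= n by rewrite ler0n.
    nra.
  move=> x A xA x1; have [g gF dg] := far x A xA x1.
  have [_ hg] := far2 x g x1 dg.
  rewrite sW lsumE /W big_cons lreg1.
  have gr : g \in F ++ [seq (w^-1)%g | w <- F] by rewrite mem_cat gF.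
  have p := perm_to_rem gr.
  rewrite (perm_big _ p) (perm_size p) big_cons addrA /= -natr1.
  apply: le_trans (nrmD _ _) _.
  have hr := lsum_le (rem g (F ++ [seq (w^-1)%g | w <- F])) x.
  rewrite lsumE x1 mulr1 in hr.
  by have := lerD hg hr => h; apply: le_trans h _; lra.
Qed.

End SpectralGap.

(** * Almost invariant vectors from an invariant mean *)

Section GreenFunction.
Context {R : realType} {Gamma : groupType}.
Local Notation H := (ell2 R Gamma).
Local Notation nrm := (@ell2_norm R Gamma).
Local Notation delta := (@delta R Gamma).
Variables (W : seq Gamma) (q : R).
Hypotheses (symW : symmetric_seq W) (q0 : 0 < q).
Hypothesis gap : forall x : H, nrm (lsum W x) <= q * nrm x.

Fixpoint walks (k : nat) : Gamma -> R :=
  if k is k'.+1 then fun x => \sum_(w <- W) walks k' (w^-1 * x)%g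
  else fun x => (1%g == x)%:R.

Lemma walks_ge0 k x : 0 <= walks k x.
Proof. by elim: k x => [|k IH] x /=; rewrite ?ler0n ?sumr_ge0. Qed.

Lemma walks_iter k : forall x, (walks k x)%:C%C = iter k (lsum W) (delta 1%g) x.
Proof.
elim: k => [|k IH] x; first exact: (rmorph_nat (real_complex R)).
rewrite [walks _ _]/= iterS.
rewrite lsumE ell2_sum (rmorph_sum (real_complex R)); apply: eq_bigr => w _.
by rewrite lregE -IH.
Qed.

Lemma walks_le k x : walks k x <= q ^+ k.
Proof.
have : nrm (iter k (lsum W) (delta 1%g)) <= q ^+ k.
  elim: k => [|k IH]; first by rewrite nrm_delta.
  by apply: le_trans (gap _) _; rewrite exprS ler_wpM2l// ltW.
apply: le_trans; apply: le_trans (coord_le_nrm _ x).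
by rewrite -walks_iter cabs_real ger0_norm ?walks_ge0.
Qed.

Variable t : R.
Hypotheses (t_gt_q : q < t) (t_lt_W : t < (size W)%:R).

Let t0 : 0 < t. Proof. exact: lt_trans t_gt_q. Qed.

Let term x k := walks k x / t ^+ k.

Let term_ge0 x k : 0 <= term x k.
Proof. by rewrite divr_ge0 ?walks_ge0// exprn_ge0// ltW. Qed.

Lemma green_cvg x : cvgn (series (term x)).
Proof.
apply: (@series_le_cvg _ _ (geometric 1 (q / t))) => [k|k|k|].
- exact: term_ge0.
- by rewrite /geometric /= mul1r exprn_ge0// divr_ge0// ltW.
- rewrite /geometric /= mul1r /term (expr_div_n q).
  by rewrite ler_wpM2r ?invr_ge0 ?exprn_ge0 ?walks_le// ltW.
- apply: is_cvg_geometric_series.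
  by rewrite ger0_norm ?ltr_pdivrMr ?mul1r// divr_ge0// ltW.
Qed.

(** The Green function at the parameter 1 / t; it converges since t exceeds the
    norm bound q. *)
Definition green x : R := limn (series (term x)).

Lemma green_term x k : term x k <= green x.
Proof.
have nd : nondecreasing_seq (series (term x)).
  by apply: nondecreasing_series => i _ _; exact: term_ge0.
apply: le_trans (nondecreasing_cvgn_le nd (@green_cvg x) k.+1).
by rewrite seriesSr /= lerDr sumr_ge0.
Qed.

(** Convolution with W shifts the series by one term, and each term carries one
    factor 1 / t more than its predecessor. *)
Lemma green_superharmonic x : \sum_(w <- W) green (w^-1 * x)%g <= t * green x.
Proof.
have c : (fun n => \sum_(w <- W) series (term (w^-1 * x)%g) n) @ \oo -->
    \sum_(w <- W) green (w^-1 * x)%g.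
  rewrite -[X in X @ _ --> _]/(fun n => (\sum_(w <- W) series (term (w^-1 * x)%g) n)).
  by apply: cvg_big => // [|w _]; [exact: add_continuous|exact: green_cvg].
apply: (cvgr_to_le c); apply: nearW => n.
rewrite /series /= exchange_big /=.
apply: (@le_trans _ _ (\sum_(0 <= k < n) t * term x k.+1)).
  rewrite le_eqVlt; apply/orP; left; apply/eqP; apply: eq_bigr => k _.
  by rewrite /term /= -mulr_suml exprS invfM; field; rewrite ?expf_neq0 ?gt_eqF//.
rewrite -mulr_sumr ler_pM2l//.
apply: (@le_trans _ _ (series (term x) n.+1)).
  by rewrite /series /= big_nat_recl//= lerDr.
apply: (nondecreasing_cvgn_le _ (@green_cvg x) n.+1).
by apply: nondecreasing_series => i _ _; exact: term_ge0.
Qed.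

Definition reachable x := exists k, 0 < walks k x.

Lemma mem_inv w : w \in W -> (w^-1)%g \in W.
Proof. by move=> wW; rewrite -(perm_mem symW); apply: map_f. Qed.

Lemma reachableM w x : w \in W -> reachable x -> reachable (w * x)%g.
Proof.
move=> wW [k kx]; exists k.+1 => /=; apply: lt_le_trans kx _.
rewrite (big_rem w)//= mulKg lerDl sumr_ge0// => v _; exact: walks_ge0.
Qed.

Lemma reachable_inv w x : w \in W -> reachable (w^-1 * x)%g <-> reachable x.
Proof.
move=> wW; split=> [|h]; last by apply: reachableM => //; exact: mem_inv.
by move=> /(reachableM wW); rewrite mulVKg.
Qed.

Lemma green_gt0 x : reachable x -> 0 < green x.
Proof.
move=> [k kx]; apply: lt_le_trans (green_term x k).
by rewrite divr_gt0// exprn_gt0.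
Qed.

(* The reachable elements need not exhaust the group; a choice of base points
   in the cosets transports the Green function to a positive function on it. *)
Let base x := xget 1%g [set y | reachable (x * y^-1)%g].

Let base_reach x : reachable (x * (base x)^-1)%g.
Proof.
rewrite /base; case: xgetP => // h; exfalso.
by apply: (h x); exists 0%N; rewrite /= mulgV eqxx ltr01.
Qed.

Let base_inv w x : w \in W -> base (w^-1 * x)%g = base x.
Proof.
move=> wW; rewrite /base; congr xget; apply/seteqP; split=> y /=.
  by rewrite -mulgA => /(reachable_inv _ wW).
by rewrite -mulgA => h; apply/(reachable_inv _ wW).
Qed.

Let V x := green (x * (base x)^-1)%g.

Let V_gt0 x : 0 < V x. Proof. exact: green_gt0. Qed.

Let V_sum x : \sum_(w <- W) V (w^-1 * x)%g <= t * V x.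
Proof.
apply: le_trans (green_superharmonic _).
rewrite big_seq [leRHS]big_seq le_eqVlt; apply/orP; left; apply/eqP.
by apply: eq_bigr => w wW; rewrite /V base_inv// mulgA.
Qed.

Let V_le w x : w \in W -> V (w^-1 * x)%g <= t * V x.
Proof.
move=> wW; apply: le_trans (V_sum x); rewrite (big_rem w)//= lerDl sumr_ge0// => v _.
exact: ltW.
Qed.

(** The logarithmic increments of a positive strictly superharmonic function are
    bounded; their means cancel in inverse pairs, against their negative sum. *)
Lemma gap_no_mean (m : (Gamma -> R) -> R) : invariant_mean m -> False.
Proof.
move=> hm.
pose c w x := if w \in W then ln (V (w^-1 * x)%g) - ln (V x) else 0.
have lnV_le w x : w \in W -> ln (V (w^-1 * x)%g) <= ln t + ln (V x).
  by move=> wW; rewrite -lnM ?posrE// ler_ln ?posrE ?mulr_gt0// V_le.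
have bc w : rbounded (c w).
  rewrite /c; have [wW|_] := boolP (w \in W); last exact: rbounded_cst.
  exists (ln t) => x; rewrite ler_norml; apply/andP; split.
    have := lnV_le _ (w^-1 * x)%g (mem_inv wW).
    by rewrite invgK mulVKg; lra.
  by have := lnV_le _ x wW; lra.
have [bs ms] := mean_sum hm W bc.
have neg : m (fun x => \sum_(w <- W) c w x) <= t - (size W)%:R.
  rewrite -[leRHS](mean_cst hm); apply: (mean_le hm) => // [|x]; first exact: rbounded_cst.
  apply: (@le_trans _ _ (\sum_(w <- W) (V (w^-1 * x)%g / V x - 1))).
    rewrite big_seq [leRHS]big_seq; apply: ler_sum => w wW.
    rewrite /c wW -ln_div ?posrE// lerBrDr addrC.
    apply: le_trans (expR_ge1Dx _) _; rewrite lnK// posrE divr_gt0//.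
  rewrite sumrB -mulr_suml big_const_seq count_predT iter_addr_0.
  by rewrite lerD2r ler_pdivrMr.
have inv w : w \in W -> m (c (w^-1)%g) = - m (c w).
  move=> wW; rewrite -(mean_inv hm w (bc w)) -[RHS]mulN1r -(meanZ hm); last first.
    by have [C hC] := bc w; exists C => x; exact: hC.
  congr m; apply/funext => x; rewrite /c wW mem_inv// invgK mulKg; ring.
have : \sum_(w <- W) m (c w) = - \sum_(w <- W) m (c w).
  have /esym := perm_big (op := +%R) (x := 0) (P := xpredT) (F := fun w => m (c w)) _ symW.
  rewrite big_map => {1}->; rewrite -sumrN big_seq [RHS]big_seq.
  by apply: eq_bigr => w; exact: inv.
move: neg t_lt_W; rewrite ms; lra.
Qed.

End GreenFunction.

Theorem mean_almost_invariant (R : realType) (Gamma : groupType)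
    (m : (Gamma -> R) -> R) :
  invariant_mean m -> @almost_invariant_vectors R Gamma.
Proof.
move=> hm; apply: contrapT => /spectral_gap[W [q [sW /andP[q0 qW] h]]].
have [qt tW] := midf_lt qW.
exact: (gap_no_mean sW q0 h qt tW hm).
Qed.

(** * Positive definite functions of finite-rank completely positive maps *)

Section FiniteSpan.
Context {R : realType} {I : choiceType}.
Local Notation H := (ell2 R I).
Local Notation nrm := (@ell2_norm R I).

Definition proj (us : seq H) (x : H) : H := \sum_(u <- us) dot x u *: u.

Lemma dot_proj us x y : dot (proj us x) y = dot x (proj us y).
Proof.
rewrite /proj dot_suml dot_sumr; apply: eq_bigr => u _.
by rewrite dotZl dotZr -dotC mulrC.
Qed.

(** Gram-Schmidt; a list of unit vectors fixed by its own projection is the form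
    of orthonormality that the induction needs. *)
Lemma gram_schmidt (s : seq H) : exists us : seq H,
  [/\ forall u, u \in us -> nrm u = 1, forall u, u \in us -> proj us u = u &
      forall x, x \in s -> proj us x = x].
Proof.
elim: s => [|x s [us [us1 usP sP]]]; first by exists [::].
pose w := x - proj us x.
have wo u : u \in us -> dot w u = 0.
  by move=> uus; rewrite /w dotBl dot_proj usP// subrr.
have [w0|w0] := eqVneq w 0.
  exists us; split=> // y; rewrite inE => /orP[/eqP->|/sP//].
  by apply/eqP; rewrite eq_sym -subr_eq0 -/w w0.
have nw : nrm w != 0 by apply: contra_neq w0; exact: nrm_eq0.
pose u' := (nrm w)^-1%:C%C *: w.
have u'o u : u \in us -> dot u' u = 0 by move=> /wo h; rewrite dotZl h mulr0.
have u'o' u : u \in us -> dot u u' = 0 by move=> /u'o h; rewrite dotC h conjc0.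
have u'1 : nrm u' = 1.
  by rewrite nrmZ cabs_real ger0_norm ?invr_ge0 ?nrm_ge0// mulVf.
have pu' : proj us u' = 0.
  by rewrite /proj big1_seq// => u /andP[_ /u'o ->]; rewrite scale0r.
have pc y : proj (u' :: us) y = dot y u' *: u' + proj us y by rewrite /proj big_cons.
have fixed y : proj us y = y -> proj (u' :: us) y = y.
  by move=> py; rewrite pc -{1}py dot_proj pu' dot0r scale0r add0r.
exists (u' :: us); split=> [u|u|y]; rewrite inE => /orP[/eqP->|].
- by [].
- exact: us1.
- by rewrite pc pu' addr0 dotxx u'1 expr1n scale1r.
- by move=> /usP; exact: fixed.
- rewrite pc.
  have -> : dot x u' = (nrm w)%:C%C.
    rewrite (_ : x = w + proj us x); last by rewrite /w subrK.
    rewrite dotDl dot_proj pu' dot0r addr0 dotZr conjc_real dotxx -realcM.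
    by congr (_%:C%C); field.
  by rewrite scalerA -realcM divff// scale1r /w subrK.
- by move=> /sP; exact: fixed.
Qed.

(** An orthonormal basis of the span expands x as the sum of the <x, u> u, where
    |<x, u>| is at most the norm of x. *)
Lemma span_coord (n : nat) (e : 'I_n -> H) : exists us : seq H,
  (forall u, u \in us -> nrm u = 1) /\
  forall (c : 'I_n -> R[i]) i, cabs ((\sum_k c k *: e k) i) <=
    nrm (\sum_k c k *: e k) * \sum_(u <- us) cabs (u i).
Proof.
have [us [us1 _ usP]] := gram_schmidt [seq e k | k <- enum 'I_n].
exists us; split=> // c i; set x := \sum_k _.
have px : proj us x = x.
  rewrite /proj {1}/x.
  under eq_bigr do rewrite dot_suml scaler_suml.
  rewrite exchange_big /=; apply: eq_bigr => k _.
  under eq_bigr do rewrite dotZl -scalerA.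
  by rewrite -scaler_sumr -/(proj us (e k)) usP// map_f ?mem_enum.
rewrite -{1}px ell2_sum mulr_sumr; apply: le_trans (cabs_sum _ _ _) _.
rewrite big_seq [leRHS]big_seq; apply: ler_sum => u uus.
rewrite ell2Z Normc.normcM ler_wpM2r ?cabs_ge0//.
by apply: le_trans (cauchy_schwarz _ _) _; rewrite (us1 u uus) mulr1.
Qed.

End FiniteSpan.

Section Coefficients.
Context {R : realType} {Gamma : groupType}.
Local Notation H := (ell2 R Gamma).
Local Notation B := (bop R Gamma).
Local Notation nrm := (@ell2_norm R Gamma).
Local Notation M := (group_vN R Gamma).
Local Notation lam := (@lregular R Gamma).
Local Notation delta := (@delta R Gamma).
Variables (Phi : B -> B) (hPhi : normal_finite_rank_ucp M Phi).

(** The operators lam (g^-1 * h) form a Gram matrix: its quadratic form at the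
    vectors x_g is the squared norm of the sum of the lam g x_g. *)
Lemma kernel_ge0 (s : seq (Gamma * H)) :
  0 <= \sum_(p <- s) \sum_(p' <- s) dot (Phi (lam (p.1^-1 * p'.1)%g) p'.2) p.2.
Proof.
case: hPhi => _ _ cp _ _; pose p0 := (1%g : Gamma, 0 : H).
pose X : 'M[B]_(size s) :=
  \matrix_(i, j) lam ((nth p0 s i).1^-1 * (nth p0 s j).1)%g.
have XM i j : M (X i j) by rewrite mxE; exact: vN_lreg.
have Xpos : mx_positive X.
  move=> x; set y := \sum_(i < size s) lam (nth p0 s i).1 (x i).
  rewrite [leRHS](_ : _ = dot y y); first by rewrite dotxx ler0c sqr_ge0.
  rewrite {2}/y dot_sumr; apply: eq_bigr => i _; rewrite /y dot_suml.
  by apply: eq_bigr => j _; rewrite mxE lregM dot_lreg invgK.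
have := cp _ X XM Xpos (fun i => (nth p0 s i).2).
rewrite (big_nth p0) big_mkord; congr (0 <= _); apply: eq_bigr => i _.
rewrite (big_nth p0) big_mkord; apply: eq_bigr => j _.
by rewrite !mxE.
Qed.

Lemma Phi1 x : Phi (lam 1%g) x = x.
Proof. by case: hPhi => _ _ _ h _; rewrite lreg1 h. Qed.

(** Positivity at the two points 1 and g; symmetry comes from comparing the
    vectors y and i y. *)
Lemma Phi_hermitian g x y :
  dot (Phi (lam g^-1%g) x) y = conjc (dot (Phi (lam g) y) x) /\
  0 <= nrm x ^+ 2 + nrm y ^+ 2 + 2 * complex.Re (dot (Phi (lam g) y) x).
Proof.
have key (y' : H) : 0 <= (nrm x ^+ 2)%:C%C + dot (Phi (lam g) y') x +
    (dot (Phi (lam g^-1%g) x) y' + (nrm y' ^+ 2)%:C%C).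
  have := kernel_ge0 [:: (1%g, x); (g, y')].
  rewrite !big_cons !big_nil /= !addr0 invg1 !mul1g mulg1 mulVg !Phi1 !dotxx.
  by [].
have := key y; have := key ('i%C *: y).
rewrite nrmZ bopZ dotZl dotZr.
set b := dot (Phi (lam g) y) x; set c := dot (Phi _ x) y.
case: b => b1 b2; case: c => c1 c2.
rewrite !lecE /= => /andP[/eqP h1 _] /andP[/eqP h2 h3].
have e1 : c2 = - b2 by move: h1 h2; lra.
have e2 : c1 = b1 by move: h1 h2; lra.
split; first by rewrite /conjc e1 e2.
by move: h3; rewrite e2; lra.
Qed.

Lemma nrm_Phi g x : nrm (Phi (lam g) x) <= nrm x.
Proof.
have [_] := Phi_hermitian g (- Phi (lam g) x) x.
rewrite nrmN dotNr dotxx -realcN /= => h.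
rewrite -(@ler_pXn2r _ 2)// ?nnegrE ?nrm_ge0//; lra.
Qed.

(** Haagerup's function g |-> tau (Phi (lam g) lam g^-1), which is positive definite
    by complete positivity of Phi. *)
Definition coef (g : Gamma) : R[i] := Phi (lam g) (delta 1%g) g.

Lemma coef1 : coef 1%g = 1.
Proof. by rewrite /coef Phi1 deltaE eqxx. Qed.

Lemma coefV g : coef g^-1%g = conjc (coef g).
Proof.
case: hPhi => PM _ _ _ _.
rewrite /coef -!dot_deltar; have [<- _] := Phi_hermitian g (delta g) (delta 1%g).
rewrite !dot_deltar [RHS]vN_coord ?mul1g//; exact: PM (vN_lreg _).
Qed.

Definition coef_sum (W : seq Gamma) : R[i] := \sum_(w <- W) coef w.

Definition square_seq (W : seq Gamma) : seq Gamma :=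
  [seq (a^-1 * b)%g | a <- W, b <- W].

(** Cauchy-Schwarz for the positive definite function, that is, positivity at the
    point 1 with weight - coef_sum W and at the members of W with weight 1. *)
Lemma coef_sum_square W : cabs (coef_sum W) ^+ 2 <= cabs (coef_sum (square_seq W)).
Proof.
case: hPhi => PM _ _ _ _.
have posdef (s : seq (Gamma * R[i])) : 0 <=
    \sum_(p <- s) \sum_(p' <- s) p'.2 * conjc p.2 * coef (p.1^-1 * p'.1)%g.
  have := kernel_ge0 [seq (p.1, p.2 *: delta p.1^-1%g) | p <- s].
  rewrite big_map; congr (0 <= _); apply: eq_bigr => p _.
  rewrite big_map; apply: eq_bigr => p' _ /=.
  rewrite bopZ dotZl dotZr dot_deltar mulrA vN_coord; last exact: PM (vN_lreg _).
  by rewrite invgK.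
have := posdef ((1%g, - coef_sum W) :: [seq (w, 1) | w <- W]).
rewrite !big_cons !big_map /= invg1 mul1g coef1.
under eq_bigr do rewrite mul1r mul1g.
under [X in _ + X]eq_bigr do rewrite big_cons big_map /= mulg1.
rewrite big_split /= -mulr_sumr -/(coef_sum W).
have -> : \sum_(w <- W) - coef_sum W * conjc 1 * coef w^-1%g =
    - (coef_sum W * conjc (coef_sum W)).
  under eq_bigr do rewrite conjc1 mulr1 coefV.
  by rewrite -mulr_sumr -conjc_sum mulNr.
rewrite conjcN mulr1 mulrNN !mulNr (mulrC (conjc _)) subrr add0r => h.
have {h} : (cabs (coef_sum W) ^+ 2)%:C%C <= coef_sum (square_seq W).
  rewrite -subr_ge0 -mulc_conj addrC; move: h; congr (0 <= _ + _).
  rewrite /coef_sum /square_seq big_allpairs_dep /=; apply: eq_bigr => a _.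
  by apply: eq_bigr => b _; rewrite conjc1 !mul1r.
rewrite lecE => /andP[_]; rewrite [complex.Re _%:C%C]/=; move=> h.
by apply: le_trans h _; apply: le_trans (ler_norm _) (Re_le_cabs _).
Qed.

(** Finite rank makes the coefficient function square-summable, in the weak
    form of a bound by the norm of a sum of translates. *)
Lemma coef_sum_bound : exists K : R, forall W,
  cabs (coef_sum W) <= K * nrm (lsum W (delta 1%g)).
Proof.
case: hPhi => PM _ _ _ [_ [n [e he]]].
have [us [us1 usP]] := span_coord (fun k => e k (delta 1%g)).
exists (size us)%:R => W.
have abs_ss (u : H) : (fun h => (cabs (u h))%:C%C) \in @square_summable R Gamma.
  have := ell2_funP u; rewrite !unfold_in /sqsum => h.
  by under eq_esum do rewrite cabs_real ger0_norm ?cabs_ge0//.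
pose au (u : H) : H := Ell2 (abs_ss u).
have nau u : nrm (au u) = nrm u.
  rewrite /ell2_norm /sqsum; congr (Num.sqrt (fine _)); apply: eq_esum => i _.
  by rewrite cabs_real ger0_norm ?cabs_ge0.
have coefle w : cabs (coef w) <= \sum_(u <- us) cabs (u w).
  have [c cE] := he (lam w) (vN_lreg w).
  have E : Phi (lam w) (delta 1%g) = \sum_k c k *: e k (delta 1%g).
    by rewrite cE bop_sumE.
  rewrite /coef E; apply: le_trans (usP _ _) _.
  rewrite -E -[leRHS]mul1r ler_wpM2r ?sumr_ge0// => [u _|]; first exact: cabs_ge0.
  by apply: le_trans (nrm_Phi _ _) _; rewrite nrm_delta.
apply: le_trans (cabs_sum _ _ _) _.
apply: le_trans (ler_sum _ (fun w _ => coefle w)) _.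
rewrite exchange_big /= -sum1_size natr_sum mulr_suml.
rewrite big_seq [leRHS]big_seq; apply: ler_sum => u uus; rewrite mul1r.
have -> : \sum_(w <- W) cabs (u w) = cabs (dot (lsum W (delta 1%g)) (au u)).
  rewrite lsumE dot_suml (eq_bigr (fun w => (cabs (u w))%:C%C)); last first.
    by move=> w _; rewrite lreg_delta mulg1 dot_deltal conjc_real.
  rewrite -(rmorph_sum (real_complex R)) /= cabs_real ger0_norm// sumr_ge0// => w _.
  exact: cabs_ge0.
by apply: le_trans (cauchy_schwarz _ _) _; rewrite nau (us1 u uus) mulr1.
Qed.

End Coefficients.

(** * Norm estimates by iterated squaring *)

Section Squaring.
Context {R : realType} {Gamma : groupType}.
Local Notation H := (ell2 R Gamma).
Local Notation B := (bop R Gamma).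
Local Notation nrm := (@ell2_norm R Gamma).
Local Notation M := (group_vN R Gamma).
Local Notation delta := (@delta R Gamma).

Lemma bernoulli (x : R) n : 0 <= x -> 1 + n%:R * x <= (1 + x) ^+ n.
Proof.
move=> x0; elim: n => [|n IH]; first by rewrite mul0r addr0 expr0.
rewrite exprS -natr1; have n0 : 0 <= n%:R :> R := ler0n _ _.
have := ler_wpM2l (addr_ge0 ler01 x0) IH; apply: le_trans; nra.
Qed.

Lemma le_of_dyadic_powers (c q K : R) : 0 <= c -> 0 < q ->
  (forall j, c ^+ (2 ^ j) <= K * q ^+ (2 ^ j)) -> c <= q.
Proof.
move=> c0 q0 h; rewrite leNgt; apply/negP => qc.
pose x := c / q - 1.
have x0 : 0 < x by rewrite subr_gt0 ltr_pdivlMr// mul1r.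
have bound j : j%:R * x <= K.
  have e : c ^+ (2 ^ j) / q ^+ (2 ^ j) <= K by rewrite ler_pdivrMr ?exprn_gt0.
  rewrite -expr_div_n (_ : c / q = 1 + x) in e; last by rewrite /x; ring.
  apply: le_trans e; apply: le_trans (bernoulli _ (ltW x0)).
  have : j%:R <= (2 ^ j)%:R :> R by rewrite ler_nat ltnW// ltn_expl.
  by move=> /(ler_wpM2r (ltW x0)) le; apply: le_trans le _; rewrite lerDr.
have := bound (Num.trunc (K / x)).+1.
rewrite -ler_pdivlMr// leNgt => /negP; apply; exact: truncnS_gt.
Qed.

(** The sum over the inverses is the adjoint of the sum over W; bounding both
    makes the property pass to square_seq W. *)
Definition bounded_sums (W : seq Gamma) (q : R) :=
  forall x : H, nrm (lsum W x) <= q * nrm x /\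
    nrm (lsum [seq (w^-1)%g | w <- W] x) <= q * nrm x.

Lemma bounded_sums_square W q : 0 <= q -> bounded_sums W q ->
  bounded_sums (square_seq W) (q ^+ 2).
Proof.
move=> q0 b x.
have s1 : lsum (square_seq W) x = lsum [seq (w^-1)%g | w <- W] (lsum W x).
  rewrite !lsumE big_allpairs_dep big_map; apply: eq_bigr => a _.
  by rewrite bop_sum; apply: eq_bigr => b' _; rewrite lregM.
have s2 : lsum [seq (w^-1)%g | w <- square_seq W] x = lsum (square_seq W) x.
  rewrite !lsumE big_map !big_allpairs_dep exchange_big /=.
  by apply: eq_bigr => a _; apply: eq_bigr => b' _; rewrite invgM invgK.
have le : nrm (lsum (square_seq W) x) <= q ^+ 2 * nrm x.
  rewrite s1; apply: le_trans (b _).2 _.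
  by rewrite expr2 -mulrA ler_wpM2l// (b x).1.
by rewrite s2.
Qed.

Lemma bounded_sums_iter W q j : 0 <= q -> bounded_sums W q ->
  bounded_sums (iter j square_seq W) (q ^+ (2 ^ j)).
Proof.
move=> q0 b; elim: j => [|j IH]; first by rewrite expn0 expr1.
rewrite iterS expnSr exprM; apply: bounded_sums_square => //.
exact: exprn_ge0.
Qed.

Lemma size_square_iter (W : seq Gamma) j :
  size (iter j square_seq W) = (size W ^ (2 ^ j))%N.
Proof.
elim: j => [|j IH]; first by rewrite expn0 expn1.
by rewrite iterS size_allpairs IH -expnD addnn -mul2n -expnS.
Qed.

(** Positive definiteness lets the coefficient sums be squared without loss, so
    the square-summability constant disappears in the limit. *)
Lemma coef_sum_le (Phi : B -> B) W q : normal_finite_rank_ucp M Phi -> 0 < q ->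
  bounded_sums W q -> cabs (coef_sum Phi W) <= q.
Proof.
move=> hPhi q0 b; have [K hK] := coef_sum_bound hPhi.
apply: (@le_of_dyadic_powers _ _ `|K|) => // [|j]; first exact: cabs_ge0.
apply: (@le_trans _ _ (cabs (coef_sum Phi (iter j square_seq W)))).
  elim: j => [|j IH]; first by rewrite expn0 expr1.
  rewrite expnSr exprM iterS; apply: le_trans (coef_sum_square hPhi _).
  by rewrite ler_pXn2r ?nnegrE ?exprn_ge0 ?cabs_ge0.
apply: le_trans (hK _) _.
have := (bounded_sums_iter j (ltW q0) b (delta 1%g)).1; rewrite nrm_delta mulr1 => h.
apply: (@le_trans _ _ (`|K| * nrm (lsum (iter j square_seq W) (delta 1%g)))).
  by rewrite ler_wpM2r ?nrm_ge0// ler_norm.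
by rewrite ler_wpM2l.
Qed.

(** Coefficients within e of 1 give sums proportional to the length of the list, also
    after iterated squaring, which a spectral gap forbids. *)
Lemma coefs_almost_invariant (e : R) : e < 1 ->
  (forall V : seq Gamma, exists2 Phi, normal_finite_rank_ucp M Phi &
    forall g, g \in V -> cabs (1 - coef Phi g) <= e) ->
  @almost_invariant_vectors R Gamma.
Proof.
move=> e1 hV; apply: contrapT => /spectral_gap[W [q [sW /andP[q0 qW] hq]]].
have b : bounded_sums W q.
  move=> x; split; first exact: hq.
  by rewrite lsumE (perm_big _ sW) -lsumE hq.
suff : (size W)%:R <= q by rewrite leNgt qW.
apply: (@le_of_dyadic_powers _ _ (1 - e)^-1) => // j.
rewrite ler_pdivlMl ?subr_gt0// -natrX -size_square_iter.
have [Phi hPhi he] := hV (iter j square_seq W).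
have bj := bounded_sums_iter j (ltW q0) b.
apply: le_trans (coef_sum_le hPhi _ bj); last exact: exprn_gt0.
apply: (@le_trans _ _ (complex.Re (coef_sum Phi (iter j square_seq W)))); last first.
  exact: le_trans (ler_norm _) (Re_le_cabs _).
elim: (iter j _ _) he => [|w V IH] he; first by rewrite mulr0 /coef_sum big_nil.
rewrite /coef_sum big_cons ReD /= -natr1 mulrDr mulr1 addrC lerD//.
  have := le_trans (ler_norm _) (le_trans (Re_le_cabs _) (he w (mem_head _ _))).
  by rewrite ReB /=; lra.
by apply: IH => g gV; apply: he; rewrite inE gV orbT.
Qed.

End Squaring.

(** * The ultraweak topology *)

Section Ultraweak.
Context {R : realType} {I : choiceType}.
Local Notation H := (ell2 R I).
Local Notation B := (bop R I).
Local Notation nrm := (@ell2_norm R I).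

Lemma uw_continuous (p : uw_index R I) : continuous (uw_functional p : B -> R[i]^o).
Proof.
move=> x; have /cvg_sup/(_ p) h : nbhs x --> (x : ultraweak R I) by [].
apply: (cvg_trans _ (@initial_continuous _ _ (uw_functional p) x)).
exact: cvg_app h.
Qed.

Lemma vec_index_subproof (x : H) :
  (\sum_(n <oo) (nrm (if n is 0%N then x else 0) ^+ 2)%:E < +oo)%E.
Proof.
rewrite (nneseries_split 0 1)//; last by move=> k _; rewrite lee_fin sqr_ge0.
rewrite big_nat1 eseries0 ?adde0 ?ltry// => -[|k]// _ _.
by rewrite nrm0 expr0n.
Qed.

Definition vec_index (x y : H) : uw_index R I :=
  UwIndex (vec_index_subproof x) (vec_index_subproof y).

Lemma uw_vec (x y : H) (T : B) : uw_functional (vec_index x y) T = dot (T x) y.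
Proof.
rewrite /uw_functional.
have [|_ ->//] := @csumE_single R nat (fun n => dot (T (uw_left (vec_index x y) n))
  (uw_right (vec_index x y) n)) 0%N.
by move=> [|n]// _; rewrite /= bop0 dot0l.
Qed.

Lemma vec_predual (M : set B) (x y : H) : predual M (fun T => dot (T x) y).
Proof.
split; first by move=> a S T _ _; rewrite bop_addE bop_scaleE dotDl dotZl.
rewrite (_ : (fun T : B => dot (T x) y : R[i]^o) = uw_functional (vec_index x y)).
  by apply: continuous_subspaceT; exact: uw_continuous.
by apply/funext => T; rewrite uw_vec.
Qed.

End Ultraweak.

(** * Almost invariant vectors from the failure of separation *)

Section NotSeparated.
Context {R : realType} {Gamma : groupType}.
Local Notation H := (ell2 R Gamma).
Local Notation B := (bop R Gamma).
Local Notation M := (group_vN R Gamma).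
Local Notation lam := (@lregular R Gamma).
Local Notation delta := (@delta R Gamma).

Lemma coef_functional_norm (g : Gamma) :
  predual_norm M (fun T : B => dot (T (delta 1%g)) (delta g)) = 1.
Proof.
rewrite /predual_norm; set S := [set _ | _ in _].
have ub : ubound S 1.
  move=> _ [T [_ /= T1] <-]; apply: le_trans (dot_bop_le _ _ _) _.
  by rewrite !nrm_delta !mulr1.
have S1 : S 1.
  exists (lam g); first by split; [exact: vN_lreg|rewrite /= opnorm_lreg].
  by rewrite lreg_delta mulg1 dot_deltar deltaE eqxx Normc.normc1.
apply/eqP; rewrite eq_le; apply/andP; split.
  by apply: ge_sup => //; exists 1.
by apply: ub_le_sup => //; exists 1.
Qed.

(** Tested on the unitaries lam g and the functionals that take their coefficient
    at g, the failure of separation says that the coefficient functions of the net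
    are eventually within a fixed e < 1 of 1, simultaneously at finitely many points
    because the net is directed. *)
Lemma not_separated_almost_invariant (eps : R) : eps < 1 ->
  ~ separation_property M eps -> @almost_invariant_vectors R Gamma.
Proof.
move=> e1; rewrite /separation_property => /existsNP[L /existsNP[le /existsNP[Phi]]].
move=> /not_implyP[[[l0] lerefl letrans ledir] /not_implyP[hPhi nsep]].
pose e := (eps + 1) / 2.
have ee : eps < e by rewrite /e; lra.
apply: (@coefs_almost_invariant R Gamma e) => [|V]; first by rewrite /e; lra.
suff [l hl] : exists l, forall m, le l m -> forall g, g \in V ->
    cabs (1 - coef (Phi m) g) <= e.
  by exists (Phi l) => //; exact: hl.
elim: V => [|g V [l hl]]; first by exists l0.
suff [k hk] : exists k, forall m, le k m -> cabs (1 - coef (Phi m) g) <= e.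
  have [n [ln kn]] := ledir l k; exists n => m nm h; rewrite inE => /orP[/eqP->|hV].
    by apply: hk; exact: letrans kn nm.
  by apply: hl => //; exact: letrans ln nm.
pose om := fun T : B => dot (T (delta 1%g)) (delta g).
have lim : ~ (eps%:E < net_limsup le (fun l => cabs (om (lam g - Phi l (lam g))%R)))%E.
  move=> h; apply: nsep; exists (lam g), om; split=> //; first exact: vN_lreg.
  - exact: vec_predual.
  - exact: opnorm_lreg.
  - exact: coef_functional_norm.
have {lim} : (net_limsup le (fun l => cabs (om (lam g - Phi l (lam g))%R)) < e%:E)%E.
  by rewrite (@le_lt_trans _ _ eps%:E) ?lte_fin// leNgt; apply/negP.
move=> /ereal_inf_lt[_ [k _ <-] hk]; exists k => m km.
rewrite -lee_fin; apply: le_trans (ltW hk); apply: ereal_sup_ubound.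
exists m => //; congr (_%:E); congr cabs.
by rewrite /om bop_addE bop_oppE dotBl lreg_delta mulg1 !dot_deltar deltaE eqxx.
Qed.

Theorem not_separated_injective (eps : R) : eps < 1 ->
  ~ separation_property M eps -> injective_vN M.
Proof.
move=> e1 /(not_separated_almost_invariant e1)/almost_invariant_mean[m hm].
exact: mean_injective hm.
Qed.

End NotSeparated.

(** * The hypertrace of a projection of norm one *)

Section RootsOfUnity.
Context {R : realType}.

Lemma exists_prim_root n : (0 < n)%N -> exists z : R[i], n.-primitive_root z.
Proof.
move=> n_gt0; have [r Dp] := closed_field_poly_normal ('X^n - 1 : {poly R[i]}).
rewrite (monicP _) ?monicXnsubC// scale1r in Dp.
have rn1 : all n.-unity_root r by apply/allP => z; rewrite -root_prod_XsubC -Dp.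
have sz_r : (n < (size r).+1)%N by rewrite -(size_prod_XsubC r id) -Dp size_XnsubC.
have [|z _ hz] := hasP (has_prim_root n_gt0 rn1 _ sz_r); last by exists z.
by rewrite -separable_prod_XsubC -Dp separable_Xn_sub_1// pnatr_eq0 -lt0n.
Qed.

Lemma prim_root_cabs n (z : R[i]) : n.-primitive_root z -> cabs z = 1.
Proof.
move=> hz; have n0 := prim_order_gt0 hz.
apply/eqP; rewrite -(@eqrXn2 _ n)// ?cabs_ge0// expr1n; apply/eqP.
by rewrite -cabsX (prim_expr_order hz) Normc.normc1.
Qed.

Lemma prim_root_orthogonal n (z : R[i]) (k l : 'I_n) : n.-primitive_root z ->
  \sum_(j < n) conjc (z ^+ j) ^+ k * (z ^+ j) ^+ l = if k == l then n%:R else 0.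
Proof.
move=> hz; have n0 := prim_order_gt0 hz.
have zz : z * conjc z = 1 by rewrite mulc_conj (prim_root_cabs hz) expr1n.
pose r := conjc z ^+ k * z ^+ l.
have -> : \sum_(j < n) conjc (z ^+ j) ^+ k * (z ^+ j) ^+ l = \sum_(j < n) r ^+ j.
  by apply: eq_bigr => j _; rewrite /r exprMn conjcX -!exprM (mulnC k) (mulnC l).
have rn : r ^+ n = 1.
  rewrite /r exprMn -!exprM !(mulnC _ n) !exprM -conjcX (prim_expr_order hz).
  by rewrite conjc1 !expr1n mulr1.
case: ifPn => [/eqP kl|kl].
  rewrite (eq_bigr (fun=> 1)); first by rewrite sumr_const card_ord.
  by move=> j _; rewrite /r -kl -exprMn mulrC zz !expr1n.
have r1 : r != 1.
  apply: contra_neq kl => r1.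
  have : z ^+ k = z ^+ l.
    by rewrite -[LHS]mulr1 -r1 /r mulrA -exprMn zz expr1n mul1r.
  move/eqP; rewrite (eq_prim_root_expr hz) !modn_small// => /eqP.
  exact: val_inj.
apply: (mulfI (_ : r - 1 != 0)); first by rewrite subr_eq0.
by rewrite -subrX1 rn subrr mulr0.
Qed.

End RootsOfUnity.

Section NormEstimate.
Context {R : realType} {I : choiceType}.
Local Notation H := (ell2 R I).
Local Notation B := (bop R I).
Local Notation nrm := (@ell2_norm R I).

Definition perturbed (b a y : B) (s : R[i]) : B := bop1 - (4^-1)%:C%C *: bcomp b a + s *: y.

(** The quadratic term pays for the linear one, since the vectors on which x a is
    large are those on which 1 - b a / 4 contracts. *)
Lemma perturbed_norm (a b x : B) s : adjoint_pair a b -> opnorm b <= 2 -> opnorm x <= 1 ->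
  opnorm (perturbed b a (bcomp x a) s) <= 1 + 2 * cabs s ^+ 2.
Proof.
move=> ab b2 x1; have s0 := cabs_ge0 s.
apply: opnorm_le => [v|]; last by rewrite addr_ge0// mulr_ge0 ?sqr_ge0.
rewrite !bop_addE bop_oppE !bop_scaleE !bcompE -[bop1 v]/v.
set t := nrm (a v); set X := nrm v.
set P := nrm (v - (4^-1)%:C%C *: b (a v)).
have t0 : 0 <= t := nrm_ge0 _; have X0 : 0 <= X := nrm_ge0 _.
have P0 : 0 <= P := nrm_ge0 _.
have Psq : P ^+ 2 <= X ^+ 2 - t ^+ 2 / 4.
  rewrite /P nrmD_sq nrmN nrmZ cabs_real ger0_norm ?invr_ge0//.
  rewrite dotNr dotZr conjc_real -ab dotxx -realcM -realcN /= -/t -/X.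
  have : nrm (b (a v)) <= 2 * t.
    by apply: le_trans (bop_bound _ _) _; rewrite ler_wpM2r.
  rewrite -(@ler_pXn2r _ 2) ?nnegrE ?mulr_ge0 ?nrm_ge0// => h.
  rewrite (exprMn _ 4^-1); move: h; rewrite exprMn; nra.
apply: le_trans (nrmD _ _) _; rewrite nrmZ -/P.
have xt : nrm (x (a v)) <= t.
  by apply: le_trans (bop_bound _ _) _; rewrite -[leRHS]mul1r ler_wpM2r.
apply: (@le_trans _ _ (P + cabs s * t)); first by rewrite lerD2l ler_wpM2l.
have [X1|X1] := eqVneq X 0.
  have : t ^+ 2 <= 0 by move: Psq (sqr_ge0 P); rewrite X1 expr0n /=; lra.
  move=> tt; have t1 : t = 0.
    by apply/eqP; rewrite -sqrf_eq0 eq_le tt sqr_ge0.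
  have : P ^+ 2 <= 0 by move: Psq; rewrite X1 t1 !expr0n /=; lra.
  move=> PP; have P1 : P = 0 by apply/eqP; rewrite -sqrf_eq0 eq_le PP sqr_ge0.
  by rewrite P1 t1 X1 !mulr0 addr0.
have Xp : 0 < X by rewrite lt_neqAle eq_sym X1.
(* The tangent line of the square root, written with w = t / X. *)
pose w := t / X; have tw : t = w * X by rewrite /w mulfVK.
have w0 : 0 <= w by rewrite divr_ge0.
have Pw : P <= (1 - w ^+ 2 / 8) * X.
  have wle : w ^+ 2 <= 4.
    have : t ^+ 2 <= 4 * X ^+ 2 by move: Psq (sqr_ge0 P); lra.
    by rewrite tw exprMn ler_pM2r// exprn_gt0.
  rewrite -(@ler_pXn2r _ 2)// ?nnegrE ?mulr_ge0//; last by lra.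
  apply: le_trans Psq _; rewrite tw !exprMn.
  have X2 := sqr_ge0 X.
  have : 0 <= (w ^+ 2 / 8) ^+ 2 * X ^+ 2 by rewrite mulr_ge0// sqr_ge0.
  nra.
apply: le_trans (lerD Pw (lexx _)) _; rewrite tw mulrA -mulrDl ler_wpM2r//.
have := sqr_ge0 (4 * cabs s - w); nra.
Qed.

(** Products with a on the left are reduced by taking adjoints to products with b
    on the right. *)
Lemma perturbed_adjoint (a b x x' : B) s : adjoint_pair a b -> adjoint_pair b a ->
  adjoint_pair x x' ->
  adjoint_pair (perturbed a b (bcomp a x) s) (perturbed a b (bcomp x' b) (conjc s)).
Proof.
move=> ab ba xx u v; rewrite !bop_addE !bop_oppE !bop_scaleE !bcompE.
rewrite !dotDl !dotDr dotNl dotNr !dotZl !dotZr conjc_real conjcK.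
by rewrite ab ba ab xx.
Qed.

End NormEstimate.

Section Hypertrace.
Context {R : realType} {Gamma : groupType}.
Local Notation H := (ell2 R Gamma).
Local Notation B := (bop R Gamma).
Local Notation nrm := (@ell2_norm R Gamma).
Local Notation M := (group_vN R Gamma).
Local Notation lam := (@lregular R Gamma).
Local Notation delta := (@delta R Gamma).
Variable E : B -> B.
Hypotheses (Elin : linear E) (EM : forall T, M (E T)) (Eid : forall x, M x -> E x = x)
  (Enorm : forall T, opnorm (E T) <= opnorm T).

Let ED S T : E (S + T) = E S + E T.
Proof. by have := Elin 1 S T; rewrite !scale1r. Qed.

Let E0 : E 0 = 0. Proof. by apply: Eid; exact: vN0. Qed.

Let EZ a T : E (a *: T) = a *: E T.
Proof. by have := Elin a T 0; rewrite E0 !addr0. Qed.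

Let EN T : E (- T) = - E T.
Proof. by rewrite -scaleN1r EZ scaleN1r. Qed.

(** Since E fixes 1 and b a, contractivity at 1 - b a / 4 + s y, for the best phase
    of s, bounds the linear term at every vector. *)
Lemma projection_small (a b y : B) (v : H) (r : R) :
  M a -> M b -> adjoint_pair b a ->
  (forall s, opnorm (perturbed b a y s) <= 1 + 2 * cabs s ^+ 2) -> 0 < r ->
  cabs (dot (E y v) v) <= nrm (a v) ^+ 2 / (4 * r) + 2 * r * nrm v ^+ 2.
Proof.
move=> Ma Mb ba hp r0; have [p p1 pz] := cabs_phase (dot (E y v) v).
pose s := r%:C%C * p.
have cs : cabs s = r by rewrite /s Normc.normcM p1 mulr1 cabs_real ger0_norm// ltW.
have Ep : E (perturbed b a y s) = perturbed b a (E y) s.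
  rewrite /perturbed !ED EN !EZ (Eid vN1) (Eid _)//; exact: vN_comp.
have val : dot (perturbed b a (E y) s v) v =
    (nrm v ^+ 2 - 4^-1 * nrm (a v) ^+ 2 + r * cabs (dot (E y v) v))%:C%C.
  rewrite !bop_addE bop_oppE !bop_scaleE bcompE !dotDl dotNl !dotZl ba -[bop1 v]/v !dotxx.
  by rewrite /s -mulrA pz !realcD realcN !realcM.
have := dot_bop_le (E (perturbed b a y s)) v v.
rewrite Ep val cabs_real -Ep => h.
have h2 : opnorm (E (perturbed b a y s)) <= 1 + 2 * r ^+ 2.
  by apply: le_trans (Enorm _) _; rewrite -cs; exact: hp.
have {h} := le_trans (ler_norm _) h.
have := ler_wpM2r (sqr_ge0 (nrm v)) h2; rewrite -mulrA -expr2 => h3 h4.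
have {h3 h4} h : r * cabs (dot (E y v) v) <=
    r * (nrm (a v) ^+ 2 / (4 * r) + 2 * r * nrm v ^+ 2).
  apply: (@le_trans _ _ (4^-1 * nrm (a v) ^+ 2 + 2 * r ^+ 2 * nrm v ^+ 2)).
    by move: (le_trans h4 h3); lra.
  rewrite le_eqVlt; apply/orP; left; apply/eqP; field.
  by rewrite gt_eqF.
by rewrite ler_pM2l in h.
Qed.

Definition tau (T : B) : R[i] := T (delta 1%g) 1%g.

Lemma tau_diag T g : M T -> dot (T (delta g)) (delta g) = tau T.
Proof. by move=> hT; rewrite dot_deltar vN_coord// mulgV. Qed.

Section Averaging.
Variables (g : Gamma) (D : B) (MD : M D) (n : nat) (z : R[i]).
Hypothesis hz : n.-primitive_root z.

Let pow (k : nat) : Gamma := iter k (fun h => g * h)%g 1%g.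

(** For c of modulus one, an eigenvector of the translation by g up to two boundary
    terms, while the squared norm averages to n over the n-th roots of unity. *)
Definition eigvec (c : R[i]) : H := \sum_(k < n) conjc c ^+ k *: delta (pow k).

Lemma eigvec_small (c : R[i]) : cabs c = 1 ->
  nrm (lam g (eigvec c) - c *: eigvec c) <= 2.
Proof.
move=> c1; have cc : c * conjc c = 1 by rewrite mulc_conj c1 expr1n.
have n0 := prim_order_gt0 hz.
have -> : lam g (eigvec c) - c *: eigvec c =
    conjc c ^+ n.-1 *: delta (pow n) - c *: delta 1%g.
  rewrite /eigvec -(big_mkord xpredT (fun k => conjc c ^+ k *: delta (pow k))).
  case: (n) n0 => // k _; rewrite -pred_Sn.
  elim: k => [|k IH].
    by rewrite big_nat1 expr0 !scale1r lreg_delta.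
  rewrite big_nat_recr// bopD scalerDr opprD addrACA {}IH bopZ lreg_delta scalerA.
  rewrite exprS mulrA cc mul1r -[(g * pow _)%g]/(pow k.+2).
  set u := _ ^+ k *: _; set v := c *: _; set w := _ *: _.
  by rewrite addrC -addrA [u - v]addrC [- u + _]addrCA addNr addr0.
apply: le_trans (nrmB _ _) _; rewrite !nrmZ !nrm_delta !mulr1 c1.
rewrite cabsX cabs_conj c1 expr1n; lra.
Qed.

Lemma eigvec_average :
  \sum_(j < n) dot (D (eigvec (z ^+ j))) (eigvec (z ^+ j)) = n%:R * (n%:R * tau D).
Proof.
pose d (k l : 'I_n) := dot (D (delta (pow k))) (delta (pow l)).
transitivity (\sum_(j < n) \sum_(k < n) \sum_(l < n)
    conjc (z ^+ j) ^+ k * (z ^+ j) ^+ l * d k l).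
  apply: eq_bigr => j _; rewrite /eigvec bop_sum dot_suml; apply: eq_bigr => k _.
  rewrite dot_sumr; apply: eq_bigr => l _.
  by rewrite bopZ dotZl dotZr (conjcX (conjc (z ^+ j))) conjcK mulrA.
rewrite exchange_big /=.
rewrite (eq_bigr (fun=> n%:R * tau D)) ?sumr_const ?card_ord ?mulr_natl// => k _.
rewrite exchange_big /=.
under eq_bigr do rewrite -mulr_suml (prim_root_orthogonal k _ hz).
rewrite (bigD1 k)// eqxx big1 => [|l lk]; first by rewrite [LHS]addr0 /d tau_diag// mulr_natl.
by rewrite eq_sym (negPf lk) mul0r.
Qed.

End Averaging.

(** Averaging over the approximate eigenvectors of the n-th roots of unity turns the
    hypothesis into the bound 4 / (n r) + 3 r on the trace, for all n and r. *)
Lemma tau_eq0 g (D : B) : M D ->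
  (forall (c : R[i]) (v : H) (r : R), cabs c = 1 -> 0 < r ->
    cabs (dot (D v) v) <= nrm (lam g v - c *: v) ^+ 2 / r + 3 * r * nrm v ^+ 2) ->
  tau D = 0.
Proof.
move=> MD hD.
have key (n : nat) (r : R) : (0 < n)%N -> 0 < r ->
    cabs (tau D) <= 4 / (n%:R * r) + 3 * r.
  move=> n0 r0; have [z hz] := @exists_prim_root R n n0.
  have nR : 0 < n%:R :> R by rewrite ltr0n.
  have cz j : cabs (z ^+ j) = 1 by rewrite cabsX (prim_root_cabs hz) expr1n.
  have nv : \sum_(j < n) nrm (eigvec g n (z ^+ j)) ^+ 2 = n%:R * n%:R.
    apply: (@complexI R); rewrite (rmorph_sum (real_complex R)) /=.
    under eq_bigr do rewrite -dotxx.
    have := eigvec_average g vN1 hz; rewrite -[tau bop1]/((delta 1%g) 1%g) deltaE eqxx mulr1.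
    by rewrite realcM !(rmorph_nat (real_complex R)) => <-.
  have := congr1 (@Normc.normc R) (eigvec_average g MD hz).
  have cn : cabs (n%:R : R[i]) = n%:R.
    by rewrite -(rmorph_nat (real_complex R)) cabs_real ger0_norm// ltW.
  rewrite !Normc.normcM cn => avg.
  have : n%:R * (n%:R * cabs (tau D)) <= n%:R * (n%:R * (4 / (n%:R * r) + 3 * r)).
    rewrite -avg; apply: le_trans (cabs_sum _ _ _) _.
    apply: (@le_trans _ _ (\sum_(j < n) (4 / r + 3 * r * nrm (eigvec g n (z ^+ j)) ^+ 2))).
      apply: ler_sum => j _; apply: le_trans (hD (z ^+ j) _ r (cz j) r0) _.
      rewrite lerD2r ler_pM2r ?invr_gt0//.
      have h := eigvec_small g hz (cz j).
      rewrite (_ : 4 = 2 ^+ 2); last by rewrite expr2; ring.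
      by rewrite ler_pXn2r ?nnegrE ?nrm_ge0.
    rewrite big_split /= sumr_const card_ord -mulr_sumr nv -mulr_natl.
    rewrite le_eqVlt; apply/orP; left; apply/eqP; field.
    by rewrite !gt_eqF.
  by rewrite !ler_pM2l.
apply: Normc.eq0_normc; apply/eqP; rewrite eq_le cabs_ge0 andbT.
apply/ler_addgt0Pr => e e0; rewrite add0r.
have r0 : 0 < e / 6 by rewrite divr_gt0.
pose N := (Num.trunc (4 / ((e / 6) * (e / 2)))).+1.
apply: le_trans (key N _ isT r0) _.
have N0 : 0 < N%:R :> R by rewrite ltr0n.
have : 4 / (N%:R * (e / 6)) <= e / 2.
  have := truncnS_gt (4 / ((e / 6) * (e / 2))); rewrite -/N => /ltW.
  by rewrite !ler_pdivrMr ?mulr_gt0// => /le_trans; apply; lra.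
lra.
Qed.

Let trans g (c : R[i]) : B := lam g - c *: bop1.

Let transE g c v : trans g c v = lam g v - c *: v. Proof. by []. Qed.

Let trans_vN g c : M (trans g c).
Proof. by apply: vNB; [exact: vN_lreg|apply: vNZ; exact: vN1]. Qed.

Let trans_norm g c : cabs c = 1 -> opnorm (trans g c) <= 2.
Proof.
move=> c1; apply: opnorm_le => // v; rewrite transE; apply: le_trans (nrmB _ _) _.
by rewrite nrm_lreg nrmZ c1 mul1r mulr_natl.
Qed.

Let trans_adj g c : adjoint_pair (trans g c) (trans g^-1%g (conjc c)).
Proof.
by move=> u v; rewrite !transE dotBl dotBr dot_lreg dotZl dotZr conjcK.
Qed.

Let trans_adj' g c : adjoint_pair (trans g^-1%g (conjc c)) (trans g c).
Proof. by have := @trans_adj g^-1%g (conjc c); rewrite invgK conjcK. Qed.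

Let trans_inv_nrm g c v : cabs c = 1 -> nrm (trans g^-1%g (conjc c) v) = nrm (trans g c v).
Proof.
move=> c1; have cc : conjc c * c = 1 by rewrite mulrC mulc_conj c1 expr1n.
have -> : trans g^-1%g (conjc c) v = (- conjc c) *: lam g^-1%g (trans g c v).
  rewrite !transE bopB lregVK bopZ scaleNr scalerBr scalerA cc scale1r opprB.
  by [].
by rewrite nrmZ nrm_lreg normcN cabs_conj c1 mul1r.
Qed.

Let sum_bound (A C N r X : R) : 0 < r -> 0 <= N -> A <= C ^+ 2 / (4 * r) + 2 * r * N ^+ 2 ->
  X <= C * N -> A + X <= C ^+ 2 / r + 3 * r * N ^+ 2.
Proof.
move=> r0 N0 hA hX.
have h : C * N <= C ^+ 2 / (4 * r) + r * N ^+ 2.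
  rewrite -subr_ge0 (_ : _ - _ = (C / 2 - r * N) ^+ 2 / r).
    by rewrite divr_ge0 ?sqr_ge0// ltW.
  by field; rewrite gt_eqF.
have h' : C ^+ 2 / (4 * r) + C ^+ 2 / (4 * r) <= C ^+ 2 / r.
  rewrite -subr_ge0 (_ : _ - _ = C ^+ 2 / (2 * r)).
    by rewrite divr_ge0 ?sqr_ge0// mulr_ge0// ltW.
  by field; rewrite gt_eqF.
lra.
Qed.

Lemma tau_right g (y : B) : opnorm y <= 1 ->
  tau (E (bcomp y (lam g))) = tau (bcomp (E y) (lam g)).
Proof.
move=> y1; pose D := E (bcomp y (lam g)) - bcomp (E y) (lam g).
have MD : M D by apply: vNB; [exact: EM|apply: vN_comp; [exact: EM|exact: vN_lreg]].
apply/eqP; rewrite -subr_eq0; apply/eqP; rewrite -[LHS]/(tau D).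
apply: (tau_eq0 (g := g) MD) => c v r c1 r0.
have -> : D = E (bcomp y (trans g c)) - bcomp (E y) (trans g c).
  rewrite /D /trans !bcompDr !bcompNr !bcompZr ED EN EZ.
  have b1 S : bcomp S bop1 = S by exact: bopP.
  by rewrite !b1 opprD opprK addrACA addNr addr0.
rewrite bop_addE bop_oppE dotBl bcompE; apply: le_trans (le_normcD _ _) _.
rewrite normcN -!transE; apply: sum_bound => //; first exact: nrm_ge0.
  apply: (@projection_small _ (trans g^-1%g (conjc c))) => //; try exact: trans_vN.
  move=> s; apply: perturbed_norm => //.
  by apply: trans_norm; rewrite cabs_conj.
apply: le_trans (dot_bop_le _ _ _) _; rewrite ler_wpM2r ?nrm_ge0//.
rewrite -[leRHS]mul1r ler_wpM2r ?nrm_ge0//; exact: le_trans (Enorm _) y1.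
Qed.

Lemma tau_left g (y y' : B) : adjoint_pair y y' -> opnorm y <= 1 -> opnorm y' <= 1 ->
  tau (E (bcomp (lam g) y)) = tau (bcomp (lam g) (E y)).
Proof.
move=> yy y1 y1'; pose D := E (bcomp (lam g) y) - bcomp (lam g) (E y).
have MD : M D by apply: vNB; [exact: EM|apply: vN_comp; [exact: vN_lreg|exact: EM]].
apply/eqP; rewrite -subr_eq0; apply/eqP; rewrite -[LHS]/(tau D).
apply: (tau_eq0 (g := g) MD) => c v r c1 r0.
have -> : D = E (bcomp (trans g c) y) - bcomp (trans g c) (E y).
  rewrite /D /trans !bcompDl !bcompNl !bcompZl ED EN EZ.
  have b1 S : bcomp bop1 S = S by exact: bopP.
  by rewrite !b1 opprD opprK addrACA addNr addr0.
rewrite bop_addE bop_oppE dotBl bcompE; apply: le_trans (le_normcD _ _) _.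
rewrite normcN -!transE -(trans_inv_nrm g v c1); apply: sum_bound => //; first exact: nrm_ge0.
  apply: (@projection_small _ (trans g c)) => //; try exact: trans_vN.
  move=> s; apply: le_trans (adjoint_pair_opnorm (perturbed_adjoint s _ _ yy)) _ => //.
  by rewrite -(cabs_conj s); apply: perturbed_norm => //; exact: trans_norm.
rewrite trans_adj; apply: le_trans (cauchy_schwarz _ _) _.
rewrite mulrC ler_wpM2l ?nrm_ge0//; apply: le_trans (bop_bound _ _) _.
rewrite -[leRHS]mul1r ler_wpM2r ?nrm_ge0//; exact: le_trans (Enorm _) y1.
Qed.

(** By the left and right estimates the two sides are the traces of lam g (E y) and
    of (E y) lam g, which agree because E y commutes with right translations. *)
Lemma hypertrace g (y y' : B) : adjoint_pair y y' -> opnorm y <= 1 -> opnorm y' <= 1 ->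
  tau (E (bcomp (lam g) y)) = tau (E (bcomp y (lam g))).
Proof.
move=> yy y1 y1'; rewrite (tau_left g yy)// tau_right//.
rewrite /tau !bcompE lregE mulg1 lreg_delta mulg1 [RHS]vN_coord; last exact: EM.
by rewrite mul1g.
Qed.

Let m (f : Gamma -> R) : R := complex.Re (tau (E (mulop (fun g => (f g)%:C%C)))).

(** Conjugating a multiplication operator by a translation translates the function,
    so the hypertrace restricts to an invariant mean. The function is scaled to
    meet the norm bounds. *)
Theorem projection_mean : invariant_mean m.
Proof.
have mulopD a (f f' : Gamma -> R) : rbounded f -> rbounded f' ->
    mulop (fun g => (a * f g + f' g)%:C%C) =
    a%:C%C *: mulop (fun g => (f g)%:C%C) + mulop (fun g => (f' g)%:C%C) :> B.
  move=> bf bf'; apply: bopP => x; apply: ell2P => i.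
  rewrite bop_addE bop_scaleE ell2D ell2Z !mulopE; try exact: realc_bounded.
    by rewrite realcD realcM; ring.
  by apply: realc_bounded; exact: rboundedZD.
have tauD a S T : tau (a *: S + T) = a * tau S + tau T by [].
have mcst C : m (fun=> C) = C.
  have e : mulop (fun=> C%:C%C) = C%:C%C *: bop1 :> B.
    apply: bopP => x; apply: ell2P => i; rewrite mulopE//.
    exact: realc_bounded (rbounded_cst C).
  rewrite /m e EZ (Eid vN1) -[tau _]/(C%:C%C * (delta 1%g) 1%g) deltaE eqxx mulr1.
  by [].
have mlin a f f' : rbounded f -> rbounded f' ->
    m (fun x => a * f x + f' x) = a * m f + m f'.
  move=> bf bf'; rewrite /m mulopD// ED EZ tauD ReD; congr (_ + _).
  by case: (tau _) => u v /=; ring.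
split=> //.
- move=> f bf f0; case: (bf) => C fC.
  have C0 : 0 <= C by exact: le_trans (fC 1%g).
  have : m (fun x => -1 * f x + C) <= C.
    apply: le_trans (ler_norm _) _; apply: le_trans (Re_le_cabs _) _.
    rewrite /tau -dot_deltar; apply: le_trans (dot_bop_le _ _ _) _.
    rewrite !nrm_delta !mulr1; apply: le_trans (Enorm _) _.
    apply: opnorm_mulop => // g; rewrite cabs_real ger0_norm; last first.
      by rewrite mulN1r addrC subr_ge0; exact: le_trans (ler_norm _) (fC g).
    by rewrite mulN1r gerDr oppr_le0.
  rewrite mlin//; last exact: rbounded_cst.
  rewrite mcst; lra.
- move=> f g bf; case: (bf) => C fC.
  pose K := `|C| + 1; have K0 : 0 < K by rewrite ltr_wpDl.
  pose h x := K^-1 * f x.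
  have h1 x : `|h x| <= 1.
    have Ki : 0 <= K^-1 by rewrite invr_ge0 ltW.
    rewrite /h normrM (ger0_norm Ki) ler_pdivrMl// mulr1.
    by apply: le_trans (fC x) _; rewrite (le_trans (ler_norm C))// lerDl.
  have bh : rbounded h by exists 1.
  have mf f' : rbounded f' -> m (fun x => K^-1 * f' x) = K^-1 * m f'.
    move=> bf'; have := mlin K^-1 f' (fun=> 0) bf' (rbounded_cst 0).
    by rewrite mcst addr0 => <-; congr m; apply/funext => x; rewrite addr0.
  have bfg : rbounded (fun x => f (g * x)%g) by exists C => x.
  apply: (mulfI (_ : K^-1 != 0)); first by rewrite invr_eq0 gt_eqF.
  rewrite -!mf// -/h -[LHS]/(m (fun x => h (g * x)%g)) /m; congr complex.Re.
  have bhg : rbounded (fun x => h (g * x)%g) by exists 1 => x; exact: h1.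
  pose x := mulop (fun k => (h (g * k)%g)%:C%C) : B.
  have x1 : opnorm x <= 1.
    by apply: opnorm_mulop => // k; rewrite cabs_real.
  have xx : adjoint_pair x x.
    have := mulop_adjoint (realc_bounded bhg).
    by rewrite (_ : (fun i => conjc _) = (fun k => (h (g * k)%g)%:C%C))//;
      apply/funext => k; rewrite conjc_real.
  have e1 : mulop (fun k => (h k)%:C%C) = bcomp (lam g) (bcomp x (lam g^-1%g)).
    apply: bopP => u; apply: ell2P => k.
    rewrite !bcompE lregE !mulopE; try exact: realc_bounded.
    by rewrite lregE invgK mulVKg.
  have e2 : mulop (fun k => (h (g * k)%g)%:C%C) = bcomp (bcomp x (lam g^-1%g)) (lam g).
    by apply: bopP => u; rewrite !bcompE lregVK.
  rewrite e1 e2; apply/esym/(@hypertrace g _ (bcomp (lam g) x)).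
  + by move=> u v; rewrite !bcompE xx dot_lreg invgK.
  + apply: opnorm_le => // u; rewrite bcompE; apply: le_trans (bop_bound _ _) _.
    by rewrite nrm_lreg ler_wpM2r ?nrm_ge0.
  + apply: opnorm_le => // u; rewrite bcompE nrm_lreg; apply: le_trans (bop_bound _ _) _.
    by rewrite ler_wpM2r ?nrm_ge0.
Qed.

End Hypertrace.

(** * Multipliers by finitely supported positive definite functions *)

Section Truncation.
Context {R : realType} {I : choiceType}.
Local Notation H := (ell2 R I).
Local Notation B := (bop R I).
Local Notation nrm := (@ell2_norm R I).

Lemma dot_supported (x y : H) (D : seq I) : (forall i, i \notin D -> x i = 0) ->
  dot x y = \sum_(i <- undup D) x i * conjc (y i).
Proof.
move=> xD; have {1}-> : x = trunc D x.
  by apply: ell2P => i; rewrite truncE; case: ifPn => // /xD.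
by rewrite /trunc dot_suml; apply: eq_bigr => i _; rewrite dotZl dot_deltal.
Qed.

Lemma nrm_comb (K : seq I) (a : I -> R[i]) : uniq K ->
  nrm (\sum_(k <- K) a k *: delta k) ^+ 2 = \sum_(k <- K) cabs (a k) ^+ 2.
Proof.
move=> uK; set x := \sum_(k <- K) _.
have xE k : k \in K -> x k = a k.
  move=> kK; rewrite /x ell2_sum (bigD1_seq k)// big1 => [|j jk].
    by rewrite [LHS]addr0 ell2Z deltaE eqxx mulr1.
  by rewrite ell2Z deltaE (negPf jk) mulr0.
apply: (@complexI R); rewrite -dotxx {2}/x dot_sumr (rmorph_sum (real_complex R)) /=.
rewrite [LHS]big_seq [RHS]big_seq; apply: eq_bigr => k kK.
by rewrite dotZr dot_deltar xE// mulrC mulc_conj.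
Qed.

Lemma dot_comb (T : B) (K K' : seq I) (a b : I -> R[i]) :
  dot (T (\sum_(k <- K) a k *: delta k)) (\sum_(h <- K') b h *: delta h) =
  \sum_(k <- K) \sum_(h <- K') a k * conjc (b h) * T (delta k) h.
Proof.
rewrite bop_sum dot_suml; apply: eq_bigr => k _; rewrite dot_sumr.
by apply: eq_bigr => h _; rewrite bopZ dotZl dotZr dot_deltar mulrA.
Qed.

(** The list depends on the operator only through a bound of its norm. *)
Lemma approx_form (C : R) (x y : H) e : 0 < e -> exists K0 : seq I,
  forall K (Y : B), {subset K0 <= K} -> opnorm Y <= C ->
    cabs (dot (Y x) y - dot (Y (trunc K x)) (trunc K y)) <= e.
Proof.
move=> e0; pose c := `|C| * (nrm x + nrm y) + 1.
have c0 : 0 < c by rewrite ltr_wpDl// mulr_ge0// addr_ge0 ?nrm_ge0.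
have [K1 h1] := trunc_dense x (divr_gt0 e0 c0).
have [K2 h2] := trunc_dense y (divr_gt0 e0 c0).
exists (K1 ++ K2) => K Y hK YC.
have {}YC : opnorm Y <= `|C| by apply: le_trans YC (ler_norm _).
have /ltW {}h1 : nrm (x - trunc K x) < e / c.
  by apply: h1 => k kK; apply: hK; rewrite mem_cat kK.
have /ltW {}h2 : nrm (y - trunc K y) < e / c.
  by apply: h2 => k kK; apply: hK; rewrite mem_cat kK orbT.
have -> : dot (Y x) y - dot (Y (trunc K x)) (trunc K y) =
    dot (Y (x - trunc K x)) y + dot (Y (trunc K x)) (y - trunc K y).
  by rewrite bopB dotBl dotBr; ring.
apply: le_trans (le_normcD _ _) _.
have b1 := dot_bop_le Y (x - trunc K x) y.
have b2 := dot_bop_le Y (trunc K x) (y - trunc K y).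
have t1 : opnorm Y * nrm (x - trunc K x) * nrm y <= `|C| * nrm y * (e / c).
  rewrite mulrAC; apply: ler_pM => //; rewrite ?mulr_ge0 ?opnorm_ge0 ?nrm_ge0//.
  by rewrite ler_wpM2r ?nrm_ge0.
have t2 : opnorm Y * nrm (trunc K x) * nrm (y - trunc K y) <= `|C| * nrm x * (e / c).
  apply: ler_pM => //; rewrite ?mulr_ge0 ?opnorm_ge0 ?nrm_ge0//.
  by apply: ler_pM; rewrite ?opnorm_ge0 ?nrm_ge0// nrm_trunc_le.
apply: le_trans (lerD (le_trans b1 t1) (le_trans b2 t2)) _.
rewrite -mulrDl -mulrDr (addrC (nrm y)) mulrCA ger_pMr// ler_pdivrMr// mul1r.
by rewrite /c lerDl.
Qed.

Lemma approx_form_sum (J : Type) (r : seq J) (Y : J -> B) (x y : J -> H) e : 0 < e ->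
  exists K0 : seq I, forall K, {subset K0 <= K} ->
    cabs (\sum_(j <- r) dot (Y j (x j)) (y j) -
          \sum_(j <- r) dot (Y j (trunc K (x j))) (trunc K (y j))) <= e.
Proof.
elim: r e => [|j r IH] e e0.
  by exists [::] => K _; rewrite !big_nil subr0 Normc.normc0 ltW.
have e2 : 0 < e / 2 by rewrite divr_gt0.
have [K1 h1] := IH _ e2; have [K2 h2] := approx_form (opnorm (Y j)) (x j) (y j) e2.
exists (K1 ++ K2) => K hK; rewrite !big_cons opprD addrACA.
apply: le_trans (le_normcD _ _) _; rewrite [leRHS](_ : e = e / 2 + e / 2); last by field.
apply: lerD; first by apply: h2 => // k kK; apply: hK; rewrite mem_cat kK orbT.
by apply: h1 => k kK; apply: hK; rewrite mem_cat kK.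
Qed.

Lemma ge0_limit (z : R[i]) : (forall e, 0 < e -> exists w, 0 <= w /\ cabs (z - w) <= e) ->
  0 <= z.
Proof.
move=> h; rewrite lecE; apply/andP; split.
  rewrite -normr_eq0 eq_le normr_ge0 andbT; apply/ler_addgt0Pr => e e0; rewrite add0r.
  have [w [w0 we]] := h e e0; move: w0; rewrite lecE => /andP[/eqP /= iw _].
  apply: le_trans we; apply: le_trans (Im_le_cabs _).
  by move: iw; case: (z) => a b; case: (w) => c d /= ->; rewrite subr0.
apply/ler_addgt0Pr => e e0.
have [w [w0 we]] := h e e0; move: w0; rewrite lecE => /andP[_ /= rw].
have := le_trans (Re_le_cabs _) we; rewrite ReB ler_norml => /andP[].
by rewrite /=; lra.
Qed.

(** The quadratic bound is applied to a multiple of T x of the same norm as x. *)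
Lemma opnorm_le_form (T : B) C : 0 <= C ->
  (forall x y, 2 * cabs (dot (T x) y) <= C * (nrm x ^+ 2 + nrm y ^+ 2)) -> opnorm T <= C.
Proof.
move=> C0 h; apply: opnorm_le => // x.
have [->|x0] := eqVneq (nrm (T x)) 0; first by rewrite mulr_ge0 ?nrm_ge0.
have Tp : 0 < nrm (T x) by rewrite lt_neqAle eq_sym x0 nrm_ge0.
have xp : 0 < nrm x.
  rewrite lt_neqAle nrm_ge0 andbT eq_sym; apply: contra_neq x0 => /nrm_eq0 ->.
  by rewrite bop0 nrm0.
have := h x ((nrm x / nrm (T x))%:C%C *: T x).
rewrite dotZr conjc_real dotxx -realcM cabs_real nrmZ cabs_real !ger0_norm//; last 2 first.
- by rewrite divr_ge0 ?nrm_ge0.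
- by rewrite mulr_ge0 ?sqr_ge0 ?divr_ge0 ?nrm_ge0.
rewrite mulfVK// (_ : nrm x / nrm (T x) * _ = nrm (T x) * nrm x); last by field.
rewrite [X in _ -> _ <= X](_ : _ = C * nrm x)// => le.
have : 2 * nrm x * nrm (T x) <= 2 * nrm x * (C * nrm x) by move: le; nra.
by rewrite ler_pM2l// mulr_gt0.
Qed.

End Truncation.

Section Multiplier.
Context {R : realType} {Gamma : groupType}.
Local Notation H := (ell2 R Gamma).
Local Notation B := (bop R Gamma).
Local Notation nrm := (@ell2_norm R Gamma).
Local Notation M := (group_vN R Gamma).
Local Notation lam := (@lregular R Gamma).
Local Notation delta := (@delta R Gamma).
Variables (xi : H) (A : seq Gamma).
Hypotheses (xiA : supported xi A) (xi1 : nrm xi = 1).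

Definition posdef g : R[i] := dot (lam g xi) xi.

Definition posdef_support : seq Gamma := undup [seq (a * b^-1)%g | a <- A, b <- A].

(** The Schur multiplier of the matrix posdef (h * k^-1), written as a finite sum
    that makes sense for all operators and agrees with it on the algebra. *)
Definition multiplier (T : B) : B :=
  \sum_(g <- posdef_support) (posdef g * T (delta 1%g) g) *: lam g.

Lemma posdef1 : posdef 1%g = 1.
Proof. by rewrite /posdef lreg1 dotxx xi1 expr1n. Qed.

Lemma posdef_out g : g \notin posdef_support -> posdef g = 0.
Proof.
move=> gS; rewrite /posdef dotC (dot_supported _ xiA) big1_seq ?conjc0// => t.
rewrite mem_undup => /andP[_ tA]; rewrite lregE.
suff /xiA -> : (g^-1 * t)%g \notin A by rewrite conjc0 mulr0.
apply: contra gS => gt; rewrite mem_undup; apply/allpairsP.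
by exists (t, (g^-1 * t)%g); split=> //=; rewrite invgM invgK mulVKg.
Qed.

Lemma multiplier_vN T : M (multiplier T).
Proof. by apply: vN_sum => g _; apply: vNZ; exact: vN_lreg. Qed.

Lemma multiplier_coord T k h : M T ->
  multiplier T (delta k) h = posdef (h * k^-1)%g * T (delta k) h.
Proof.
move=> hT; rewrite /multiplier bop_sumE ell2_sum (vN_coord k h hT).
have e g : ((posdef g * T (delta 1%g) g) *: lam g) (delta k) h =
    posdef g * T (delta 1%g) g * (g == h * k^-1)%g%:R.
  rewrite bop_scaleE ell2Z lreg_delta deltaE; congr (_ * _%:R); congr nat_of_bool.
  by rewrite -[RHS](inj_eq (@mulIg _ k)) mulgVK.
under eq_bigr do rewrite e.
have [hS|hS] := boolP ((h * k^-1)%g \in posdef_support).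
  rewrite (bigD1_seq _ hS) ?undup_uniq// big1 => [|g gh]; last by rewrite (negPf gh) mulr0.
  by rewrite [LHS]addr0 eqxx mulr1.
rewrite (posdef_out hS) mul0r big1_seq// => g /andP[_ gS].
by case: eqP => [gh|_]; [rewrite gh (negPf hS) in gS|rewrite mulr0].
Qed.

Lemma multiplier_linear a S T : multiplier (a *: S + T) = a *: multiplier S + multiplier T.
Proof.
rewrite /multiplier scaler_sumr -big_split /=; apply: eq_bigr => g _.
rewrite -[X in (posdef g * X) *: _]/(a * S (delta 1%g) g + T (delta 1%g) g).
by rewrite scalerA -scalerDl; congr (_ *: _); ring.
Qed.

Lemma multiplier1 : multiplier bop1 = bop1.
Proof.
apply: bop_ext => k; apply: ell2P => h; rewrite multiplier_coord; last exact: vN1.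
rewrite -[bop1 _]/(delta k) deltaE; case: eqP => [->|_]; last by rewrite mulr0.
by rewrite mulgV posdef1 mulr1.
Qed.

(** Contains every s for which xi (k * s) is nonzero for some k in K. *)
Definition window (K : seq Gamma) : seq Gamma :=
  undup [seq (k^-1 * a)%g | k <- undup K, a <- A].

Definition cut (s : Gamma) (K : seq Gamma) (x : H) : H :=
  \sum_(k <- undup K) (x k * xi (k * s)%g) *: delta k.

Lemma posdef_window K k h : k \in K ->
  posdef (h * k^-1)%g = \sum_(s <- window K) xi (k * s)%g * conjc (xi (h * s)%g).
Proof.
move=> kK; rewrite /posdef lregM dot_lreg (@dot_supported _ _ _ _ (window K)).
  by rewrite undup_id ?undup_uniq//; apply: eq_bigr => s _; rewrite !lregE !invgK.
move=> s sD; rewrite lregE invgK xiA//; apply: contra sD => ks.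
rewrite mem_undup; apply/allpairsP; exists (k, (k * s)%g); split => //=.
  by rewrite mem_undup.
by rewrite mulKg.
Qed.

(** On truncated vectors the multiplier is the compression of a finite direct
    sum of copies of the identity representation. *)
Lemma multiplier_form T K x y : M T ->
  dot (multiplier T (trunc K x)) (trunc K y) =
  \sum_(s <- window K) dot (T (cut s K x)) (cut s K y).
Proof.
move=> hT; rewrite /trunc dot_comb; under [RHS]eq_bigr do rewrite /cut dot_comb.
rewrite [RHS]exchange_big /= big_seq [RHS]big_seq; apply: eq_bigr => k.
rewrite mem_undup => kK; rewrite [RHS]exchange_big /=; apply: eq_bigr => h _.
rewrite multiplier_coord// (posdef_window h kK) mulr_suml mulr_sumr.
by apply: eq_bigr => s _; rewrite conjcM; ring.
Qed.

Lemma cut_nrm K x : \sum_(s <- window K) nrm (cut s K x) ^+ 2 <= nrm x ^+ 2.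
Proof.
apply: (@le_trans _ _ (nrm (trunc K x) ^+ 2)); last first.
  by rewrite ler_pXn2r ?nnegrE ?nrm_ge0// nrm_trunc_le.
rewrite nrm_trunc; under eq_bigr do rewrite /cut nrm_comb ?undup_uniq//.
rewrite exchange_big /=; apply: ler_sum => k _.
under eq_bigr do rewrite Normc.normcM exprMn.
rewrite -mulr_sumr -[leRHS]mulr1 ler_wpM2l ?sqr_ge0//.
have -> : 1 = nrm (lam k^-1%g xi) ^+ 2 by rewrite nrm_lreg xi1 expr1n.
apply: (@le_trans _ _ (nrm (trunc (window K) (lam k^-1%g xi)) ^+ 2)); last first.
  by rewrite ler_pXn2r ?nnegrE ?nrm_ge0// nrm_trunc_le.
rewrite nrm_trunc undup_id ?undup_uniq//; apply: ler_sum => s _.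
by rewrite lregE invgK.
Qed.

Lemma multiplier_cp : completely_positive M multiplier.
Proof.
move=> n X XM Xpos x; apply: ge0_limit => e e0.
pose Y (p : 'I_n * 'I_n) := multiplier (X p.1 p.2).
have [K0 hK0] := approx_form_sum (index_enum ('I_n * 'I_n)%type) Y
  (fun p => x p.2) (fun p => x p.1) e0.
pose F (i j : 'I_n) := dot (multiplier (X i j) (trunc K0 (x j))) (trunc K0 (x i)).
have hw := hK0 K0 (fun _ => id).
exists (\sum_p F p.1 p.2); split.
  rewrite -(pair_bigA _ F) /F.
  under eq_bigr do under eq_bigr do rewrite multiplier_form//.
  under eq_bigr do rewrite exchange_big /=.
  rewrite exchange_big /=; apply: sumr_ge0 => s _; exact: Xpos.
rewrite pair_bigA /=; apply: le_trans hw.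
rewrite le_eqVlt; apply/orP; left; apply/eqP; congr (cabs (_ - _)).
by apply: eq_bigr => p _; rewrite mxE.
Qed.

Lemma multiplier_norm T : M T -> opnorm (multiplier T) <= opnorm T.
Proof.
move=> hT; apply: opnorm_le_form => [|x y]; first exact: opnorm_ge0.
apply/ler_addgt0Pr => e e0.
have e2 : 0 < e / 2 by rewrite divr_gt0.
have [K hK] := approx_form (opnorm (multiplier T)) x y e2.
have {hK} := hK K (multiplier T) (fun _ => id) (lexx _).
rewrite multiplier_form//; set w := \sum_(s <- _) _ => hw.
have w2 : 2 * cabs w <= opnorm T * (nrm x ^+ 2 + nrm y ^+ 2).
  apply: (@le_trans _ _ (\sum_(s <- window K)
      opnorm T * (nrm (cut s K x) ^+ 2 + nrm (cut s K y) ^+ 2))).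
    apply: (@le_trans _ _ (2 * \sum_(s <- window K) cabs (dot (T (cut s K x)) (cut s K y)))).
      by rewrite /w ler_wpM2l// cabs_sum.
    rewrite mulr_sumr; apply: ler_sum => s _.
    have := dot_bop_le T (cut s K x) (cut s K y).
    have := opnorm_ge0 T; have := sqr_ge0 (nrm (cut s K x) - nrm (cut s K y)).
    nra.
  rewrite -mulr_sumr big_split /= ler_wpM2l ?opnorm_ge0// lerD// cut_nrm//.
have := le_normcD (dot (multiplier T x) y - w) w; rewrite subrK => h.
lra.
Qed.

Lemma multiplier_finite_rank : finite_rank M multiplier.
Proof.
exists (size posdef_support), (fun i => lam (nth 1%g posdef_support i)) => T _.
exists (fun i => posdef (nth 1%g posdef_support i) * T (delta 1%g) (nth 1%g posdef_support i)).
by rewrite /multiplier (big_nth 1%g) big_mkord.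
Qed.

Lemma posdef_near1 g : cabs (posdef g - 1) <= nrm (lam g xi - xi).
Proof.
have -> : posdef g - 1 = dot (lam g xi - xi) xi.
  by rewrite dotBl dotxx xi1 expr1n.
by apply: le_trans (cauchy_schwarz _ _) _; rewrite xi1 mulr1.
Qed.

End Multiplier.

(** * Ultraweak functionals on bounded sets *)

Section UltraweakEstimates.
Context {R : realType} {I : choiceType}.
Local Notation H := (ell2 R I).
Local Notation B := (bop R I).
Local Notation nrm := (@ell2_norm R I).
Variable p : uw_index R I.

Lemma norm_seq_ss (v : nat -> H) : (\sum_(n <oo) (nrm (v n) ^+ 2)%:E < +oo)%E ->
  (fun n => (nrm (v n))%:C%C) \in @square_summable R nat.
Proof.
rewrite nneseries_esumT; last by move=> n; rewrite lee_fin sqr_ge0.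
rewrite unfold_in /sqsum => h.
by under eq_esum do rewrite cabs_real ger0_norm ?nrm_ge0//.
Qed.

Let zl : ell2 R nat := Ell2 (norm_seq_ss (uw_leftP p)).
Let zr : ell2 R nat := Ell2 (norm_seq_ss (uw_rightP p)).

Let uterm (T : B) n := dot (T (uw_left p n)) (uw_right p n).

Let uterm_le T n : cabs (uterm T n) <= opnorm T * cabs (zl n * conjc (zr n)).
Proof.
apply: le_trans (dot_bop_le _ _ _) _; rewrite -mulrA Normc.normcM cabs_conj !cabs_real.
by rewrite !ger0_norm ?nrm_ge0.
Qed.

Lemma uterm_csummable T : csummable (uterm T).
Proof.
have /csummableP s := dot_csummable zl zr.
apply/csummableP; apply: rsummable_le (rsummableZ (opnorm T) s) => n.
rewrite (ger0_norm (cabs_ge0 _)); apply: le_trans (uterm_le T n) (ler_norm _).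
Qed.

Lemma uw_linear a S T :
  uw_functional p (a *: S + T) = a * uw_functional p S + uw_functional p T.
Proof.
rewrite /uw_functional -csumZ; last exact: uterm_csummable.
rewrite -csumD; [|apply: csummableZ; exact: uterm_csummable|exact: uterm_csummable].
by congr csum; apply/funext => n; rewrite bop_addE bop_scaleE dotDl dotZl.
Qed.

Lemma uw0 : uw_functional p 0 = 0.
Proof.
have := uw_linear 1 0 0; rewrite scale1r addr0 mul1r => /eqP.
by rewrite -[X in X == _]addr0 (inj_eq (addrI _)) eq_sym => /eqP.
Qed.

Lemma uwB S T : uw_functional p (S - T) = uw_functional p S - uw_functional p T.
Proof. by rewrite addrC -scaleN1r uw_linear mulN1r addrC. Qed.

Lemma uw_sum (J : Type) (r : seq J) (F : J -> B) (c : J -> R[i]) :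
  uw_functional p (\sum_(j <- r) c j *: F j) = \sum_(j <- r) c j * uw_functional p (F j).
Proof. by elim: r => [|j r IH]; rewrite ?big_nil ?uw0// !big_cons uw_linear IH. Qed.

Lemma csum_finite (u : nat -> R[i]) (D : seq nat) : uniq D ->
  (forall n, n \notin D -> u n = 0) -> csum u = \sum_(n <- D) u n.
Proof.
move=> uD u0; pose x : ell2 R nat := \sum_(n <- D) u n *: delta n.
pose y : ell2 R nat := \sum_(n <- D) 1 *: delta n.
have xE (a : nat -> R[i]) n : (\sum_(m <- D) a m *: delta m : ell2 R nat) n =
    if n \in D then a n else 0.
  rewrite ell2_sum; case: ifPn => nD; last first.
    rewrite big1_seq// => m /andP[_ mD]; rewrite ell2Z deltaE.
    by case: eqP => [mn|]; [rewrite -mn mD in nD|rewrite mulr0].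
  rewrite (bigD1_seq n)// big1 => [|m mn]; last by rewrite ell2Z deltaE (negPf mn) mulr0.
  by rewrite [LHS]addr0 ell2Z deltaE eqxx mulr1.
have -> : csum u = dot x y.
  rewrite /dot; congr csum; apply/funext => n; rewrite /x /y !xE.
  by case: ifPn => [_|/u0 ->]; rewrite ?conjc1 ?mulr1// mul0r.
rewrite (@dot_supported _ _ _ _ D) ?undup_id//.
  rewrite big_seq [RHS]big_seq; apply: eq_bigr => n nD.
  by rewrite /x /y !xE nD conjc1 mulr1.
by move=> n nD; rewrite /x xE (negPf nD).
Qed.

(** The terms are bounded by the products of two square-summable sequences of norms,
    and the tail of one of them is small by truncation. *)
Lemma uw_tail (C e : R) : 0 < e -> exists F : seq nat, forall T : B, opnorm T <= C ->
  cabs (uw_functional p T - \sum_(n <- F) dot (T (uw_left p n)) (uw_right p n)) <= e.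
Proof.
move=> e0; pose c := `|C| * ell2_norm zr + 1.
have c0 : 0 < c by rewrite ltr_wpDl// mulr_ge0// nrm_ge0.
have [A /(_ A (fun _ => id))/ltW hA] := trunc_dense zl (divr_gt0 e0 c0).
exists (undup A) => T TC.
have {}TC : opnorm T <= `|C| by apply: le_trans TC (ler_norm _).
pose u1 n := if n \in A then uterm T n else 0.
pose u2 n := if n \in A then 0 else uterm T n.
have /csummableP s := uterm_csummable T.
have s1 : csummable u1.
  apply/csummableP; apply: rsummable_le s => n; rewrite !(ger0_norm (cabs_ge0 _)) /u1.
  by case: ifP => // _; rewrite Normc.normc0 cabs_ge0.
have s2 : csummable u2.
  apply/csummableP; apply: rsummable_le s => n; rewrite !(ger0_norm (cabs_ge0 _)) /u2.
  by case: ifP => // _; rewrite Normc.normc0 cabs_ge0.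
have -> : uw_functional p T = csum u1 + csum u2.
  rewrite -csumD// /uw_functional; congr csum; apply/funext => n.
  by rewrite /u1 /u2; case: ifP => _; rewrite ?addr0 ?add0r.
rewrite (@csum_finite u1 (undup A)) ?undup_uniq//; last first.
  by move=> n; rewrite mem_undup /u1 => /negPf ->.
have -> : \sum_(n <- undup A) u1 n =
    \sum_(n <- undup A) dot (T (uw_left p n)) (uw_right p n).
  rewrite big_seq [RHS]big_seq; apply: eq_bigr => n; rewrite mem_undup /u1 => ->.
  by [].
rewrite addrAC subrr add0r; apply: le_trans (cabs_csum s2) _.
pose d := zl - trunc A zl.
have [sd _] := dot_csummable d zr.
apply: (@le_trans _ _ (rsum (fun n => `|C| * complex.Re (d n * conjc (zr n))))).
  apply: le_rsum => [||n]; first exact/csummableP.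
    exact: rsummableZ.
  have dE : d n = if n \in A then 0 else zl n.
    by rewrite /d ell2D ell2N truncE; case: ifP => _; rewrite ?subrr ?subr0.
  rewrite dE /u2; case: ifP => _; first by rewrite Normc.normc0 mul0r mulr0.
  apply: le_trans (uterm_le T n) _.
  rewrite [zl n]/((nrm (uw_left p n))%:C%C) [zr n]/((nrm (uw_right p n))%:C%C).
  rewrite conjc_real -realcM cabs_real ger0_norm ?mulr_ge0 ?nrm_ge0//=.
  by rewrite ler_wpM2r// mulr_ge0 ?nrm_ge0.
rewrite rsumZ// -[rsum _]/(complex.Re (dot d zr)).
have h : complex.Re (dot d zr) <= e / c * ell2_norm zr.
  apply: le_trans (ler_norm _) _; apply: le_trans (Re_le_cabs _) _.
  by apply: le_trans (cauchy_schwarz _ _) _; rewrite ler_wpM2r ?nrm_ge0.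
apply: le_trans (ler_wpM2l (normr_ge0 C) h) _.
rewrite mulrCA mulrAC -mulrA ger_pMr// ler_pdivrMr// mul1r.
by rewrite /c lerDl.
Qed.

End UltraweakEstimates.

(** * The net of multipliers *)

Section InitialCvg.

Lemma cvg_initial (S : choiceType) (T : topologicalType) (f : S -> T)
    (L : Type) (F : set_system L) (u : L -> S) (s : S) : Filter F ->
  (f \o u) @ F --> f s -> u @ F --> (s : initial_topology f).
Proof.
move=> FF h A [_ [[B oB <-] Bs] sBA].
apply: (filterS (P := u @^-1` (f @^-1` B))); first by move=> l; exact: sBA.
by apply: h; exact: open_nbhs_nbhs.
Qed.

Context {R : realType} {I : choiceType}.

Lemma cvg_ultraweak (L : Type) (F : set_system L) (u : L -> bop R I) (x : bop R I) :
  Filter F -> (forall p, (uw_functional p \o u) @ F --> uw_functional p x) ->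
  u @ F --> x.
Proof.
move=> FF h; apply/cvg_sup => p; apply: cvg_initial; exact: h.
Qed.

End InitialCvg.

Section MultiplierNet.
Context {R : realType} {Gamma : groupType}.
Local Notation H := (ell2 R Gamma).
Local Notation B := (bop R Gamma).
Local Notation nrm := (@ell2_norm R Gamma).
Local Notation M := (group_vN R Gamma).
Local Notation lam := (@lregular R Gamma).
Local Notation delta := (@delta R Gamma).

Lemma multiplier_normal (xi : H) (A : seq Gamma) : normal_map M (multiplier xi A).
Proof.
apply: continuous_subspaceT => x.
have FF := @nbhs_filter (bop R Gamma) x.
apply: cvg_ultraweak => p.
rewrite (_ : _ \o _ = fun T => \sum_(g <- posdef_support A)
    (posdef xi g * uw_functional (vec_index (delta 1%g) (delta g)) T) *
      uw_functional p (lam g)); last first.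
  apply/funext => T; rewrite /= /multiplier uw_sum; apply: eq_bigr => g _.
  by rewrite uw_vec dot_deltar.
rewrite (_ : uw_functional p _ = \sum_(g <- posdef_support A)
    (posdef xi g * uw_functional (vec_index (delta 1%g) (delta g)) x) *
      uw_functional p (lam g)); last first.
  rewrite /multiplier uw_sum; apply: eq_bigr => g _.
  by rewrite uw_vec dot_deltar.
apply: cvg_big => [|g _]; first exact: add_continuous.
apply: cvgM; last exact: cvg_cst.
apply: cvgM; first exact: cvg_cst.
exact: uw_continuous.
Qed.

Lemma multiplier_nfr (xi : H) (A : seq Gamma) : supported xi A -> nrm xi = 1 ->
  normal_finite_rank_ucp M (multiplier xi A).
Proof.
move=> xiA xi1; split.
- by move=> T _; exact: multiplier_vN.
- by move=> a S T _ _; exact: multiplier_linear.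
- exact: multiplier_cp.
- exact: multiplier1.
- by split; [exact: multiplier_normal|exact: multiplier_finite_rank].
Qed.

Definition nearly_invariant (W : seq Gamma) (d : R) (xi : H) (A : seq Gamma) :=
  [/\ supported xi A, nrm xi = 1 & forall g, g \in W -> nrm (lam g xi - xi) <= d].

Lemma opnormB (S T : B) : opnorm (S - T) <= opnorm S + opnorm T.
Proof.
apply: opnorm_le => [x|]; last by rewrite addr_ge0 ?opnorm_ge0.
rewrite bop_addE bop_oppE mulrDl; apply: le_trans (nrmB _ _) _.
by rewrite lerD// bop_bound.
Qed.

Lemma multiplier_diff_norm xi A T : M T -> supported xi A -> nrm xi = 1 ->
  opnorm (multiplier xi A T - T) <= 2 * opnorm T.
Proof.
move=> hT xiA xi1; apply: le_trans (opnormB _ _) _.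
by rewrite mulr_natl mulr2n lerD2r multiplier_norm.
Qed.

(** Matrix entries of the difference are those of T times posdef - 1, and finitely
    many of them determine the form up to a small error. *)
Lemma multiplier_form_small (T : B) x y e : M T -> 0 < e ->
  exists W d, 0 < d /\ forall xi A, nearly_invariant W d xi A ->
    cabs (dot ((multiplier xi A T - T) x) y) <= e.
Proof.
move=> hT e0; have e2 : 0 < e / 2 by rewrite divr_gt0.
have [K hK] := approx_form (2 * opnorm T) x y e2.
pose s : R := \sum_(k <- undup K) \sum_(h <- undup K)
  cabs (x k * conjc (y h)) * cabs (T (delta k) h).
have s0 : 0 <= s by do 2! apply: sumr_ge0 => ? _; rewrite mulr_ge0 ?cabs_ge0.
exists [seq (h * k^-1)%g | k <- undup K, h <- undup K], (e / 2 / (s + 1)).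
have s1 : 0 < s + 1 by rewrite ltr_wpDl.
split=> [|xi A [xiA xi1 hW]]; first exact: divr_gt0.
have := hK K (multiplier xi A T - T) (fun _ => id) (multiplier_diff_norm hT xiA xi1).
set w := dot _ (trunc K y) => h1.
have h2 : cabs w <= e / 2.
  rewrite /w /trunc dot_comb; apply: le_trans (cabs_sum _ _ _) _.
  apply: (@le_trans _ _ (e / 2 / (s + 1) * s)); last first.
    by rewrite -mulrA ger_pMr// mulrC ler_pdivrMr// mul1r lerDl.
  rewrite /s mulr_sumr big_seq [leRHS]big_seq; apply: ler_sum => k kK.
  apply: le_trans (cabs_sum _ _ _) _.
  rewrite mulr_sumr big_seq [leRHS]big_seq; apply: ler_sum => h hK'.
  rewrite bop_addE bop_oppE ell2D ell2N multiplier_coord//.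
  rewrite -[X in _ - X]mul1r -mulrBl !Normc.normcM [leLHS]mulrCA ler_wpM2r//.
    by rewrite mulr_ge0 ?cabs_ge0 ?mulr_ge0 ?cabs_ge0.
  apply: le_trans (posdef_near1 xi1 _) _; apply: hW.
  by apply/allpairsP; exists (k, h).
have := le_normcD (dot ((multiplier xi A T - T) x) y - w) w; rewrite subrK; lra.
Qed.

Lemma multiplier_uw_small (T : B) p e : M T -> 0 < e ->
  exists W d, 0 < d /\ forall xi A, nearly_invariant W d xi A ->
    cabs (uw_functional p (multiplier xi A T - T)) <= e.
Proof.
move=> hT e0; have e2 : 0 < e / 2 by rewrite divr_gt0.
have [F hF] := uw_tail p (2 * opnorm T) e2.
suff [W [d [d0 hd]]] : exists W d, 0 < d /\ forall xi A, nearly_invariant W d xi A ->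
    cabs (\sum_(n <- F) dot ((multiplier xi A T - T) (uw_left p n)) (uw_right p n)) <= e / 2.
  exists W, d; split=> // xi A hxi; have [xiA xi1 _] := hxi.
  have := hF _ (multiplier_diff_norm hT xiA xi1); have := hd xi A hxi.
  set w := \sum_(n <- F) _ => h1 h2.
  have := le_normcD (uw_functional p (multiplier xi A T - T) - w) w; rewrite subrK; lra.
elim: F (e / 2) e2 {hF} => [|n F IH] r r0.
  by exists [::], 1; split=> // xi A _; rewrite big_nil Normc.normc0 ltW.
have r2 : 0 < r / 2 by rewrite divr_gt0.
have [W1 [d1 [d10 h1]]] := multiplier_form_small (uw_left p n) (uw_right p n) hT r2.
have [W2 [d2 [d20 h2]]] := IH _ r2.
exists (W1 ++ W2), (Num.min d1 d2); split=> [|xi A [xiA xi1 hW]]; first by rewrite lt_min d10.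
rewrite big_cons; apply: le_trans (le_normcD _ _) _.
rewrite [leRHS](_ : r = r / 2 + r / 2); last by field.
apply: lerD; [apply: h1|apply: h2]; split=> // g gW.
  by apply: le_trans (hW g _) _; rewrite ?mem_cat ?gW// ge_min lexx.
by apply: le_trans (hW g _) _; rewrite ?mem_cat ?gW ?orbT// ge_min lexx orbT.
Qed.

Let L := (seq Gamma * nat)%type.
Let le (l k : L) : Prop := {subset l.1 <= k.1} /\ (l.2 <= k.2)%N.

Let le_directed : directed le.
Proof.
split; first by constructor; exact: ([::], 0%N).
- by move=> a; split.
- by move=> a b c [h1 h2] [h3 h4]; split=> [g /h1/h3//|]; exact: leq_trans h2 h4.
- move=> [W n] [W' n']; exists (W ++ W', maxn n n').
  split; split=> /= [g gW|]; rewrite ?mem_cat ?gW ?orbT//.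
    exact: leq_maxl.
  exact: leq_maxr.
Qed.

(** The multipliers of a net of almost invariant vectors form a bounded net that
    converges in matrix coefficients, hence ultraweakly, hence against every normal
    functional. *)
Theorem almost_invariant_not_separated (eps : R) : 0 < eps ->
  @almost_invariant_vectors R Gamma -> ~ separation_property M eps.
Proof.
move=> eps0 ai sep.
have /choice[v hv] (l : L) : exists v : H * seq Gamma,
    nearly_invariant l.1 (l.2.+1%:R)^-1 v.1 v.2.
  have [|x [A h]] := ai l.1 (l.2.+1%:R)^-1; first by rewrite invr_gt0.
  by exists (x, A).
pose Phi l := multiplier (v l).1 (v l).2.
have nfr l : normal_finite_rank_ucp M (Phi l).
  by have [h1 h2 _] := hv l; exact: multiplier_nfr.
have [x [om [Mx [oml omc] _ _]]] := sep L le Phi le_directed nfr.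
apply/negP; rewrite -leNgt.
pose tails (l : L) := [set k | le l k].
pose F := filter_from [set: L] tails.
have FF : Filter F.
  apply: filter_from_filter; first by exists ([::], 0%N).
  have [_ _ tr dir] := le_directed.
  move=> a b _ _; have [c [ac bc]] := dir a b; exists c => // k ck.
  by split; [exact: tr ac ck|exact: tr bc ck].
have cvPhi : (fun l => Phi l x) @ F --> x.
  apply: cvg_ultraweak => p; apply/cvgrPdist_le => e e0.
  have [r r0 er] : exists2 r : R, 0 < r & e = r%:C%C.
    move: e0; case: (e) => a b; rewrite ltcE /= => /andP[/eqP -> a0].
    by exists a.
  have [W [d [d0 hd]]] := multiplier_uw_small p Mx r0.
  exists (W, Num.trunc d^-1) => // k [Wk dk].
  rewrite /= er normr_cabs lecR -[_ - _]opprB normcN.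
  have -> : uw_functional p (Phi k x) - uw_functional p x = uw_functional p (Phi k x - x).
    by rewrite uwB.
  apply: hd; have [h1 h2 h3] := hv k; split=> // g gW.
  apply: le_trans (h3 g (Wk g gW)) _.
  rewrite -[leRHS]invrK lef_pV2 ?posrE ?invr_gt0//.
  apply: le_trans (ltW (truncnS_gt _)) _.
  by rewrite ler_nat ltnS.
have cvom : (fun l => om (Phi l x) : R[i]^o) @ F --> (om x : R[i]^o).
  have /subspace_continuousP/(_ x Mx) h := omc.
  apply: cvg_trans h => A hA.
  have hB : nbhs x [set y | M y -> A (om y)] := hA.
  have hF : F (fun l => M (Phi l x) -> A (om (Phi l x))) := cvPhi _ hB.
  suff : F (fun l => A (om (Phi l x))) by [].
  apply: (filterS _ hF) => l; apply.
  by have [PM _ _ _ _] := nfr l; exact: PM.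
move/cvgrPdist_le/(_ (eps%:C%C)) : cvom.
have eC : 0 < eps%:C%C by rewrite ltcR.
move=> /(_ eC)[l _ hl].
apply: (@le_trans _ _ (ereal_sup
  [set (cabs (om (x - Phi m x)%R))%:E | m in [set m | le l m]])).
  by apply: ereal_inf_lbound; exists l.
apply: ge_ereal_sup => _ [k lk <-]; rewrite lee_fin.
have -> : om (x - Phi k x) = om x - om (Phi k x).
  have [PM _ _ _ _] := nfr k; have := oml (-1) (Phi k x) x (PM _ Mx) Mx.
  by rewrite scaleN1r addrC => ->; rewrite -[_ *: _]/(-1 * om (Phi k x)) mulN1r addrC.
by have := hl k lk; rewrite /= normr_cabs lecR.
Qed.

End MultiplierNet.

Theorem corollaryC (R : realType) (Gamma : groupType) (eps : R)
    (heps : 0 < eps < 1) :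
  separation_property (group_vN R Gamma) eps <->
  ~ injective_vN (group_vN R Gamma).
Proof.
case/andP: heps => eps0 eps1; split.
  move=> sep [E [Elin EM Eid Enorm]].
  have hm := projection_mean Elin EM Eid Enorm.
  exact: (almost_invariant_not_separated eps0 (mean_almost_invariant hm) sep).
by move=> ninj; apply: contrapT => /(not_separated_injective eps1).
Qed.
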